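(* Let $\Gamma\subset I(\mathbb{R}^n)$ be a Bieberbach group of diagonal type with holonomy group isomorphic to $\mathbb{Z}_2^r$, and let $0\le p\le n$. (i) For every $s>0$, $$\sum_{\mu\ge 0}d_{p,\mu}(\Gamma)\,e^{-4\pi^2\mu s}=2^{-r}\sum_{d=1}^n K_p^n(n-d)\,(4\pi s)^{-\frac d2}\sum_{t=0}^d c_{d,t}(\Gamma)\,\theta_{d,t}\!\left(\tfrac{1}{4s}\right),$$ where, for $\operatorname{Re} z>0$, $$\theta_{d,t}(z)=\sum_{(m_1,\dots,m_d)\in\mathbb{Z}^d}e^{-z\left(\sum_{j=1}^t(\frac12+m_j)^2+\sum_{j=t+1}^d m_j^2\right)}.$$ (ii) Let $\Gamma'\subset I(\mathbb{R}^n)$ be another Bieberbach group of diagonal type with holonomy group isomorphic to $\mathbb{Z}_2^r$. Then $M_\Gamma$ and $M_{\Gamma'}$ are $p$-isospectral if and only if $$K_p^n(n-d)\,c_{d,t}(\Gamma)=K_p^n(n-d)\,c_{d,t}(\Gamma')\qquad\text{for each }1\le t\le d\le n.$$ In particular, if $c_{d,t}(\Gamma)=c_{d,t}(\Gamma')$ for every $d,t$, then $M_\Gamma$ and $M_{\Gamma'}$ are $p$-isospectral for all $p$. Moreover, if $K_p^n(x)$ has no integral roots and $M_\Gamma$ and $M_{\Gamma'}$ are $p$-isospectral, then they are Sunada isospectral. In particular, isospectrality (on functions) implies Sunada isospectrality.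
   Context: $I(\mathbb{R}^n)$ is the isometry group of $\mathbb{R}^n$; each element is written uniquely as $BL_b$ with $B\in O(n)$, $b\in\mathbb{R}^n$, where $L_b$ is translation by $b$, so $BL_b(x)=B(x+b)$. A Bieberbach group $\Gamma$ is a discrete, cocompact, torsion-free subgroup of $I(\mathbb{R}^n)$, and $M_\Gamma=\Gamma\backslash\mathbb{R}^n$. The translations in $\Gamma$ form a normal subgroup $\{L_\lambda:\lambda\in\Lambda\}$ of finite index, $\Lambda$ a lattice in $\mathbb{R}^n$, and $F=\Lambda\backslash\Gamma$ is the holonomy group. $\Gamma$ is of diagonal type if there is an orthonormal $\mathbb{Z}$-basis $\{e_1,\dots,e_n\}$ of $\Lambda$ such that $Be_i=\pm e_i$ for all $i$ and all $BL_b\in\Gamma$; then $F\simeq\mathbb{Z}_2^r$ for some $r\le n-1$. $d_{p,\mu}(\Gamma)$ is the multiplicity of $4\pi^2\mu$ as an eigenvalue of the Laplacian acting on $p$-forms of $M_\Gamma$ (all eigenvalues are of the form $4\pi^2\mu$ with $\mu\ge 0$; the sum over $\mu$ is over those with $d_{p,\mu}(\Gamma)\ne0$). $M_\Gamma$ and $M_{\Gamma'}$ are $p$-isospectral if these multiplicities coincide for all $\mu$; isospectral means $0$-isospectral. The Krawtchouk polynomial is $K_p^n(x)=\sum_{t=0}^p(-1)^t\binom{x}{t}\binom{n-x}{p-t}$. For $\Gamma$ of diagonal type and $BL_b\in\Gamma$ put $n_B=\dim\ker(B-\mathrm{Id})$ and $I_B=\{1\le i\le n: Be_i=e_i\}$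 (so $|I_B|=n_B$). For $i\in I_B$ one has $2\,b\cdot e_i\in\mathbb{Z}$. The Sunada numbers are, for $0\le t\le d\le n$, $$c_{d,t}(\Gamma)=\big|\{BL_b\in F: n_B=d\ \text{and}\ |\{i\in I_B: b\cdot e_i\equiv\tfrac12 \bmod \mathbb{Z}\}|=t\}\big|,$$ where $BL_b$ runs over representatives in $\Gamma$ of $F=\Lambda\backslash\Gamma$ (the conditions do not depend on the representative). For flat manifolds of diagonal type, $M_\Gamma$ and $M_{\Gamma'}$ are called Sunada isospectral when $c_{d,t}(\Gamma)=c_{d,t}(\Gamma')$ for all $0\le t\le d\le n$ (this is known to be equivalent to the pair satisfying the conditions of Sunada's theorem, and this characterization is to be taken as the definition here). *)

(* Defs.v *)
From HB Require Import structures.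
From mathcomp Require Import all_boot all_order all_algebra.
From mathcomp Require Import generic_quotient finmap complex.
From mathcomp Require Import all_classical all_reals all_analysis.
Set Implicit Arguments.
Unset Strict Implicit.
Unset Printing Implicit Defensive.
Import Order.TTheory GRing.Theory Num.Theory.
Import numFieldNormedType.Exports.
Local Open Scope classical_set_scope.
Local Open Scope ring_scope.


(* The pair (B, b) stands for the map B L_b : x |-> B (x + b); see [act].
   It is an isometry when B is orthogonal, and every isometry of R^n is of
   this form for a unique (B, b). *)
Notation affine R n := ('M[R]_n * 'cV[R]_n)%type.

Section isometries.
Context {R : realType} {n : nat}.
Implicit Types (g h : affine R n) (G : set (affine R n)).

Definition act g (x : 'cV[R]_n) : 'cV[R]_n := g.1 *m (x + g.2).

Definition isometries : set (affine R n) := [set g | g.1^T *m g.1 = 1%:M].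

Definition iso1 : affine R n := (1%:M, 0).
Definition isoM g h : affine R n := (g.1 *m h.1, h.1^T *m g.2 + h.2).
Definition isoV g : affine R n := (g.1^T, - (g.1 *m g.2)).
Definition isoX g (k : nat) : affine R n := iter k (isoM g) iso1.
Definition translation (v : 'cV[R]_n) : affine R n := (1%:M, v).

Lemma act1 x : act iso1 x = x.
Proof. by rewrite /act /= mul1mx addr0. Qed.

Lemma actM g h x : isometries h -> act (isoM g h) x = act g (act h x).
Proof.
rewrite /isometries /act /= => hh.
have hh' := mulmx1C hh.
rewrite -mulmxA; congr (_ *m _).
by rewrite !mulmxDr mulmxA hh' mul1mx addrAC addrA.
Qed.

Lemma actVK g x : isometries g -> act (isoV g) (act g x) = x.
Proof.
rewrite /isometries /act /= => gg.
by rewrite mulmxDr mulmxA gg mul1mx mulmxN mulmxA gg mul1mx addrK.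
Qed.

Definition isometry_subgroup G : Prop :=
  [/\ G `<=` isometries, G iso1,
      forall g h, G g -> G h -> G (isoM g h)
    & forall g, G g -> G (isoV g)].

(* Comparing orbits makes this an equivalence relation for any set G. *)
Definition orbit G (x : 'cV[R]_n) : set 'cV[R]_n := [set act g x | g in G].

Definition same_orbit G : rel 'cV[R]_n :=
  fun x y => `[< orbit G x = orbit G y >].

Lemma same_orbit_refl G : reflexive (same_orbit G).
Proof. by move=> x; apply/asboolP. Qed.
Lemma same_orbit_sym G : symmetric (same_orbit G).
Proof. by move=> x y; apply/asboolP/asboolP => ->. Qed.
Lemma same_orbit_trans G : transitive (same_orbit G).
Proof.
by move=> y x z /asboolP xy /asboolP yz; apply/asboolP; rewrite xy.
Qed.

Definition orbit_equiv G : equiv_rel 'cV[R]_n :=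
  EquivRel (same_orbit G) (same_orbit_refl G) (same_orbit_sym G)
    (@same_orbit_trans G).

Definition orbit_space G : topologicalType :=
  quotient_topology {eq_quot (orbit_equiv G)}%qT.

Definition Bieberbach G : Prop :=
  [/\ isometry_subgroup G,
      G `<=` isolated G,
      compact [set: orbit_space G]
    & forall g k, G g -> (0 < k)%N -> isoX g k = iso1 -> g = iso1].


Definition translations G : set 'cV[R]_n := [set v | G (translation v)].

Definition coset G g : set (affine R n) :=
  [set isoM (translation v) g | v in translations G].

Definition holonomy G : set (set (affine R n)) := [set coset G g | g in G].

Definition holonomy_iso_Z2 G (r : nat) : Prop :=
  exists phi : set (affine R n) -> 'rV['F_2]_r,
    set_bij (holonomy G) [set: 'rV['F_2]_r] phi /\
    (forall g h, G g -> G h ->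
       phi (coset G (isoM g h)) = phi (coset G g) + phi (coset G h)).

Definition dot (u v : 'cV[R]_n) : R := (u^T *m v) 0 0.

Definition diagonal_basis G (e : 'I_n -> 'cV[R]_n) : Prop :=
  [/\ forall i j, dot (e i) (e j) = (i == j)%:R,
      translations G =
        [set v | exists z : 'I_n -> int, v = \sum_i (z i)%:~R *: e i]
    & forall g, G g ->
        forall i, g.1 *m e i = e i \/ g.1 *m e i = - e i].


(* kermx is a left kernel, whence the transpose. *)
Definition fix_dim g : nat := \rank (kermx (g.1 - 1%:M)^T).

Definition half_count (e : 'I_n -> 'cV[R]_n) g : nat :=
  #|[pred i : 'I_n | (g.1 *m e i == e i) &&
                    (dot g.2 (e i) - 2^-1 \is a Num.int)]|.

Definition sunada G e (d t : nat) : nat :=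
  #|` fset_set [set C | holonomy G C /\
        exists2 g, C g & fix_dim g = d /\ half_count e g = t] |.

End isometries.

Definition sunada_isospectral (R : realType) (n : nat) (G : set (affine R n))
    (e : 'I_n -> 'cV[R]_n) (G' : set (affine R n)) (e' : 'I_n -> 'cV[R]_n) :=
  forall d t : nat, (t <= d)%N -> (d <= n)%N -> sunada G e d t = sunada G' e' d t.


Section forms.
Context {R : realType} {n : nat}.

(* w x V is the value at the point x of the form w on the p vectors given by
   the columns of V. *)
Definition pform (p : nat) : Type := 'cV[R]_n -> 'M[R]_(n, p) -> R^o.

Fixpoint Ck (k : nat) (f : 'cV[R]_n -> R^o) : Prop :=
  continuous f /\
  if k is k'.+1 then
    forall v, (forall x, derivable f x v) /\ Ck k' (fun x => 'D_v f x)
  else True.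

Definition smooth (f : 'cV[R]_n -> R) : Prop := forall k, Ck k f.

Definition multilinear p (f : 'M[R]_(n, p) -> R) : Prop :=
  forall (i : 'I_p) (a : R) (V V1 V2 : 'M[R]_(n, p)),
    col i V = a *: col i V1 + col i V2 ->
    col' i V1 = col' i V -> col' i V2 = col' i V ->
    f V = a * f V1 + f V2.

Definition alternating p (f : 'M[R]_(n, p) -> R) : Prop :=
  forall (V : 'M[R]_(n, p)) (i j : 'I_p), i != j -> col i V = col j V -> f V = 0.

Definition is_form p (w : pform p) : Prop :=
  [/\ forall x, multilinear (w x),
      forall x, alternating (w x)
    & forall V, smooth (fun x => w x V)].

(* (dw)(v_0, .., v_p) = sum_i (-1)^i D_{v_i} (w(v_0, .., ^v_i, .., v_p)) *)
Definition ext_deriv p (w : pform p) : pform p.+1 := fun x V =>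
  \sum_(i < p.+1)
    (-1) ^+ i * 'D_(col i V) (fun y => w y (col' i V) : R^o) x.

(* The formal adjoint of d for the Euclidean metric:
   (d^* w)(v_1, .., v_p) = - sum_j D_{e_j} (w(e_j, v_1, .., v_p))
   where e_j is the standard basis. *)
Definition coderiv p (w : pform p.+1) : pform p := fun x V =>
  - \sum_(j < n)
    'D_(delta_mx j 0) (fun y => w y (row_mx (delta_mx j 0 : 'cV[R]_n) V) : R^o) x.

Definition laplacian p : pform p -> pform p :=
  match p with
  | 0 => fun w => coderiv (ext_deriv w)
  | q.+1 => fun w => ext_deriv (coderiv w) + coderiv (ext_deriv w)
  end.

(* g^* w = w for all g in G; the G-invariant forms on R^n are the forms on the
   quotient manifold, and the covering map is a local isometry. *)
Definition invariant_form (G : set (affine R n)) p (w : pform p) : Prop :=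
  forall g, G g -> forall x V, w (act g x) (g.1 *m V) = w x V.

Definition eigenforms (G : set (affine R n)) p (c : R) : set (pform p) :=
  [set w | [/\ is_form w, invariant_form G w & laplacian w = c *: w]].

End forms.

Definition lin_indep (R : realType) (V : lmodType R) k (w : 'I_k -> V) : Prop :=
  forall c : 'I_k -> R, \sum_i c i *: w i = 0 -> forall i, c i = 0.

(* Dimension of a linear subspace, +oo when it is infinite. *)
Definition dimension (R : realType) (V : lmodType R) (S : set V) : \bar R :=
  ereal_sup [set k%:R%:E | k in [set k | exists w : 'I_k -> V,
    (forall i, S (w i)) /\ lin_indep w]].

Definition multiplicity (R : realType) (n : nat) (G : set (affine R n))
    (p : nat) (mu : R) : \bar R :=
  dimension (@eigenforms R n G p (4 * pi ^+ 2 * mu)).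

Definition p_isospectral (R : realType) (n : nat) (G G' : set (affine R n))
    (p : nat) : Prop :=
  forall mu : R, multiplicity G p mu = multiplicity G' p mu.

(* Terms with multiplicity zero do not contribute. *)
Definition heat_trace (R : realType) (n : nat) (G : set (affine R n))
    (p : nat) (s : R) : \bar R :=
  (\esum_(mu in [set mu : R | (0 <= mu)%R])
     (multiplicity G p mu * (expR (- (4 * pi ^+ 2 * mu * s)))%:E))%E.


Definition binom_poly (F : fieldType) (t : nat) : {poly F} :=
  (t`!%:R)^-1 *: \prod_(i < t) ('X - i%:R%:P).

Definition krawtchouk (F : fieldType) (n p : nat) : {poly F} :=
  \sum_(t < p.+1)
    (-1) ^+ t * binom_poly F t * (binom_poly F (p - t) \Po (n%:R%:P - 'X)).


Section theta.
Context {R : realType}.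
Local Open Scope complex_scope.

Definition cexp (z : R[i]) : R[i] :=
  (expR (complex.Re z))%:C * (cos (complex.Im z) +i* sin (complex.Im z)).

(* Sum of an absolutely summable family. *)
Definition rsum (T : choiceType) (f : T -> R) : R :=
  fine (\esum_(i in [set: T]) ((EFin \o f)^\+ i))%E
  - fine (\esum_(i in [set: T]) ((EFin \o f)^\- i))%E.

Definition csum (T : choiceType) (f : T -> R[i]) : R[i] :=
  rsum (fun i => complex.Re (f i)) +i* rsum (fun i => complex.Im (f i)).

Definition theta_form (d t : nat) (m : {ffun 'I_d -> int}) : R :=
  \sum_(j < d) (if (j < t)%N then 2^-1 + (m j)%:~R else (m j)%:~R) ^+ 2.

Definition theta (d t : nat) (z : R[i]) : R[i] :=
  csum (fun m : {ffun 'I_d -> int} => cexp (- z * (theta_form t m)%:C)).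

End theta.

(* Main.v *)
(* On the torus the eigenforms for [4 pi^2 mu] are the combinations of the forms
   [cas (xi e k) * eta e I] with [|k|^2 = mu], because a continuous periodic
   function is determined by its Fourier coefficients and the Laplacian multiplies
   the coefficient at [k] by [4 pi^2 |k|^2].  The invariant ones are the image of
   the average of the pullbacks over the holonomy group, so the multiplicity is the
   average of their traces.  The trace of [B L_b] is a Krawtchouk value times a
   signed count of the lattice points of norm [mu] fixed by [B], and it depends
   only on [n_B] and on the number of half-integral fixed coordinates.

   Summed over [mu], the signed counts become products of one-dimensional theta
   series, and the inversion formula, obtained by comparing the Fourier
   coefficients of a periodized Gaussian, gives (i).  As [s] tends to 0 the
   functions in (i) separate by orders of growth, which gives (ii) for [t > 0];
   for [t = 0] torsion-freeness forces [c_(d,0)] to vanish unless [d = n]: an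
   element without half-integral fixed coordinates has, up to a lattice
   translation, order at most 2. *)
Require Import Defs.
From mathcomp Require Import all_boot all_order all_algebra.
From mathcomp Require Import fingroup perm complex finmap.
From mathcomp Require Import all_classical all_reals all_analysis.
From mathcomp Require Import ring lra zify.
Set Implicit Arguments.
Unset Strict Implicit.
Unset Printing Implicit Defensive.
Import Order.TTheory GRing.Theory Num.Theory.
Import numFieldNormedType.Exports.
Local Open Scope classical_set_scope.
Local Open Scope ring_scope.

(** * Periodic functions, mean values and Fourier uniqueness *)

(** Integration enters only through [mean], which on continuous periodic functions is linear,
    bounded by the sup norm and translation invariant. Limits are moved through it by uniform
    estimates: derivatives by remainders quadratic in the increment, series by a finite set whose
    tail is small for all dominated families at once. The same functional applied to periodizations
    plays the integral over the line, and the Gaussian transform is then found from a first-order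
    differential equation.

    Since the modes are real, differentiation sends frequency k to - k, and a translation mixes the
    two. In the Laplacian the reversal occurs twice and disappears; in the traces it leaves sine
    terms that cancel over a shell, which is symmetric under negation.

    The signed counts of lattice points are not monotone data: only their combination is
    nonnegative, being a dimension. The interchange of the sum over [mu] with the sum over the
    lattice is therefore made for the whole combination and not for each holonomy element. *)

Section dot.
Context {R : realType} {n : nat}.
Implicit Types u v w x : 'cV[R]_n.

Lemma dotE u v : dot u v = \sum_i u i 0 * v i 0.
Proof. by rewrite /dot !mxE; apply: eq_bigr => i _; rewrite !mxE. Qed.

Lemma dotC u v : dot u v = dot v u.
Proof. by rewrite !dotE; apply: eq_bigr => i _; rewrite mulrC. Qed.

Lemma dotDr u v w : dot u (v + w) = dot u v + dot u w.
Proof. by rewrite /dot mulmxDr mxE. Qed.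

Lemma dotDl u v w : dot (u + v) w = dot u w + dot v w.
Proof. by rewrite !(dotC _ w) dotDr. Qed.

Lemma dotZr a u v : dot u (a *: v) = a * dot u v.
Proof. by rewrite /dot -scalemxAr mxE. Qed.

Lemma dotZl a u v : dot (a *: u) v = a * dot u v.
Proof. by rewrite !(dotC _ v) dotZr. Qed.

Lemma dotNr u v : dot u (- v) = - dot u v.
Proof. by rewrite -scaleN1r dotZr mulN1r. Qed.

Lemma dotNl u v : dot (- u) v = - dot u v.
Proof. by rewrite !(dotC _ v) dotNr. Qed.

Lemma dot0r u : dot u 0 = 0.
Proof. by rewrite -(scale0r 0) dotZr mul0r. Qed.

Lemma dot0l u : dot 0 u = 0.
Proof. by rewrite dotC dot0r. Qed.

Lemma dot_sumr (I : Type) (r : seq I) (P : pred I) (F : I -> 'cV[R]_n) u :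
  dot u (\sum_(i <- r | P i) F i) = \sum_(i <- r | P i) dot u (F i).
Proof. by apply: (big_morph (dot u)); [exact: dotDr|exact: dot0r]. Qed.

Lemma dot_suml (I : Type) (r : seq I) (P : pred I) (F : I -> 'cV[R]_n) u :
  dot (\sum_(i <- r | P i) F i) u = \sum_(i <- r | P i) dot (F i) u.
Proof. by rewrite dotC dot_sumr; apply: eq_bigr => i _; rewrite dotC. Qed.

Lemma dot_deltal i v : dot (delta_mx i 0) v = v i 0.
Proof.
rewrite dotE (bigD1 i) //= mxE !eqxx mul1r big1 ?addr0 // => j ji.
by rewrite mxE (negPf ji) mul0r.
Qed.

Lemma dot_mulmxr (B : 'M[R]_n) u v : dot u (B *m v) = dot (B^T *m u) v.
Proof. by rewrite /dot trmx_mul trmxK mulmxA. Qed.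

Lemma continuous_dot u : continuous (dot u : 'cV[R]_n -> R).
Proof.
have -> : dot u = \sum_i (fun v : 'cV[R]_n => u i 0 * v i 0).
  by apply/funext => v; rewrite dotE fct_sumE.
elim/big_ind : _ => [x|f g cf cg x|i _ x]; first exact: (@cst_continuous _ _ (0 : R)).
  by apply: continuousD; [exact: cf|exact: cg].
apply: (@continuousM _ _ (cst (u i 0)) (fun v : 'cV[R]_n => v i 0)).
  exact: cst_continuous.
exact: coord_continuous.
Qed.

Lemma cvg_coord_matrix (T : Type) (F : set_system T) (FF : Filter F)
    (f : T -> 'cV[R]_n) (l : 'cV[R]_n) :
  (forall i, f x i 0 @[x --> F] --> l i 0) -> f @ F --> l.
Proof.
move=> fl; apply/cvgrPdist_lt => eps eps0.
have : \forall x \near F, forall i, `|l i 0 - f x i 0| < eps.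
  apply: filter_forall => i.
  by move/cvgrPdist_lt : (fl i); exact.
apply: filterS => x H; rewrite /Num.norm/= mx_normrE.
apply/bigmax_ltP; split => // -[i j] _ /=.
by rewrite (ord1 j) !mxE; exact: H.
Qed.

Lemma cube_compact (C : R) :
  compact [set x : 'cV[R]_n | forall i, x i 0 \in `[- C, C]].
Proof.
have -> : [set x : 'cV[R]_n | forall i, x i 0 \in `[- C, C]] =
    trmx @` [set v : 'rV[R]_n | forall i, v ord0 i \in `[- C, C]].
  apply/seteqP; split => x /=.
    by move=> xC; exists x^T; [move=> i; rewrite mxE (_ : ord0 = 0)|rewrite trmxK].
  by move=> [y yC <-] i; rewrite mxE; exact: yC.
apply: continuous_compact.
  apply: continuous_subspaceT => x.
  apply: (@cvg_coord_matrix _ _ (nbhs_filter x)) => i.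
  under eq_fun do rewrite mxE; rewrite mxE; exact: coord_continuous.
apply: (@rV_compact _ _ (fun=> `[- C, C]%classic)) => _.
exact: segment_compact.
Qed.

Lemma norm_coord_le (x : 'cV[R]_n) i : `|x i 0| <= `|x|.
Proof.
rewrite [leRHS]/Num.norm /= mx_normrE.
by apply: (le_bigmax _ (fun ij : 'I_n * 'I_1 => `|x ij.1 ij.2|) (i, 0)).
Qed.

End dot.

Section uniform_continuity.
Context {R : realType} {n : nat}.

(** Near-covering form of compactness: near each [(x, 0)] both [f z.1] and [f (z.1 + z.2)] are
    within [eps / 2] of [f x], and compactness makes the bound on [h] uniform. *)
Lemma compact_near_unif (K : set 'cV[R]_n) (f : 'cV[R]_n -> R) (eps : R) :
  compact K -> continuous f -> 0 < eps ->
  \forall h \near (0 : 'cV[R]_n), forall x, K x -> `|f (x + h) - f x| < eps.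
Proof.
move=> /compact_near_coveringP Kc cf eps0.
move: Kc => /(_ _ (nbhs (0 : 'cV[R]_n)) (fun h x => `|f (x + h) - f x| < eps) _); apply => x Kx.
have e20 : 0 < eps / 2 by rewrite divr_gt0.
have c1 : (fun z : 'cV[R]_n * 'cV[R]_n => f z.1) @ (x, 0 : 'cV[R]_n) --> f x.
  by apply: (@cvg_comp _ _ _ fst f); [exact: cvg_fst|exact: cf].
have c2 : (fun z : 'cV[R]_n * 'cV[R]_n => f (z.1 + z.2)) @ (x, 0 : 'cV[R]_n)
    --> f x.
  have c0 : (fun z : 'cV[R]_n * 'cV[R]_n => z.1 + z.2) @ (x, 0 : 'cV[R]_n) --> x.
    rewrite -[X in _ --> X](addr0 x).
    by apply: cvgD; [exact: cvg_fst|exact: cvg_snd].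
  exact: (cvg_comp _ _ c0 (cf x)).
move/cvgrPdist_lt/(_ _ e20) : c1 => c1.
move/cvgrPdist_lt/(_ _ e20) : c2 => c2.
near=> z => /=.
have h1 : `|f x - f z.1| < eps / 2 by near: z.
have h2 : `|f x - f (z.1 + z.2)| < eps / 2 by near: z.
have -> : f (z.1 + z.2) - f z.1 = (f x - f z.1) - (f x - f (z.1 + z.2)).
  by ring.
by rewrite (splitr eps) (le_lt_trans (ler_normB _ _)) // ltrD.
Unshelve. all: by end_near. Qed.

End uniform_continuity.

(* With [cos + sin] the real Fourier modes are indexed by the whole lattice,
   one function per frequency, and no sine/cosine pairing is needed. *)
Definition cas (R : realType) (n : nat) (u x : 'cV[R]_n) : R :=
  cos (2 * pi * dot u x) + sin (2 * pi * dot u x).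

(** For an orthonormal [e] the lattice is its own dual, so these vectors serve both as periods and
    as frequencies. *)
Definition xi (R : realType) (n : nat) (e : 'I_n -> 'cV[R]_n)
    (k : {ffun 'I_n -> int}) : 'cV[R]_n := \sum_i (k i)%:~R *: e i.

Definition cper (R : realType) (n : nat) (e : 'I_n -> 'cV[R]_n)
    (f : 'cV[R]_n -> R) : Prop :=
  continuous f /\ forall i x, f (x + e i) = f x.

Section periodic.
Context {R : realType} {n : nat} (e : 'I_n -> 'cV[R]_n).
Hypothesis He : forall i j, dot (e i) (e j) = (i == j)%:R.
Implicit Types (f g : 'cV[R]_n -> R) (k l : {ffun 'I_n -> int}).

Lemma basis_expand x : x = \sum_i dot (e i) x *: e i.
Proof.
pose E : 'M[R]_n := \matrix_(i, j) e j i 0.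
have EE : E^T *m E = 1%:M.
  apply/matrixP => i j; rewrite !mxE -He dotE.
  by apply: eq_bigr => h _; rewrite !mxE.
have /(congr1 (mulmx^~ x)) := mulmx1C EE.
rewrite mul1mx => {1}<-; apply/colP => i; rewrite -mulmxA summxE mxE.
apply: eq_bigr => j _; rewrite !mxE mulrC dotE; congr (_ * _).
by apply: eq_bigr => h _; rewrite !mxE.
Qed.

Lemma dot_xi k i : dot (e i) (xi e k) = (k i)%:~R.
Proof.
rewrite /xi dot_sumr (bigD1 i) //= dotZr He eqxx mulr1 big1 ?addr0 // => j ji.
by rewrite dotZr He eq_sym (negPf ji) mulr0.
Qed.

Lemma dot_xi_xi k l : dot (xi e k) (xi e l) = \sum_i (k i * l i)%:~R.
Proof.
rewrite {1}/xi dot_suml; apply: eq_bigr => i _.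
by rewrite dotZl dot_xi rmorphM.
Qed.

Lemma xiD k l : xi e (k + l) = xi e k + xi e l.
Proof.
by rewrite /xi -big_split; apply: eq_bigr => i _; rewrite ffunE rmorphD scalerDl.
Qed.

Lemma xiN k : xi e (- k) = - xi e k.
Proof.
by rewrite /xi -sumrN; apply: eq_bigr => i _; rewrite ffunE rmorphN scaleNr.
Qed.

Lemma xi0 : xi e 0 = 0.
Proof. by rewrite /xi big1 // => i _; rewrite ffunE scale0r. Qed.

Lemma cper_lat f k x : cper e f -> f (x + xi e k) = f x.
Proof.
move=> [_ fp].
have fN m i y : f (y + (e i) *+ m) = f y.
  by elim: m => [|m IH]; rewrite ?mulr0n ?addr0 // mulrSr addrA fp.
have fZ (m : int) i y : f (y + m%:~R *: e i) = f y.
  case: m => m.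
    by rewrite (_ : (Posz m)%:~R = m%:R) // scaler_nat fN.
  rewrite NegzE mulrNz (_ : (Posz m.+1)%:~R = m.+1%:R) //.
  by rewrite scaleNr scaler_nat -(fN m.+1 i) subrK.
rewrite /xi; elim/big_rec: _ x => [|i y _ IH] x; first by rewrite addr0.
by rewrite addrA IH fZ.
Qed.

Lemma cper_reduce x : exists k, forall i, dot (e i) (x + xi e k) \in `[0, 1[.
Proof.
exists [ffun i => - Num.floor (dot (e i) x)] => i.
rewrite dotDr dot_xi ffunE rmorphN /= in_itv /= subr_ge0 floor_le_tmp /=.
by rewrite ltrBlDl -[X in _ < _ + X]/(1%:~R) -intrD ?floorD1_gt.
Qed.

Definition cell_bound : R := \sum_i `|e i|.

Lemma cell_cube x : (forall i, dot (e i) x \in `[0, 1[) ->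
  forall i, x i 0 \in `[- cell_bound, cell_bound].
Proof.
move=> xc i; rewrite in_itv /= -ler_norml {1}(basis_expand x) summxE.
apply: (le_trans (ler_norm_sum _ _ _)); apply: ler_sum => j _.
rewrite mxE normrM -[leRHS]mul1r ler_pM ?normr_ge0 ?norm_coord_le //.
by have := xc j; rewrite in_itv /= => /andP[h0 /ltW h1]; rewrite ger0_norm.
Qed.

Lemma cper_bdd f : cper e f -> exists C, forall x, `|f x| <= C.
Proof.
move=> fp; have cc := @cube_compact R n cell_bound.
have /compact_bounded [C [Cr HC]] : compact (f @` [set x : 'cV[R]_n | forall i, x i 0 \in `[- cell_bound, cell_bound]]).
  by apply: continuous_compact => //; apply: continuous_subspaceT; case: fp.
exists (C + 1) => x.
have [k /cell_cube kx] := cper_reduce x.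
rewrite -(cper_lat k x fp); apply: (HC (C + 1)); first by rewrite ltrDl.
by exists (x + xi e k).
Qed.

(** Only the base point is brought into the cell; [x + h] is moved by the same lattice vector and
    may leave it, which [compact_near_unif] allows. *)
Lemma cper_unif f (eps : R) : cper e f -> 0 < eps ->
  \forall h \near (0 : 'cV[R]_n), forall x, `|f (x + h) - f x| < eps.
Proof.
move=> fp eps0.
have := compact_near_unif (@cube_compact R n cell_bound) fp.1 eps0.
apply: filterS => h H x.
have [k /cell_cube kx] := cper_reduce x.
by rewrite -(cper_lat k x fp) -(cper_lat k (x + h) fp) addrAC; exact: H.
Qed.

Lemma cper_cst (a : R) : cper e (cst a).
Proof. by split => //; exact: cst_continuous. Qed.

Lemma cperD f g : cper e f -> cper e g -> cper e (fun x => f x + g x).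
Proof.
move=> [cf pf] [cg pg]; split => [x|i x]; last by rewrite pf pg.
by apply: continuousD; [exact: cf|exact: cg].
Qed.

Lemma cperM f g : cper e f -> cper e g -> cper e (fun x => f x * g x).
Proof.
move=> [cf pf] [cg pg]; split => [x|i x]; last by rewrite pf pg.
by apply: continuousM; [exact: cf|exact: cg].
Qed.

Lemma cperZ a f : cper e f -> cper e (fun x => a * f x).
Proof. by move=> fp; apply: cperM => //; exact: cper_cst. Qed.

Lemma cperN f : cper e f -> cper e (fun x => - f x).
Proof.
by move=> fp; under eq_fun do rewrite -mulN1r; exact: cperZ.
Qed.

Lemma cperB f g : cper e f -> cper e g -> cper e (fun x => f x - g x).
Proof. by move=> fp gp; apply: cperD => //; exact: cperN. Qed.

Lemma cper_sum (I : Type) (r : seq I) (P : pred I) (F : I -> 'cV[R]_n -> R) :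
  (forall i, P i -> cper e (F i)) -> cper e (fun x => \sum_(i <- r | P i) F i x).
Proof.
move=> Fp; elim: r => [|i r IH].
  by under eq_fun do rewrite big_nil; exact: cper_cst.
under eq_fun do rewrite big_cons.
by case Pi: (P i) => //; apply: cperD => //; exact: Fp.
Qed.

Lemma cper_prod (I : Type) (r : seq I) (P : pred I) (F : I -> 'cV[R]_n -> R) :
  (forall i, P i -> cper e (F i)) -> cper e (fun x => \prod_(i <- r | P i) F i x).
Proof.
move=> Fp; elim: r => [|i r IH].
  by under eq_fun do rewrite big_nil; exact: cper_cst.
under eq_fun do rewrite big_cons.
by case Pi: (P i) => //; apply: cperM => //; exact: Fp.
Qed.

Lemma cper_shift f h : cper e f -> cper e (fun x => f (x + h)).
Proof.
move=> [cf pf]; split => [x|i x]; last by rewrite addrAC pf.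
apply: (@continuous_comp _ _ _ (fun x : 'cV[R]_n => x + h) f x); last exact: cf.
by apply: continuousD => //; exact: cst_continuous.
Qed.

Lemma cos_periodz (x : R) (m : int) : cos (x + 2 * pi * m%:~R) = cos x.
Proof.
have cN y (j : nat) : cos (y + 2 * pi * j%:R) = cos y :> R.
  rewrite -(periodicn (@cosD2pi R) j y); congr (cos (_ + _)).
  by rewrite mulr_natr mulr_natl.
case: m => m; first exact: cN.
rewrite NegzE mulrNz (_ : (Posz m.+1)%:~R = m.+1%:R) //.
by rewrite -[LHS](cN _ m.+1) mulrN subrK.
Qed.

Lemma sin_periodz (x : R) (m : int) : sin (x + 2 * pi * m%:~R) = sin x.
Proof.
have sE (y : R) : sin y = cos (y - pi / 2) by rewrite cosBpihalf.
by rewrite sE addrAC cos_periodz -sE.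
Qed.

Lemma cper_cos k a : cper e (fun x => cos (2 * pi * dot (xi e k) x + a)).
Proof.
split=> [x|i x]; last first.
  rewrite dotDr mulrDr addrAC -(mulrA 2 pi); rewrite (dotC (xi e k) (e i)) dot_xi.
  by rewrite [2 * (pi * _)]mulrA cos_periodz.
apply: (@continuous_comp _ _ _ (fun x => 2 * pi * dot (xi e k) x + a) cos x).
  apply: continuousD; last exact: cst_continuous.
  apply: (@continuousM _ _ (cst (2 * pi)) (dot (xi e k))).
    exact: cst_continuous.
  exact: continuous_dot.
exact: continuous_cos.
Qed.

Lemma cper_sin k a : cper e (fun x => sin (2 * pi * dot (xi e k) x + a)).
Proof.
by under eq_fun do rewrite -cosBpihalf -addrA; exact: cper_cos.
Qed.

Lemma cper_cas k : cper e (cas (xi e k)).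
Proof.
rewrite (_ : cas (xi e k) = fun x => cos (2 * pi * dot (xi e k) x + 0) +
  sin (2 * pi * dot (xi e k) x + 0)); last by apply/funext => x; rewrite !addr0.
by apply: cperD; [exact: cper_cos|exact: cper_sin].
Qed.

End periodic.

(** * Mean value over the torus *)

Definition ultra_oo : set_system nat :=
  sval (cid (ultraFilterLemma eventually_filter)).

Lemma ultra_ooP : UltraFilter ultra_oo /\ \oo `<=` ultra_oo.
Proof. exact: (svalP (cid (ultraFilterLemma eventually_filter))). Qed.

#[global] Instance ultra_oo_ultra : UltraFilter ultra_oo := ultra_ooP.1.

Lemma ultra_filter_map (T U : Type) (F : set_system T) (f : T -> U) :
  UltraFilter F -> UltraFilter (f @ F).
Proof.
move=> UF; split; first exact: fmap_proper_filter.
move=> G GP sG; apply/seteqP; split => [B GB|]; last exact: sG.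
have [//|FB] := in_ultra_setVsetC (f @^-1` B) UF.
have GnB : G (~` B) by apply: sG.
by have /filter_ex[x []] : G (B `&` ~` B) by exact: filterI.
Qed.

Definition grid (R : realType) (n : nat) (e : 'I_n -> 'cV[R]_n) (N : nat)
    (k : {ffun 'I_n -> 'I_N.+1}) : 'cV[R]_n :=
  \sum_i ((k i)%:R / N.+1%:R) *: e i.

Definition gmean (R : realType) (n : nat) (e : 'I_n -> 'cV[R]_n) (N : nat)
    (f : 'cV[R]_n -> R) : R :=
  (#|{ffun 'I_n -> 'I_N.+1}|%:R)^-1 * \sum_k f (grid e (N := N) k).

(* The mean value over the torus; an ultrafilter limit of averages over finer
   and finer grids is linear, monotone and translation invariant on continuous
   functions, which is all that is needed of an integral. *)
Definition mean (R : realType) (n : nat) (e : 'I_n -> 'cV[R]_n)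
    (f : 'cV[R]_n -> R) : R := lim (gmean e N f @[N --> ultra_oo]).

Section mean.
Context {R : realType} {n : nat} (e : 'I_n -> 'cV[R]_n).
Hypothesis He : forall i j, dot (e i) (e j) = (i == j)%:R.
Implicit Types (f g : 'cV[R]_n -> R).

Lemma card_grid_gt0 N : 0 < #|{ffun 'I_n -> 'I_N.+1}|%:R :> R.
Proof. by rewrite ltr0n card_ffun !card_ord expn_gt0. Qed.

Lemma gmean_bound N f C : (forall x, `|f x| <= C) -> `|gmean e N f| <= C.
Proof.
move=> fC; rewrite /gmean normrM ger0_norm ?invr_ge0 ?ler0n //.
rewrite mulrC ler_pdivrMr ?card_grid_gt0 //.
apply: (le_trans (ler_norm_sum _ _ _)).
apply: (le_trans (ler_sum _ (fun k _ => fC (grid e (N := N) k)))).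
by rewrite sumr_const mulr_natr.
Qed.

Lemma gmeanD N f g : gmean e N (fun x => f x + g x) = gmean e N f + gmean e N g.
Proof. by rewrite /gmean big_split mulrDr. Qed.

Lemma gmeanZ N a f : gmean e N (fun x => a * f x) = a * gmean e N f.
Proof. by rewrite /gmean -mulr_sumr mulrCA. Qed.

(** The averages stay in [[- C, C]], and an ultrafilter on a compact set converges. *)
Lemma mean_cvg_bdd f : (exists C, forall x, `|f x| <= C) ->
  gmean e N f @[N --> ultra_oo] --> mean e f.
Proof.
move=> [C fC]; apply/cvg_ex.
have := @segment_compact R (- C) C; rewrite compact_ultra.
have UU : UltraFilter (gmean e N f @[N --> ultra_oo]).
  exact: ultra_filter_map.
case/(_ _ UU) => [|p [_ pl]]; last by exists p.
apply: (@filterE _ ultra_oo) => N.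
by rewrite /= in_itv /= -ler_norml; exact: gmean_bound.
Qed.

Lemma mean_cvg f : cper e f -> gmean e N f @[N --> ultra_oo] --> mean e f.
Proof. by move=> /(cper_bdd He); exact: mean_cvg_bdd. Qed.

Lemma meanD f g : cper e f -> cper e g ->
  mean e (fun x => f x + g x) = mean e f + mean e g.
Proof.
move=> fp gp; apply: cvg_lim => //.
under eq_fun do rewrite gmeanD.
by apply: cvgD; exact: mean_cvg.
Qed.

Lemma meanZ a f : cper e f -> mean e (fun x => a * f x) = a * mean e f.
Proof.
move=> fp; apply: cvg_lim => //.
under eq_fun do rewrite gmeanZ.
by apply: cvgM; [exact: cvg_cst|exact: mean_cvg].
Qed.

Lemma meanN f : cper e f -> mean e (fun x => - f x) = - mean e f.
Proof.
move=> fp; under eq_fun do rewrite -mulN1r.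
by rewrite meanZ // mulN1r.
Qed.

Lemma meanB f g : cper e f -> cper e g ->
  mean e (fun x => f x - g x) = mean e f - mean e g.
Proof. by move=> fp gp; rewrite meanD ?meanN //; exact: cperN. Qed.

Lemma mean_cst a : mean e (fun=> a) = a.
Proof.
apply: cvg_lim => //; rewrite (_ : (fun N => gmean e N (fun=> a)) = fun=> a).
  exact: cvg_cst.
apply/funext => N; rewrite /gmean sumr_const.
by rewrite -[X in _ * X]mulr_natl mulKf // gt_eqF // card_grid_gt0.
Qed.

Lemma mean_sum (I : Type) (r : seq I) (P : pred I) (F : I -> 'cV[R]_n -> R) :
  (forall i, P i -> cper e (F i)) ->
  mean e (fun x => \sum_(i <- r | P i) F i x) = \sum_(i <- r | P i) mean e (F i).
Proof.
move=> Fp; elim: r => [|i r IH].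
  by rewrite big_nil; under eq_fun do rewrite big_nil; exact: mean_cst.
rewrite big_cons; under eq_fun do rewrite big_cons.
case Pi: (P i) => //; rewrite meanD ?IH //; first exact: Fp.
exact: cper_sum.
Qed.

Lemma mean_bound f C : (forall x, `|f x| <= C) -> `|mean e f| <= C.
Proof.
move=> fC.
have /cvg_norm h : gmean e N f @[N --> ultra_oo] --> mean e f.
  by apply: mean_cvg_bdd; exists C.
apply: (cvgr_to_le h); apply: filterE => N; exact: gmean_bound.
Qed.

End mean.

Section mean_shift.
Context {R : realType} {n : nat} (e : 'I_n -> 'cV[R]_n).
Hypothesis He : forall i j, dot (e i) (e j) = (i == j)%:R.
Implicit Types (f g : 'cV[R]_n -> R).

Lemma gmean_shift_grid N f (z : {ffun 'I_n -> int}) : cper e f ->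
  gmean e N (fun x => f (x + N.+1%:R^-1 *: xi e z)) = gmean e N f.
Proof.
move=> fp; rewrite /gmean; congr (_ * _).
(* Addition in ['I_N.+1] is modulo [N.+1], so adding the residues [zz] permutes the grid; the
   quotients [q] form a lattice vector, absorbed by periodicity. *)
pose zz : {ffun 'I_n -> 'I_N.+1} := [ffun i => inZp `|(z i %% N.+1)%Z|%N].
rewrite [RHS](reindex_inj (addIr zz)) /=; apply: eq_bigr => k _.
pose q : {ffun 'I_n -> int} := [ffun i => ((k i)%:Z + z i) %/ N.+1]%Z.
have N0 : N.+1%:R != 0 :> R by rewrite pnatr_eq0.
rewrite -[RHS](cper_lat q _ fp); congr f.
rewrite /grid /xi scaler_sumr -!big_split; apply: eq_bigr => i _ /=.
rewrite scalerA -!scalerDl; congr (_ *: _).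
have kz : ((k + zz)%R i)%:Z = (((k i)%:Z + z i) %% N.+1)%Z.
  rewrite ffunE /zz ffunE /= modnDmr -modz_nat PoszD.
  by rewrite gez0_abs ?modz_ge0 // modzDmr.
have kzE : (k i)%:R + (z i)%:~R = (q i)%:~R * N.+1%:R + ((k + zz)%R i)%:R :> R.
  rewrite -[((k + zz)%R i)%:R]/(((k + zz)%R i)%:Z%:~R) kz.
  rewrite -[N.+1%:R]/(N.+1%:Z%:~R) -intrM -intrD /q ffunE -divz_eq.
  by rewrite intrD.
move: N0 kzE; move: (N.+1%:R : R) ((k i)%:R : R) (((k + zz)%R i)%:R : R).
move: ((q i)%:~R : R) ((z i)%:~R : R) => v u c a b.
move=> c0 kzE; have -> : a = v * c + b - u by rewrite -kzE addrK.
by field.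
Qed.

Lemma grid_round (h : 'cV[R]_n) N : exists z : {ffun 'I_n -> int},
  `|h - N.+1%:R^-1 *: xi e z| <= cell_bound e / N.+1%:R.
Proof.
have N0 : 0 < N.+1%:R :> R by rewrite ltr0n.
have [z hz] := cper_reduce He (N.+1%:R *: h).
(* Minus the lattice vector that brings [N.+1 *: h] into the unit cell: the error is then a point of
   the cell divided by [N.+1]. *)
exists (- z).
have -> : h - N.+1%:R^-1 *: xi e (- z) =
    N.+1%:R^-1 *: (N.+1%:R *: h + xi e z).
  by rewrite scalerDr scalerA mulVf ?gt_eqF // scale1r xiN scalerN opprK.
have N1 : 0 <= N.+1%:R^-1 :> R by rewrite invr_ge0 ler0n.
rewrite normrZ (ger0_norm N1) [leRHS]mulrC; apply: ler_wpM2l => //.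
have cb i := cell_cube He hz i.
rewrite [leLHS]/Num.norm /= mx_normrE; apply/bigmax_leP; split.
  by apply: sumr_ge0 => i _.
move=> [i j] _ /=; rewrite (ord1 j) ler_norml.
by have := cb i; rewrite in_itv.
Qed.

(** Invariance is exact for grid vectors; [h] is within [cell_bound e / N.+1] of one, and uniform
    continuity makes the difference vanish as [N] grows. *)
Lemma mean_shift f h : cper e f -> mean e (fun x => f (x + h)) = mean e f.
Proof.
move=> fp; apply/eqP; rewrite -subr_eq0 -normr_le0.
have fhp := cper_shift h fp.
apply/ler_addgt0Pr => eps eps0; rewrite add0r.
have dcvg : gmean e N (fun x => f (x + h)) - gmean e N f @[N --> ultra_oo] -->
    mean e (fun x => f (x + h)) - mean e f.
  by apply: cvgB; exact: mean_cvg.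
apply: (cvgr_to_le (cvg_norm dcvg)); apply: ultra_ooP.2.
have /nbhs_ballP[d /= d0 Hd] := cper_unif He fp eps0.
have c0 : 0 <= cell_bound e by apply: sumr_ge0.
have c1 : 0 < 1 + cell_bound e by rewrite ltr_pwDl.
have := near_infty_natSinv_lt (PosNum (divr_gt0 d0 c1)).
apply: filterS => N /= HN.
have [z hz] := grid_round h N.
have -> : (gmean e N (fun x => f (x + h)) - gmean e N f) =
    gmean e N (fun x => f (x + h) - f (x + N.+1%:R^-1 *: xi e z)).
  rewrite -(gmean_shift_grid N z fp) -mulN1r -gmeanZ -gmeanD.
  by congr gmean; apply/funext => x; rewrite mulN1r.
apply: gmean_bound => x.
have -> : x + h = x + N.+1%:R^-1 *: xi e z + (h - N.+1%:R^-1 *: xi e z).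
  by rewrite addrACA subrr addr0 addrC.
apply/ltW/Hd; rewrite -ball_normE /= sub0r normrN (le_lt_trans hz) //.
move: HN; rewrite ltr_pdivlMr // => HN; apply: le_lt_trans HN.
by rewrite mulrC ler_pM2l ?invr_gt0 ?ltr0n // lerDr.
Qed.

End mean_shift.

(** * Directional derivatives and orthogonality of the Fourier modes *)

Section directional.
Context {R : realType} {n : nat}.
Implicit Types (f g : 'cV[R]_n -> R) (u v x : 'cV[R]_n).

Lemma is_derive_line f x v t : derivable f (x + t *: v) v ->
  is_derive (t : R) 1 (fun s : R => f (x + s *: v)) ('D_v f (x + t *: v)).
Proof.
have E : (fun h : R => h^-1 *: (((fun s : R => f (x + s *: v)) \o shift t) (h *: 1) -
      f (x + t *: v))) =
    (fun h : R => h^-1 *: ((f \o shift (x + t *: v)) (h *: v) - f (x + t *: v))).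
  apply/funext => h /=; congr (_ *: (f _ - _)).
  by rewrite scalerDl [h *: 1]mulr1 addrCA.
by move=> fd; split; [rewrite /derivable E|rewrite /derive E].
Qed.

Lemma MVT_line f x v h : (forall y, derivable f y v) ->
  exists2 t : R, `|t| <= `|h| & f (x + h *: v) - f x = h * 'D_v f (x + t *: v).
Proof.
move=> fd.
have fl t := is_derive_line (fd (x + t *: v)).
have fc (t : R) : {for t, continuous (fun s : R => f (x + s *: v))}.
  by apply/differentiable_continuous/derivable1_diffP; case: (fl t).
have [h0|h0|<-] := ltrgtP 0 h; last first.
- by exists 0; rewrite // scale0r addr0 subrr mul0r.
- have [|t] := @MVT _ (fun s : R => f (x + s *: v)) (fun s : R => 'D_v f (x + s *: v)) h 0 h0 (fun t _ => fl t).
    by apply: continuous_in_subspaceT => t _; exact: fc.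
  rewrite in_itv /= => /andP[ht t0]; rewrite scale0r addr0 sub0r => E.
  exists t; first by rewrite !ler0_norm ?lerN2 ?ltW.
  by rewrite -opprB E mulrN opprK mulrC.
- have [|t] := @MVT _ (fun s : R => f (x + s *: v)) (fun s : R => 'D_v f (x + s *: v)) 0 h h0 (fun t _ => fl t).
    by apply: continuous_in_subspaceT => t _; exact: fc.
  rewrite in_itv /= => /andP[t0 th]; rewrite scale0r addr0 subr0 => E.
  exists t; first by rewrite !ger0_norm ?ltW.
  by rewrite E mulrC.
Qed.

Lemma is_derive_comp_dot (F : R -> R) (dF : R -> R) u v x :
  (forall t : R, is_derive t 1 F (dF t)) ->
  is_derive x v (fun y => F (2 * pi * dot u y)) (2 * pi * dot v u * dF (2 * pi * dot u x)).
Proof.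
move=> Fd.
pose G (t : R) := F (2 * pi * dot u x + 2 * pi * dot v u * t).
have Gd : is_derive (0 : R) 1 G (2 * pi * dot v u * dF (2 * pi * dot u x)).
  have a1 : is_derive (0 : R) 1 (fun t : R => 2 * pi * dot u x + 2 * pi * dot v u * t) (2 * pi * dot v u).
    apply: (is_derive_eq (is_deriveD (is_derive_cst _ _ _) (is_deriveZ _ (is_derive_id _ _)))).
    by rewrite add0r [_ *: _]mulr1.
  apply: (is_derive_eq (@is_derive1_comp _ F (fun t : R => 2 * pi * dot u x + 2 * pi * dot v u * t) 0 _ _ (Fd _) a1)).
  by rewrite mulr0 addr0 mulrC.
have E : (fun h : R => h^-1 *: (((fun y => F (2 * pi * dot u y)) \o shift x) (h *: v) - F (2 * pi * dot u x)))
   = (fun h : R => h^-1 *: ((G \o shift 0) (h *: 1) - G 0)).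
  apply/funext => h /=; rewrite /G mulr0 !addr0 [h *: 1]mulr1; congr (_ *: (F _ - _)).
  by rewrite dotDr dotZr (dotC u v); ring.
case: Gd; rewrite /derivable /derive -E => c l.
by split.
Qed.

(** [cas (- u)] is cosine minus sine of the same argument, so differentiation reverses the
    frequency; this is the source of every [- k] in the Fourier coefficients of derivatives. *)
Lemma is_derive_cas u v x : is_derive x v (cas u) (2 * pi * dot v u * cas (- u) x).
Proof.
have := is_deriveD (is_derive_comp_dot u v x (@is_derive_cos R))
                   (is_derive_comp_dot u v x (@is_derive_sin R)).
rewrite (_ : _ + _ = 2 * pi * dot v u * cas (- u) x); last first.
  by rewrite /cas dotNl !mulrN cosN sinN; ring.
by [].
Qed.

Lemma derive_cas u v x : 'D_v (cas u) x = 2 * pi * dot v u * cas (- u) x.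
Proof. by have /@derive_val := is_derive_cas u v x. Qed.

Lemma derivable_cas u v x : derivable (cas u) x v.
Proof. by have /@ex_derive := is_derive_cas u v x. Qed.

End directional.

Section mean_derive.
Context {R : realType} {n : nat} (e : 'I_n -> 'cV[R]_n).
Hypothesis He : forall i j, dot (e i) (e j) = (i == j)%:R.
Implicit Types (f g : 'cV[R]_n -> R) (k l : {ffun 'I_n -> int}).

(** Shift invariance kills the mean of every difference quotient, and by the mean value theorem
    these approach ['D_u f] uniformly. *)
Lemma mean_derive f u : cper e f -> (forall x, derivable f x u) ->
  cper e (fun x => 'D_u f x) -> mean e (fun x => 'D_u f x) = 0.
Proof.
move=> fp fd dp; apply/eqP; rewrite -normr_le0.
apply/ler_addgt0Pr => eps eps0; rewrite add0r.
have /nbhs_ballP[d /= d0 Hd] := cper_unif He dp eps0.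
(* The [1 +] covers [u = 0] and makes every displacement [t *: u] with [t] at most [h] strictly
   shorter than [d]. *)
pose h := d / (1 + `|u|).
have u1 : 0 < 1 + `|u| by rewrite ltr_pwDl.
have h0 : 0 < h by rewrite divr_gt0.
have fhp := cper_shift (h *: u) fp.
have := mean_bound e (f := fun x => 'D_u f x - h^-1 * (f (x + h *: u) - f x)) (C := eps).
rewrite meanB ?meanZ ?meanB ?mean_shift ?subrr ?mulr0 ?subr0 //; last 2 first.
- exact: cperB.
- by apply: cperZ; exact: cperB.
apply => x.
have [t th ->] := MVT_line x h fd; rewrite mulKf ?gt_eqF //.
rewrite distrC; apply/ltW/Hd; rewrite -ball_normE /= sub0r normrN normrZ.
apply: le_lt_trans (ler_wpM2r _ th) _ => //.
rewrite gtr0_norm // /h mulrAC ltr_pdivrMr // ltr_pM2l //.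
by rewrite ltrDr.
Qed.

Lemma mean_by_parts f u k : cper e f -> (forall x, derivable f x u) ->
  cper e (fun x => 'D_u f x) ->
  mean e (fun x => 'D_u f x * cas (xi e k) x) =
  - (2 * pi * dot u (xi e k)) * mean e (fun x => f x * cas (xi e (- k)) x).
Proof.
move=> fp fd dp.
have cp := cper_cas He.
have DE x : 'D_u (fun x => f x * cas (xi e k) x) x =
    'D_u f x * cas (xi e k) x + (2 * pi * dot u (xi e k)) * (f x * cas (xi e (- k)) x).
  rewrite deriveM //; last exact: derivable_cas.
  by rewrite derive_cas xiN /GRing.scale /=; ring.
have c1 : cper e (fun x => 'D_u f x * cas (xi e k) x) by exact: cperM.
have c2 : cper e (fun x => (2 * pi * dot u (xi e k)) * (f x * cas (xi e (- k)) x)).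
  by apply: cperZ; exact: cperM.
have : mean e (fun x => 'D_u (fun x => f x * cas (xi e k) x) x) = 0.
  apply: mean_derive.
  - exact: cperM.
  - by move=> x; apply: derivableM; [exact: fd|exact: derivable_cas].
  - by under eq_fun do rewrite DE; exact: cperD.
under eq_fun do rewrite DE.
rewrite meanD // meanZ //; last exact: cperM.
by move/eqP; rewrite addr_eq0 mulNr => /eqP.
Qed.

Lemma mean_cos k a : k != 0 -> mean e (fun x => cos (2 * pi * dot (xi e k) x + a)) = 0.
Proof.
move=> k0; have [j kj] : exists j, k j != 0.
  apply/existsP; apply: contraNT k0; rewrite negb_exists => /forallP k0.
  by apply/eqP/ffunP => j; apply/eqP; have := k0 j; rewrite negbK ffunE.
have kj0 : (k j)%:~R != 0 :> R by rewrite intr_eq0.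
(* Half a period of the mode along [e j]: the phase grows by [pi], so the cosine changes sign and
   its mean is its own opposite. *)
pose h : 'cV[R]_n := (2 * (k j)%:~R)^-1 *: e j.
have cp := cper_cos He k a.
have := mean_shift He h cp.
have -> : (fun x => cos (2 * pi * dot (xi e k) (x + h) + a)) =
          (fun x => - cos (2 * pi * dot (xi e k) x + a)).
  apply/funext => x; rewrite -cosDpi; congr cos.
  rewrite dotDr dotZr (dotC (xi e k) (e j)) dot_xi //; field.
  exact: kj0.
rewrite meanN // => /eqP; rewrite eqNr => /eqP.
by [].
Qed.

Lemma mean_sin k : mean e (fun x => sin (2 * pi * dot (xi e k) x)) = 0.
Proof.
have [->|k0] := eqVneq k 0.
  under eq_fun do rewrite xi0 dot0l mulr0 sin0.
  exact: mean_cst.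
under eq_fun do rewrite -cosBpihalf.
exact: mean_cos.
Qed.

Lemma cas_mul (u v x : 'cV[R]_n) : cas u x * cas v x =
  cos (2 * pi * dot (u - v) x) + sin (2 * pi * dot (u + v) x) :> R.
Proof. by rewrite /cas dotDl dotNl dotDl !mulrDr mulrN cosB sinD; ring. Qed.

(** By [cas_mul] the product is a cosine at [k - l] plus a sine at [k + l]; every sine has mean
    zero, and the cosine has mean zero unless [k = l]. *)
Lemma mean_cas_mul k l :
  mean e (fun x => cas (xi e k) x * cas (xi e l) x) = (k == l)%:R.
Proof.
under eq_fun do rewrite cas_mul -xiN -!xiD.
under eq_fun do rewrite -[X in cos X]addr0.
rewrite (meanD He); first last.
- by under eq_fun do rewrite -[X in sin X]addr0; exact: cper_sin.
- exact: cper_cos.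
rewrite mean_sin addr0; have [->|kl] := eqVneq k l.
  under eq_fun do rewrite subrr xi0 dot0l mulr0 addr0 cos0.
  by rewrite mean_cst.
by rewrite mean_cos // subr_eq0.
Qed.

End mean_derive.

(** * Fejer kernels and uniqueness of Fourier coefficients *)

Section fejer.
Context {R : realType}.

(* Over [0 <= l < K] this is the Fejer kernel of order [2 ^ K]. *)
Definition fejer (i K : nat) (t : R) : R :=
  \prod_(i <= l < K) (1 + cos (2 ^+ l * t)).

Lemma fejer_ge0 i K t : 0 <= fejer i K t.
Proof. by apply: prodr_ge0 => l _; rewrite -lerBlDl sub0r cos_geN1. Qed.

(** Each factor doubles the angle, since [(1 - cos u) * (1 + cos u)] equals [(1 - cos (2 * u)) / 2],
    so the product telescopes. *)
Lemma fejerE K t : (1 - cos t) * fejer 0 K t = 2 ^- K * (1 - cos (2 ^+ K * t)).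
Proof.
elim: K => [|K IH]; first by rewrite /fejer big_geq // expr0 invr1 mulr1 !mul1r.
rewrite /fejer big_nat_recr //= mulrA IH -mulrA.
have -> : 2 ^+ K.+1 * t = (2 ^+ K * t) *+ 2.
  by rewrite exprS -mulrA mulr_natl.
rewrite cos_mulr2n exprSr invfM; field.
by rewrite expf_neq0.
Qed.

Lemma fejer_far K t eta : 0 < eta -> eta <= 1 - cos t ->
  fejer 0 K t <= 2 * 2 ^- K / eta.
Proof.
move=> eta0 et; rewrite ler_pdivlMr // mulrC.
apply: (@le_trans _ _ ((1 - cos t) * fejer 0 K t)).
  by rewrite ler_wpM2r // fejer_ge0.
rewrite fejerE mulrC ler_wpM2r ?invr_ge0 ?exprn_ge0 //.
by rewrite lerBlDr -lerBlDl; have := cos_geN1 (2 ^+ K * t); lra.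
Qed.

Lemma cos_near_int (del : R) : 0 < del -> exists2 eta : R, 0 < eta &
  forall s : R, 1 - cos (2 * pi * s) < eta ->
    exists m : int, `|s + m%:~R| < del.
Proof.
have p0 := pi_gt0 R.
(* Capping at 1/2 keeps [2 * pi * d] in [[0, pi]], where the cosine is decreasing. *)
move=> del0; pose d := Num.min del (2^-1).
have d0 : 0 < d by rewrite lt_min del0 invr_gt0 ltr0n.
have d2 : d <= 2^-1 by rewrite ge_min lexx orbT.
have cI (s : R) : 0 <= s -> s <= 2^-1 -> 2 * pi * s \in `[0, pi].
  move=> s0 s1; rewrite in_itv /=; apply/andP; split.
    by apply: mulr_ge0 => //; lra.
  rewrite -subr_ge0 (_ : pi - 2 * pi * s = pi * (1 - 2 * s)); last by ring.
  by apply: mulr_ge0; [exact: ltW|lra].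
exists (1 - cos (2 * pi * d)).
  rewrite subr_gt0 -[ltRHS]cos0 ltr_cos ?(cI d (ltW d0) d2) //.
    by apply: mulr_gt0 => //; lra.
  by rewrite in_itv /= lexx ltW.
move=> s hs; pose m := - Num.floor (s + 2^-1); exists m.
have fl : `|s + m%:~R| <= 2^-1.
  have := floor_le_tmp (s + 2^-1); have := floorD1_gt (s + 2^-1).
  by rewrite intrD /m rmorphN /= ler_norml; lra.
rewrite ltNge; apply/negP => dl; move: hs; rewrite ltNge => /negP; apply.
rewrite lerD2l lerN2 -(cos_periodz (2 * pi * s) m) -mulrDr.
have -> : cos (2 * pi * (s + m%:~R)) = cos (2 * pi * `|s + m%:~R|).
  have [h|h] := ler0P (s + m%:~R); last by [].
  by rewrite mulrN cosN.
have dd : d <= `|s + m%:~R| by rewrite ge_min dl.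
rewrite leNgt ltr_cos ?(cI d (ltW d0) d2) ?(cI _ (normr_ge0 _) fl) // -leNgt.
by rewrite ler_pM2l //; lra.
Qed.

End fejer.

Section uniqueness.
Context {R : realType} {n : nat} (e : 'I_n -> 'cV[R]_n).
Hypothesis He : forall i j, dot (e i) (e j) = (i == j)%:R.
Implicit Types (f g : 'cV[R]_n -> R) (k l : {ffun 'I_n -> int}).

Lemma mean_le f g : cper e f -> cper e g -> (forall x, f x <= g x) ->
  mean e f <= mean e g.
Proof.
move=> fp gp fg; rewrite -subr_ge0 -meanB //.
apply: (cvgr_to_ge (mean_cvg He (cperB gp fp))); apply: filterE => N.
rewrite /gmean mulr_ge0 ?invr_ge0 ?ler0n // sumr_ge0 // => i _.
by rewrite subr_ge0.
Qed.

Definition coord2pi (j : 'I_n) (x : 'cV[R]_n) : R := 2 * pi * dot (e j) x.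

Definition axis (j : 'I_n) (m : nat) : {ffun 'I_n -> int} :=
  [ffun i => if i == j then m%:Z else 0].

Lemma xi_axis j m : xi e (axis j m) = m%:R *: e j.
Proof.
rewrite /xi (bigD1 j) //= ffunE eqxx big1 ?addr0 // => i ij.
by rewrite ffunE (negPf ij) scale0r.
Qed.

Lemma coord2pi_axis j m x :
  m%:R * coord2pi j x = 2 * pi * dot (xi e (axis j m)) x.
Proof. by rewrite xi_axis dotZl /coord2pi; ring. Qed.

Lemma cper_cos_axis j (m : nat) : cper e (fun x => cos (m%:R * coord2pi j x)).
Proof.
under eq_fun do rewrite coord2pi_axis -[X in cos X]addr0.
exact: cper_cos.
Qed.

Lemma cper_fejer i K j : cper e (fun x => fejer i K (coord2pi j x)).
Proof.
apply: cper_prod => l _; apply: cperD; first exact: cper_cst.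
by under eq_fun do rewrite -natrX; exact: cper_cos_axis.
Qed.

(** Factors are added from the highest frequency down. Half a period of the new cosine along [e j]
    is a whole number of periods of all factors already present and leaves [W] unchanged, so the
    added term [H] is negated by that shift and has mean zero. *)
Lemma mean_fejer_step i K j W : cper e W -> (forall x h, W (x + h *: e j) = W x) ->
  (i <= K)%N ->
  mean e (fun x => fejer (K - i) K (coord2pi j x) * W x) = mean e W.
Proof.
move=> Wp Wj; elim: i => [|i IH] iK.
  rewrite subn0; congr mean; apply/funext => x.
  by rewrite /fejer big_geq // mul1r.
rewrite -[RHS](IH (ltnW iK)).
set s := (K - i.+1)%N; have sE : (K - i)%N = s.+1 by rewrite /s; lia.
have sK : (s < K)%N by rewrite /s; lia.
rewrite sE.
pose H x := cos (2 ^+ s * coord2pi j x) * (fejer s.+1 K (coord2pi j x) * W x).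
have Hp : cper e H.
  apply: cperM; last by apply: cperM => //; exact: cper_fejer.
  by under eq_fun do rewrite -natrX; exact: cper_cos_axis.
have H0 : mean e H = 0.
  pose h := (2 ^+ s.+1)^-1 *: e j.
  have ch x : coord2pi j (x + h) = coord2pi j x + 2 * pi * (2 ^+ s.+1)^-1.
    by rewrite /coord2pi dotDr dotZr He eqxx mulr1 mulrDr.
  have := mean_shift He h Hp.
  have -> : (fun x => H (x + h)) = (fun x => - H x).
    apply/funext => x; rewrite /H Wj ch -mulNr; congr (_ * (_ * _)).
      rewrite -cosDpi; congr cos; rewrite mulrDr; congr (_ + _).
      by rewrite exprSr; field; rewrite expf_neq0.
    apply: eq_big_nat => l /andP[sl _]; congr (_ + _).
    rewrite mulrDr -[RHS](cos_periodz _ (2 ^ (l - s.+1))%N%:Z).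
    congr (cos (_ + _)); rewrite -[(_%:Z)%:~R]/((2 ^ (l - s.+1))%N%:R) natrX.
    have -> : 2 ^+ l = 2 ^+ (l - s.+1) * 2 ^+ s.+1 :> R by rewrite -exprD subnK.
    by field; rewrite expf_neq0.
  by rewrite meanN // => /eqP; rewrite eqNr => /eqP.
have -> : (fun x => fejer s K (coord2pi j x) * W x) =
    (fun x => fejer s.+1 K (coord2pi j x) * W x + H x).
  by apply/funext => x; rewrite /H /fejer big_ltn //; ring.
rewrite meanD // ?H0 ?addr0 //.
by apply: cperM => //; exact: cper_fejer.
Qed.

Lemma mean_prod_fejer K (r : seq 'I_n) : uniq r ->
  mean e (fun x => \prod_(j <- r) fejer 0 K (coord2pi j x)) = 1.
Proof.
elim: r => [_|j r IH /= /andP[jr ur]].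
  by under eq_fun do rewrite big_nil; exact: mean_cst.
under eq_fun do rewrite big_cons.
have := @mean_fejer_step K K j (fun x => \prod_(j <- r) fejer 0 K (coord2pi j x)).
rewrite subnn => -> //; first exact: IH.
  by apply: cper_prod => i _; exact: cper_fejer.
move=> x h; apply: eq_big_seq => i ir; congr fejer.
rewrite /coord2pi dotDr dotZr He; case: eqP => [ij|]; last by rewrite mulr0 addr0.
by move: jr; rewrite -ij ir.
Qed.

Lemma cos_mul_cas k l x : cos (2 * pi * dot (xi e l) x) * cas (xi e k) x =
  2^-1 * (cas (xi e (k + l)) x + cas (xi e (k - l)) x).
Proof.
rewrite /cas !xiD xiN !dotDl !dotNl !mulrDr !mulrN cosD sinD cosB sinB.
by field.
Qed.

(** By [cos_mul_cas] a cosine factor only moves frequencies, so the vanishing of all coefficients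
    together survives each factor; hence the induction for every [k] at once. *)
Lemma mean_mul_prod_cos f (r : seq ('I_n * nat)) : cper e f ->
  (forall k, mean e (fun x => f x * cas (xi e k) x) = 0) ->
  forall k, mean e (fun x => f x * \prod_(jm <- r) (1 + cos (jm.2%:R * coord2pi jm.1 x))
     * cas (xi e k) x) = 0.
Proof.
move=> fp f0; elim: r => [|[j m] r IH] k.
  by under eq_fun do rewrite big_nil mulr1; exact: f0.
set P := fun x => \prod_(jm <- r) (1 + cos (jm.2%:R * coord2pi jm.1 x)).
have Pp : cper e P.
  apply: cper_prod => jm _; apply: cperD; first exact: cper_cst.
  exact: cper_cos_axis.
have PC l : cper e (fun x => f x * P x * cas (xi e l) x).
  by apply: cperM; [exact: cperM|exact: cper_cas].
have -> : (fun x => f x * \prod_(jm <- (j, m) :: r) (1 + cos (jm.2%:R * coord2pi jm.1 x))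
     * cas (xi e k) x) =
  (fun x => f x * P x * cas (xi e k) x + 2^-1 * (f x * P x * cas (xi e (k + axis j m)) x
     + f x * P x * cas (xi e (k - axis j m)) x)).
  apply/funext => x; rewrite big_cons -/(P x) /= coord2pi_axis.
  transitivity (f x * P x * cas (xi e k) x + f x * P x *
      (2^-1 * (cas (xi e (k + axis j m)) x + cas (xi e (k - axis j m)) x))).
    by rewrite -cos_mul_cas; ring.
  by ring.
have Q := cperD (PC (k + axis j m)) (PC (k - axis j m)).
rewrite (meanD He (PC k) (cperZ _ Q)) (meanZ He _ Q).
by rewrite (meanD He (PC _) (PC _)) !IH addr0 mulr0 addr0.
Qed.

Lemma mean_mul_fejer f K : cper e f ->
  (forall k, mean e (fun x => f x * cas (xi e k) x) = 0) ->
  mean e (fun x => f x * \prod_j fejer 0 K (coord2pi j x)) = 0.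
Proof.
move=> fp f0.
have := mean_mul_prod_cos [seq (j, 2 ^ m)%N | j <- index_enum 'I_n, m <- index_iota 0 K] fp f0 0.
congr (_ = _); congr mean; apply/funext => x.
rewrite xi0 /cas dot0l mulr0 cos0 sin0 addr0 mulr1; congr (_ * _).
rewrite big_allpairs_dep /=; apply: eq_bigr => j _; apply: eq_bigr => l _.
by rewrite natrX.
Qed.

(** Closeness to the lattice is measured by [1 - cos] because [fejer_far] bounds the kernel in the
    same terms. *)
Lemma cper_near f (eps : R) : cper e f -> 0 < eps -> exists2 eta : R, 0 < eta &
  forall x, (forall j, 1 - cos (coord2pi j x) < eta) -> `|f x - f 0| < eps.
Proof.
move=> fp eps0.
have /nbhs_ballP[d /= d0 Hd] := cper_unif He fp eps0.
have c0 : 0 <= cell_bound e by apply: sumr_ge0.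
have c1 : 0 < 1 + cell_bound e by rewrite ltr_pwDl.
have [eta eta0 Heta] := cos_near_int (divr_gt0 d0 c1).
exists eta => // x Hx.
have {}Hx j := cid (Heta _ (Hx j)).
pose k : {ffun 'I_n -> int} := [ffun j => sval (Hx j)].
rewrite -(cper_lat k x fp) -[x + _]add0r; apply: Hd.
rewrite -ball_normE /= sub0r normrN (basis_expand He (x + xi e k)).
apply: (le_lt_trans (ler_norm_sum _ _ _)).
apply: (@le_lt_trans _ _ (\sum_i d / (1 + cell_bound e) * `|e i|)).
  apply: ler_sum => i _; rewrite normrZ ler_wpM2r //.
  by rewrite dotDr dot_xi // ffunE ltW // (svalP (Hx i)).
rewrite -mulr_sumr -/(cell_bound e) mulrAC ltr_pdivrMr // ltr_pM2l //.
by rewrite ltrDr.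
Qed.

(** [f] times the product kernel has mean zero and the kernel has mean 1, so [- f 0] is the mean of
    [f - f 0] times the kernel. Near the lattice [f - f 0] is small by continuity; elsewhere some
    factor of the kernel is small. *)
Lemma cper_eq0_at0 f : cper e f ->
  (forall k, mean e (fun x => f x * cas (xi e k) x) = 0) -> f 0 = 0.
Proof.
move=> fp f0; apply/eqP; rewrite -normr_le0.
apply/ler_addgt0Pr => eps eps0; rewrite add0r.
have e20 : 0 < eps / 2 by rewrite divr_gt0.
have [eta eta0 Heta] := cper_near fp e20.
have [C HC] := cper_bdd He fp.
have C0 : 0 <= C by apply: le_trans (HC 0).
pose D := (2 * C) * (2 / eta) * n%:R + 1.
have D0 : 0 < D.
  rewrite ltr_wpDl // mulr_ge0 // mulr_ge0 ?mulr_ge0 //.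
  by rewrite invr_ge0 ltW.
have [K _ HK] := near_infty_natSinv_expn_lt (PosNum (divr_gt0 e20 D0)).
have {}HK : 2 ^- K * D < eps / 2.
  by have := HK K (leqnn K); rewrite /= ltr_pdivlMr // div1r.
pose F x := \prod_j fejer 0 K (coord2pi j x).
(* Away from the lattice one factor [j] is bounded pointwise; the product of the others, of mean 1,
   is kept in the majorant [B]. *)
pose F' j x := \prod_(i <- rem j (index_enum 'I_n)) fejer 0 K (coord2pi i x).
have Fp : cper e F by apply: cper_prod => j _; exact: cper_fejer.
have F'p j : cper e (F' j) by apply: cper_prod => i _; exact: cper_fejer.
have F0 x : 0 <= F x by apply: prodr_ge0 => j _; exact: fejer_ge0.
have F'0 j x : 0 <= F' j x by apply: prodr_ge0 => i _; exact: fejer_ge0.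
have ui : uniq (index_enum 'I_n) by exact: index_enum_uniq.
have FF' j x : F x = fejer 0 K (coord2pi j x) * F' j x.
  by rewrite /F (perm_big _ (perm_to_rem (mem_index_enum j))) big_cons.
have MF : mean e F = 1 by exact: mean_prod_fejer.
have MF' j : mean e (F' j) = 1 by apply: mean_prod_fejer; exact: rem_uniq.
pose B x := (eps / 2) * F x + \sum_j ((2 * C) * (2 * 2 ^- K / eta)) * F' j x.
have Bp : cper e B.
  by apply: cperD; [exact: cperZ|apply: cper_sum => j _; exact: cperZ].
have MB : mean e B = eps / 2 + 2 ^- K * ((2 * C) * (2 / eta) * n%:R).
  have c1 j : cper e (fun x => ((2 * C) * (2 * 2 ^- K / eta)) * F' j x) by exact: cperZ.
  have c2 : cper e (fun x => \sum_j ((2 * C) * (2 * 2 ^- K / eta)) * F' j x).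
    by apply: cper_sum => j _.
  rewrite /B (meanD He (cperZ _ Fp) c2) (meanZ He _ Fp) MF (mean_sum He) //.
  under eq_bigr do rewrite meanZ // MF' mulr1.
  by rewrite sumr_const card_ord -mulr_natr; ring.
have cc0 : 0 <= (2 * C) * (2 * 2 ^- K / eta).
  have k0 : 0 <= 2 ^- K :> R by rewrite invr_ge0 exprn_ge0.
  have i0 : 0 <= eta^-1 by rewrite invr_ge0 ltW.
  by rewrite !mulr_ge0.
have key x : `|f x - f 0| * F x <= B x.
  rewrite /B; have [near|] := pselect (forall j, 1 - cos (coord2pi j x) < eta).
    rewrite ler_wpDr //; last by rewrite ler_wpM2r // ltW // Heta.
    by apply: sumr_ge0 => j _; rewrite mulr_ge0.
  move=> /existsNP[j /negP]; rewrite -leNgt => far.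
  apply: ler_wpDl; first by rewrite mulr_ge0 // ltW.
  rewrite (bigD1 j) //=; apply: ler_wpDr.
    by apply: sumr_ge0 => i _; rewrite mulr_ge0.
  rewrite (FF' j) mulrA ler_wpM2r //.
  apply: ler_pM => //; first exact: fejer_ge0.
    by rewrite mulr_natl mulr2n (le_trans (ler_normB _ _)) // lerD.
  exact: fejer_far.
have fBp : cper e (fun x => (f x - f 0) * F x).
  by apply: cperM => //; apply: cperB => //; exact: cper_cst.
have MfF : mean e (fun x => (f x - f 0) * F x) = - f 0.
  under eq_fun do rewrite mulrBl.
  rewrite meanB ?meanZ ?MF ?mulr1 //; [|exact: cperM|exact: cperZ].
  by rewrite mean_mul_fejer // sub0r.
have bnd : eps / 2 + 2 ^- K * (2 * C * (2 / eta) * n%:R) <= eps.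
  have : 2 ^- K * (2 * C * (2 / eta) * n%:R) <= eps / 2.
    apply: le_trans (ltW HK); rewrite ler_wpM2l ?invr_ge0 ?exprn_ge0 //.
    by rewrite /D lerDl.
  by lra.
apply: le_trans bnd; rewrite -MB.
rewrite ler_norml; apply/andP; split; last first.
  rewrite -[f 0]opprK -MfF -meanN //; apply: mean_le => // [|x].
    exact: cperN.
  apply: le_trans (key x); rewrite -mulNr ler_wpM2r //.
  by rewrite opprB distrC ler_norm.
rewrite lerNl -MfF; apply: mean_le => // x.
by apply: le_trans (key x); rewrite ler_wpM2r // ler_norm.
Qed.

Lemma cas_shift k (x y : 'cV[R]_n) : cas (xi e k) (x - y) =
  cos (2 * pi * dot (xi e k) y) * cas (xi e k) x
  - sin (2 * pi * dot (xi e k) y) * cas (xi e (- k)) x.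
Proof.
rewrite /cas xiN dotDr !dotNr !dotNl !mulrDr !mulrN cosB sinB cosN sinN; ring.
Qed.

(** Translating by [y] mixes only the coefficients at [k] and [- k], so the hypothesis passes to the
    translate and evaluation at 0 suffices. *)
Lemma cper_eq0 f : cper e f ->
  (forall k, mean e (fun x => f x * cas (xi e k) x) = 0) -> forall x, f x = 0.
Proof.
move=> fp f0 y; rewrite -[y]add0r.
apply: (@cper_eq0_at0 (fun x => f (x + y))); first exact: cper_shift.
move=> k; have cp : cper e (fun x => f x * cas (xi e k) (x - y)).
  by apply: cperM => //; apply: cper_shift; exact: cper_cas.
have := mean_shift He y cp.
under eq_fun do rewrite addrK; move=> ->.
have cc l : cper e (fun x => f x * cas (xi e l) x).
  by apply: cperM => //; exact: cper_cas.
have -> : (fun x => f x * cas (xi e k) (x - y)) =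
  fun x => cos (2 * pi * dot (xi e k) y) * (f x * cas (xi e k) x)
   - sin (2 * pi * dot (xi e k) y) * (f x * cas (xi e (- k)) x).
  by apply/funext => x; rewrite cas_shift; ring.
by rewrite meanB ?meanZ ?f0 ?mulr0 ?subr0 //; exact: cperZ.
Qed.

Lemma cper_ext f g : cper e f -> cper e g ->
  (forall k, mean e (fun x => f x * cas (xi e k) x) =
             mean e (fun x => g x * cas (xi e k) x)) -> f = g.
Proof.
move=> fp gp fg; apply/funext => x; apply/eqP; rewrite -subr_eq0; apply/eqP.
apply: (@cper_eq0 (fun x => f x - g x)); first exact: cperB.
move=> k; have cp := cper_cas He k.
under eq_fun do rewrite mulrBl.
by rewrite meanB ?fg ?subrr //; exact: cperM.
Qed.

End uniqueness.

(** * Absolutely summable families *)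

Section rsum.
Context {R : realType} {T : choiceType}.
Implicit Types (f g a b : T -> R).

Definition asum f : Prop := summable [set: T] (EFin \o f).

Lemma esum_EFin_ge0 f : (forall i, 0 <= f i) ->
  (0 <= \esum_(i in [set: T]) (f i)%:E)%E.
Proof. by move=> f0; apply: esum_ge0 => i _; rewrite lee_fin. Qed.

Lemma asumE f : asum f <-> (\esum_(i in [set: T]) `|f i|%:E < +oo)%E.
Proof. by []. Qed.

Lemma asum_fin_num f : (forall i, 0 <= f i) -> asum f ->
  (\esum_(i in [set: T]) (f i)%:E)%E \is a fin_num.
Proof.
move=> f0 /asumE; under eq_esum do rewrite ger0_norm //.
by move=> h; rewrite ge0_fin_numE // esum_EFin_ge0.
Qed.

Lemma asum_le f g : (forall i, `|f i| <= g i) -> asum g -> asum f.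
Proof.
move=> fg /asumE gs; apply/asumE; apply: le_lt_trans gs.
apply: le_esum => i _; rewrite lee_fin.
by apply: le_trans (fg i) _; exact: ler_norm.
Qed.

Lemma asum_norm f : asum f -> asum (fun i => `|f i|).
Proof. by move/asumE=> fs; apply/asumE; under eq_esum do rewrite normr_id. Qed.

Lemma asumD f g : asum f -> asum g -> asum (fun i => f i + g i).
Proof. exact: summableD. Qed.

Lemma asumZ c f : asum f -> asum (fun i => c * f i).
Proof.
move=> /asum_norm fs; pose m := Num.bound `|c|.
have mS (j : nat) : asum (fun i => j%:R * `|f i|).
  elim: j => [|j IH].
    under eq_fun do rewrite mul0r.
    by apply/asumE; rewrite esum1 // => i _; rewrite normr0.
  under eq_fun do rewrite -natr1 mulrDl mul1r.
  exact: asumD.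
apply: asum_le (mS m) => i; rewrite normrM ler_wpM2r //.
by rewrite ltW // archi_boundP.
Qed.

Lemma asumN f : asum f -> asum (fun i => - f i).
Proof. by move=> fs; under eq_fun do rewrite -mulN1r; exact: asumZ. Qed.

Lemma asumB f g : asum f -> asum g -> asum (fun i => f i - g i).
Proof. by move=> fs gs; apply: asumD => //; exact: asumN. Qed.

Lemma asum_sum (I : Type) (r : seq I) (P : pred I) (F : I -> T -> R) :
  (forall i, P i -> asum (F i)) -> asum (fun t => \sum_(i <- r | P i) F i t).
Proof.
move=> Fs; elim: r => [|i r IH].
  under eq_fun do rewrite big_nil.
  by apply/asumE; rewrite esum1 // => i _; rewrite normr0.
under eq_fun do rewrite big_cons.
by case Pi: (P i) => //; apply: asumD => //; exact: Fs.
Qed.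

Let pos f i := Num.max (f i) 0.
Let neg f i := Num.max (- f i) 0.

Let pos0 f i : 0 <= pos f i. Proof. by rewrite /pos le_max lexx orbT. Qed.
Let neg0 f i : 0 <= neg f i. Proof. by rewrite /neg le_max lexx orbT. Qed.

Let pos_neg f i : f i = pos f i - neg f i.
Proof.
rewrite /pos /neg !maxEle.
by case: (lerP (f i) 0) => h; case: (lerP (- f i) 0) => h'; lra.
Qed.

Let pos_le f i : `|pos f i| <= `|f i|.
Proof. by rewrite /pos maxEle; case: ifP; rewrite ?normr0 ?normr_ge0. Qed.

Let neg_le f i : `|neg f i| <= `|f i|.
Proof. by rewrite /neg maxEle; case: ifP; rewrite ?normr0 ?normr_ge0 ?normrN. Qed.

Let asum_pos f : asum f -> asum (pos f).
Proof. by move=> /asum_norm; apply: asum_le; exact: pos_le. Qed.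

Let asum_neg f : asum f -> asum (neg f).
Proof. by move=> /asum_norm; apply: asum_le; exact: neg_le. Qed.

Let rsum_posneg f : rsum f = fine (\esum_(i in [set: T]) (pos f i)%:E)%E
  - fine (\esum_(i in [set: T]) (neg f i)%:E)%E.
Proof.
rewrite /rsum; congr (fine _ - fine _); apply: eq_esum => i _.
  by rewrite funeposE /pos EFin_max.
by rewrite funenegE /neg EFin_max.
Qed.

(* Independence of the decomposition into nonnegative parts; linearity of
   [rsum] follows. *)
Lemma rsumE f a b : (forall i, 0 <= a i) -> (forall i, 0 <= b i) ->
  asum a -> asum b -> (forall i, f i = a i - b i) ->
  rsum f = fine (\esum_(i in [set: T]) (a i)%:E)%E
         - fine (\esum_(i in [set: T]) (b i)%:E)%E.
Proof.
move=> a0 b0 sa sb fab; rewrite rsum_posneg.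
have sf : asum f by rewrite (_ : f = fun i => a i - b i); [exact: asumB|exact: funext].
have ap := asum_pos sf; have an := asum_neg sf.
have fp := asum_fin_num (pos0 f) ap; have fn := asum_fin_num (neg0 f) an.
have fa := asum_fin_num a0 sa; have fb := asum_fin_num b0 sb.
have E : (\esum_(i in [set: T]) (pos f i)%:E + \esum_(i in [set: T]) (b i)%:E =
  \esum_(i in [set: T]) (a i)%:E + \esum_(i in [set: T]) (neg f i)%:E)%E.
  rewrite -!esumD //; try by move=> i _; rewrite lee_fin.
  apply: eq_esum => i _; rewrite -!EFinD; congr EFin.
  by have := pos_neg f i; rewrite fab; lra.
have := congr1 fine E; rewrite !fineD //.
by move: (fine _) (fine _) (fine _) (fine _) => x y z t; lra.
Qed.

Lemma rsum_ge0E f : (forall i, 0 <= f i) ->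
  rsum f = fine (\esum_(i in [set: T]) (f i)%:E)%E.
Proof.
move=> f0; rewrite rsum_posneg -[RHS]subr0; congr (_ - _).
  by congr fine; apply: eq_esum => i _; rewrite /pos max_l.
by rewrite esum1 // => i _; rewrite /neg max_r // oppr_le0.
Qed.

Lemma rsum_esum f : (forall i, 0 <= f i) -> asum f ->
  (rsum f)%:E = (\esum_(i in [set: T]) (f i)%:E)%E.
Proof. by move=> f0 fs; rewrite rsum_ge0E // fineK // asum_fin_num. Qed.

Lemma rsum_ge0 f : (forall i, 0 <= f i) -> 0 <= rsum f.
Proof. by move=> f0; rewrite rsum_ge0E // fine_ge0 // esum_EFin_ge0. Qed.

Lemma eq_rsum f g : f =1 g -> rsum f = rsum g.
Proof. by move=> /funext ->. Qed.

Lemma rsumN f : asum f -> rsum (fun i => - f i) = - rsum f.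
Proof.
move=> fs; rewrite [in RHS]rsum_posneg opprB.
apply: rsumE => //; [exact: asum_neg|exact: asum_pos|].
by move=> i; rewrite [in LHS](pos_neg f i) opprB.
Qed.

Lemma rsumD f g : asum f -> asum g -> rsum (fun i => f i + g i) = rsum f + rsum g.
Proof.
move=> fs gs.
have pp := asumD (asum_pos fs) (asum_pos gs).
have nn := asumD (asum_neg fs) (asum_neg gs).
rewrite (rsumE (a := fun i => pos f i + pos g i) (b := fun i => neg f i + neg g i)) //; first last.
- by move=> i; rewrite {1}(pos_neg f i) {1}(pos_neg g i); ring.
- by move=> i; exact: addr_ge0.
- by move=> i; exact: addr_ge0.
rewrite -!rsum_ge0E; first last.
- by move=> i; exact: addr_ge0.
- by move=> i; exact: addr_ge0.
have pD (u v : T -> R) : (forall i, 0 <= u i) -> (forall i, 0 <= v i) -> asum u -> asum v ->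
    rsum (fun i => u i + v i) = rsum u + rsum v.
  move=> u0 v0 us vs; rewrite !rsum_ge0E //; last by move=> i; exact: addr_ge0.
  rewrite -fineD ?asum_fin_num // -esumD //; last first.
  - by move=> i _; rewrite lee_fin.
  - by move=> i _; rewrite lee_fin.
rewrite !pD //; try (by apply: asum_pos); try (by apply: asum_neg).
by rewrite (rsum_posneg f) (rsum_posneg g) -!rsum_ge0E //; ring.
Qed.

Lemma rsumB f g : asum f -> asum g -> rsum (fun i => f i - g i) = rsum f - rsum g.
Proof. by move=> fs gs; rewrite rsumD ?rsumN //; exact: asumN. Qed.

Lemma rsum_le f g : asum f -> asum g -> (forall i, f i <= g i) -> rsum f <= rsum g.
Proof.
move=> fs gs fg; rewrite -subr_ge0 -rsumB //; apply: rsum_ge0 => i.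
by rewrite subr_ge0.
Qed.

Lemma rsum_norm f : asum f -> `|rsum f| <= rsum (fun i => `|f i|).
Proof.
move=> fs; have ns := asum_norm fs.
rewrite ler_norml; apply/andP; split.
  rewrite -rsumN //; apply: rsum_le => //; first exact: asumN.
  by move=> i; rewrite lerNl -normrN ler_norm.
by apply: rsum_le => // i; exact: ler_norm.
Qed.

Lemma rsum_finite f (A : {fset T}) : (forall i, i \notin A -> f i = 0) ->
  asum f /\ rsum f = \sum_(i <- A) f i.
Proof.
move=> fA.
have E g : (forall i, 0 <= g i) -> (forall i, i \notin A -> g i = 0) ->
    (\esum_(i in [set: T]) (g i)%:E = (\sum_(i <- A) g i)%:E)%E.
  move=> g0 gA; rewrite -sumEFin.
  have := @esum_fset R T [set` A] (fun i => (g i)%:E) (finite_fset A).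
  rewrite fsbig_finite ?finite_fset // set_fsetK => <-; last first.
    by move=> i _; rewrite lee_fin.
  rewrite [RHS]esum_mkcond; apply: eq_esum => i _.
  by case: ifPn => // iA; rewrite gA //; apply: contra iA => iA; rewrite inE.
split.
  by apply/asumE; rewrite E ?ltry // => i iA; rewrite fA ?normr0.
rewrite rsum_posneg !E //; first last.
- by move=> i iA; rewrite /pos fA // maxxx.
- by move=> i iA; rewrite /neg fA // oppr0 maxxx.
by rewrite /= -sumrB; apply: eq_bigr => i _; rewrite -pos_neg.
Qed.

Lemma asum_bound f C : (forall i, 0 <= f i) ->
  (forall A : {fset T}, \sum_(i <- A) f i <= C) -> asum f /\ rsum f <= C.
Proof.
move=> f0 fC.
have H : (\esum_(i in [set: T]) (f i)%:E <= C%:E)%E.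
  apply: ge_ereal_sup => _ [A [finA _] <-].
  by rewrite fsbig_finite // sumEFin lee_fin.
have fs : asum f.
  apply/asumE; under eq_esum do rewrite ger0_norm //.
  by apply: le_lt_trans H _; exact: ltry.
by split => //; rewrite -lee_fin rsum_esum.
Qed.

Lemma sum_le_rsum f (A : {fset T}) : (forall i, 0 <= f i) -> asum f ->
  \sum_(i <- A) f i <= rsum f.
Proof.
move=> f0 fs.
pose g i := if i \in A then f i else 0.
have [gs gE] : asum g /\ rsum g = \sum_(i <- A) g i.
  by apply: rsum_finite => i /negPf iA; rewrite /g iA.
have -> : \sum_(i <- A) f i = rsum g.
  by rewrite gE; apply: eq_big_seq => i iA; rewrite /g iA.
by apply: rsum_le => // i; rewrite /g; case: ifP.
Qed.

(** Finite partial sums give one inequality for nonnegative families; the reverse one is the same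
    inequality for the inverse factor. *)
Lemma rsumZ c f : asum f -> rsum (fun i => c * f i) = c * rsum f.
Proof.
move=> fs.
have leZ (a : R) (u : T -> R) : 0 <= a -> (forall i, 0 <= u i) -> asum u ->
    rsum (fun i => a * u i) <= a * rsum u.
  move=> a0 u0 us; apply: (asum_bound _ _).2 => [i|A]; first exact: mulr_ge0.
  by rewrite -mulr_sumr ler_wpM2l // sum_le_rsum.
have Z0 (a : R) (u : T -> R) : 0 <= a -> (forall i, 0 <= u i) -> asum u ->
    rsum (fun i => a * u i) = a * rsum u.
  move=> a0 u0 us; apply/eqP; rewrite eq_le leZ //=.
  have [->|an0] := eqVneq a 0.
    by rewrite mul0r rsum_ge0 // => i; rewrite mul0r.
  have a1 : 0 < a by rewrite lt_neqAle eq_sym an0.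
  have := leZ a^-1 (fun i => a * u i); rewrite invr_ge0 => /(_ a0).
  rewrite (_ : (fun i => a^-1 * (a * u i)) = u); last first.
    by apply/funext => i; rewrite mulKf.
  rewrite mulrC ler_pdivlMr // mulrC; apply.
    by move=> i; exact: mulr_ge0.
  exact: asumZ.
have Z1 (a : R) : 0 <= a -> rsum (fun i => a * f i) = a * rsum f.
  move=> a0; rewrite (_ : (fun i => a * f i) = fun i => a * pos f i - a * neg f i); last first.
    by apply/funext => i; rewrite -mulrBr -pos_neg.
  have ps := asum_pos fs; have ns := asum_neg fs.
  rewrite rsumB ?Z0 //; try exact: asumZ.
  by rewrite (rsum_posneg f) -!rsum_ge0E // [RHS]mulrBr.
have [c0|c0] := leP 0 c; first exact: Z1.
rewrite (_ : (fun i => c * f i) = fun i => - (- c * f i)); last first.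
  by apply/funext => i; rewrite mulNr opprK.
have cN : 0 <= - c by rewrite oppr_ge0 ltW.
by rewrite (rsumN (asumZ _ fs)) (Z1 _ cN) mulNr opprK.
Qed.

Lemma rsum_sum (I : Type) (r : seq I) (P : pred I) (F : I -> T -> R) :
  (forall i, P i -> asum (F i)) ->
  rsum (fun t => \sum_(i <- r | P i) F i t) = \sum_(i <- r | P i) rsum (F i).
Proof.
move=> Fs; elim: r => [|i r IH].
  rewrite big_nil; under eq_fun do rewrite big_nil.
  have [//|_ ->] := @rsum_finite (fun=> 0) fset0.
  by rewrite big_seq_fset0.
rewrite big_cons; under eq_fun do rewrite big_cons.
by case Pi: (P i) => //; rewrite rsumD ?IH //; [exact: Fs|exact: asum_sum].
Qed.

(** One finite set serves all families dominated by [f]. This uniformity plays the part of dominated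
    convergence when sums are exchanged with limits and means. *)
Lemma rsum_tail f (eps : R) : asum f -> 0 < eps -> exists A : {fset T},
  forall g, (forall i, `|g i| <= `|f i|) -> `|rsum g - \sum_(i <- A) g i| <= eps.
Proof.
move=> fs eps0; have ns := asum_norm fs.
have n0 i : 0 <= `|f i| by [].
have [A HA] : exists A : {fset T}, rsum (fun i => `|f i|) - eps < \sum_(i <- A) `|f i|.
  apply: contrapT => /forallNP H.
  have := (asum_bound n0 (C := rsum (fun i => `|f i|) - eps)).
  case; last by rewrite leNgt ltrBlDr ltrDl eps0.
  by move=> A; rewrite leNgt; apply/negP; exact: H.
exists A => g gf.
have gs : asum g by apply: asum_le ns.
pose r (h : T -> R) i := if i \in A then h i else 0.
have rE h : asum (r h) /\ rsum (r h) = \sum_(i <- A) h i.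
  have [s E] : asum (r h) /\ rsum (r h) = \sum_(i <- A) r h i.
    by apply: rsum_finite => i /negPf iA; rewrite /r iA.
  by split => //; rewrite E; apply: eq_big_seq => i iA; rewrite /r iA.
rewrite -(rE g).2 -rsumB //; last exact: (rE g).1.
have s1 : asum (fun i => g i - r g i) by apply: asumB => //; exact: (rE g).1.
apply: (le_trans (rsum_norm s1)).
apply: (@le_trans _ _ (rsum (fun i => `|f i| - r (fun i => `|f i|) i))).
  apply: rsum_le; [exact: asum_norm| |].
    by apply: asumB => //; exact: (rE _).1.
  by move=> i; rewrite /r; case: ifP => _; rewrite ?subrr ?subr0 ?normr0.
rewrite rsumB //; last exact: (rE _).1.
by rewrite (rE _).2; move: HA; lra.
Qed.

End rsum.

Lemma esum_mul_pair (R : realType) (T1 T2 : choiceType) (x : T1 -> R) (y : T2 -> R) :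
  (forall i, 0 <= x i) -> (forall i, 0 <= y i) -> asum x -> asum y ->
  asum (fun p => x p.1 * y p.2) /\ rsum (fun p => x p.1 * y p.2) = rsum x * rsum y.
Proof.
move=> x0 y0 xs ys.
have E : (\esum_(p in [set: T1 * T2]) (x p.1 * y p.2)%:E = (rsum x * rsum y)%:E)%E.
  have <- : [set: T1] `*`` (fun=> [set: T2]) = [set: T1 * T2].
    by apply/seteqP; split.
  rewrite -(@esum_esum R T1 T2 setT (fun=> setT) (fun i j => (x i * y j)%:E)); last first.
    by move=> i j _ _; rewrite lee_fin mulr_ge0.
  have -> : (\esum_(i in [set: T1]) \esum_(j in [set: T2]) (x i * y j)%:E =
     \esum_(i in [set: T1]) (rsum y * x i)%:E)%E.
    apply: eq_esum => i _; rewrite -rsum_esum; last exact: asumZ.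
      by rewrite rsumZ // mulrC.
    by move=> j; exact: mulr_ge0.
  rewrite -rsum_esum; last exact: asumZ.
    by rewrite rsumZ // mulrC.
  by move=> i; rewrite mulr_ge0 // rsum_ge0.
have xy0 (p : T1 * T2) : 0 <= x p.1 * y p.2 by exact: mulr_ge0.
have s : asum (fun p : T1 * T2 => x p.1 * y p.2).
  apply/asumE; under eq_esum do rewrite ger0_norm //.
  by rewrite E ltry.
by split => //; apply/EFin_inj; rewrite rsum_esum.
Qed.

Lemma rsum_mul_pair (R : realType) (T1 T2 : choiceType) (x : T1 -> R) (y : T2 -> R) :
  asum x -> asum y ->
  asum (fun p => x p.1 * y p.2) /\ rsum (fun p => x p.1 * y p.2) = rsum x * rsum y.
Proof.
move=> xs ys.
have [s _] := esum_mul_pair (fun i => normr_ge0 (x i)) (fun i => normr_ge0 (y i))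
  (asum_norm xs) (asum_norm ys).
split; first by apply: asum_le s => p; rewrite normrM.
(* Nonnegative parts written through the absolute value, so that their summability follows from that
   of [f]; the product splits into four nonnegative ones. *)
pose P (T : choiceType) (f : T -> R) i := (`|f i| + f i) / 2.
pose N (T : choiceType) (f : T -> R) i := (`|f i| - f i) / 2.
have P0 (T : choiceType) (f : T -> R) i : 0 <= P T f i.
  by rewrite divr_ge0 // -lerBlDr sub0r -normrN ler_norm.
have N0 (T : choiceType) (f : T -> R) i : 0 <= N T f i.
  by rewrite divr_ge0 // subr_ge0 ler_norm.
have PN (T : choiceType) (f : T -> R) i : f i = P T f i - N T f i.
  by rewrite /P /N; field.
have Ps (T : choiceType) (f : T -> R) : asum f -> asum (P T f).
  move=> fs; rewrite /P; under eq_fun do rewrite mulrC.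
  by apply: asumZ; apply: asumD => //; exact: asum_norm.
have Ns (T : choiceType) (f : T -> R) : asum f -> asum (N T f).
  move=> fs; rewrite /N; under eq_fun do rewrite mulrC.
  by apply: asumZ; apply: asumB => //; exact: asum_norm.
have xE : rsum x = rsum (P _ x) - rsum (N _ x).
  by rewrite -rsumB; [apply: eq_rsum => i; exact: PN|exact: Ps|exact: Ns].
have yE : rsum y = rsum (P _ y) - rsum (N _ y).
  by rewrite -rsumB; [apply: eq_rsum => i; exact: PN|exact: Ps|exact: Ns].
have [s1 e1] := esum_mul_pair (P0 _ x) (P0 _ y) (Ps _ _ xs) (Ps _ _ ys).
have [s2 e2] := esum_mul_pair (P0 _ x) (N0 _ y) (Ps _ _ xs) (Ns _ _ ys).
have [s3 e3] := esum_mul_pair (N0 _ x) (P0 _ y) (Ns _ _ xs) (Ps _ _ ys).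
have [s4 e4] := esum_mul_pair (N0 _ x) (N0 _ y) (Ns _ _ xs) (Ns _ _ ys).
transitivity (rsum (fun p : T1 * T2 => (P _ x p.1 * P _ y p.2 - P _ x p.1 * N _ y p.2)
   - (N _ x p.1 * P _ y p.2 - N _ x p.1 * N _ y p.2))).
  by apply: eq_rsum => p; rewrite {1}(PN _ x p.1) {1}(PN _ y p.2); ring.
rewrite rsumB; [|exact: asumB|exact: asumB].
by rewrite !rsumB // e1 e2 e3 e4 xE yE; ring.
Qed.

Lemma reindex_rsum (R : realType) (T1 T2 : choiceType) (h : T1 -> T2) (f : T2 -> R) :
  bijective h -> asum f -> asum (f \o h) /\ rsum (f \o h) = rsum f.
Proof.
move=> hb fs.
have hsb : set_bij [set: T1] [set: T2] h by rewrite setTT_bijective.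
split; first by apply/asumE; rewrite -(reindex_esum _ _ _ (fun i => `|f i|%:E) hsb).
rewrite /rsum; congr (fine _ - fine _);
  rewrite [RHS](reindex_esum _ _ _ _ hsb); apply: eq_esum => i _.
  by rewrite !funeposE.
by rewrite !funenegE.
Qed.

(** * Theta inversion *)

Section int_series.
Context {R : realType}.

Lemma asum_int_geom (r : R) : 0 <= r -> r < 1 -> asum (fun m : int => r ^+ `|m|%N).
Proof.
move=> r0 r1; have q0 (j : nat) : 0 <= r ^+ j by exact: exprn_ge0.
have geom N : \sum_(0 <= j < N) r ^+ j <= (1 - r)^-1.
  have : (1 - r) * \sum_(0 <= j < N) r ^+ j = 1 - r ^+ N.
    by rewrite big_mkord; apply: oppr_inj; rewrite -mulNr !opprB -subrX1.
  move=> E; rewrite -[leRHS]div1r ler_pdivlMr ?subr_gt0 // mulrC E.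
  by rewrite gerBl.
have := @asum_bound R int (fun m : int => r ^+ `|m|%N) (2 * (1 - r)^-1).
case => // A.
have [N AN] : exists N, forall m, m \in A -> (`|m| < N)%N.
  exists (\max_(m <- A) `|m|%N).+1 => m mA; rewrite ltnS.
  by rewrite (big_rem m) //= leq_maxl.
(* [Negz j] is [- (j + 1)], so both halves are bounded by the same geometric sum. *)
pose s := [seq Posz j | j <- index_iota 0 N] ++ [seq Negz j | j <- index_iota 0 N].
have us : uniq s.
  rewrite cat_uniq !map_inj_uniq ?iota_uniq //=; try by move=> ? ? [].
  by rewrite andbT; apply/hasPn => ? /mapP[j _ ->]; apply/negP => /mapP[].
have As m : m \in A -> m \in s.
  move=> /AN; rewrite mem_cat; case: m => j jN; apply/orP; [left|right];
    apply/mapP; exists j => //; rewrite mem_index_iota //=.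
  exact: ltnW.
apply: (@le_trans _ _ (\sum_(m <- s) r ^+ `|m|%N)).
  rewrite [leRHS](bigID (mem A)) /= [leLHS](_ : _ = \sum_(m <- s | m \in A) r ^+ `|m|%N).
    by rewrite lerDl sumr_ge0.
  rewrite -[RHS]big_filter; apply: perm_big; apply: uniq_perm.
  - exact: fset_uniq.
  - exact: filter_uniq.
  move=> m; rewrite mem_filter; apply/idP/andP => [mA|[]//].
  by split => //; exact: As.
rewrite big_cat !big_map /= mulr_natl mulr2n lerD //.
apply: le_trans (geom N); apply: ler_sum => j _ /=.
by rewrite exprS ler_piMl // ltW.
Qed.

End int_series.

(** * Periodization of functions dominated by a Gaussian *)

Section periodization.
Context {R : realType}.
Implicit Types (F G : R -> R).

Definition gauss_dom F : Prop := continuous F /\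
  exists C c : R, [/\ 0 <= C, 0 < c & forall x, `|F x| <= C * expR (- (c * x ^+ 2))].

Definition periodize F (x : R) : R := rsum (fun m : int => F (x + m%:~R)).

(** [(x + m) ^ 2 >= m ^ 2 / 2 - x ^ 2] and [m ^ 2 >= |m|]: a Gaussian on the integers is dominated
    by a geometric family, locally uniformly in [x]. *)
Lemma gauss_int_le (c x B : R) (m : int) : 0 < c -> `|x| <= B ->
  expR (- (c * (x + m%:~R) ^+ 2)) <= expR (c * B ^+ 2) * expR (- (c / 2)) ^+ `|m|%N.
Proof.
move=> c0 xB; rewrite -expRM_natl -expRD ler_expR.
have x2 : x ^+ 2 <= B ^+ 2.
  by rewrite -real_normK ?num_real // lerXn2r ?nnegrE // (le_trans _ xB).
have m2 : `|m|%N%:R <= m%:~R ^+ 2 :> R.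
  rewrite -[leRHS]real_normK ?num_real // -intr_norm -natr_absz -natrX ler_nat.
  by case: `|m|%N => // j; rewrite -[X in (X <= _)%N]expn1 leq_pexp2l.
have h : 0 <= (m%:~R + 2 * x) ^+ 2 by exact: sqr_ge0.
move: h m2 x2; move: (m%:~R : R) (`|m|%N%:R : R) (B ^+ 2) => y z b h m2 x2.
rewrite -subr_ge0.
have -> : c * b + z * - (c / 2) - - (c * (x + y) ^+ 2) =
    c * ((y + 2 * x) ^+ 2 / 2 + (y ^+ 2 - z) / 2 + (b - x ^+ 2)) by field.
by apply: mulr_ge0; [exact: ltW|move: h; set h' := (_ ^+ 2); lra].
Qed.

Lemma expRN_lt1 (c : R) : 0 < c -> expR (- c) < 1.
Proof. by move=> c0; rewrite expR_lt1 oppr_lt0. Qed.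

Lemma asum_gauss_geom (c B : R) : 0 < c ->
  asum (fun m : int => expR (c * B ^+ 2) * expR (- (c / 2)) ^+ `|m|%N).
Proof.
move=> c0; apply: asumZ; apply: asum_int_geom; first exact: expR_ge0.
by apply: expRN_lt1; rewrite divr_gt0.
Qed.

Lemma asum_periodize F x : gauss_dom F -> asum (fun m : int => F (x + m%:~R)).
Proof.
move=> [_ [C [c [C0 c0 FC]]]].
apply: asum_le (asumZ C (asum_gauss_geom `|x| c0)) => m.
by apply: le_trans (FC _) _; rewrite ler_wpM2l // gauss_int_le.
Qed.

Lemma periodizeD1 F x : gauss_dom F -> periodize F (x + 1) = periodize F x.
Proof.
move=> Fd.
have hb : bijective (fun m : int => 1 + m) by exists (fun m => -1 + m) => m; lia.
rewrite /periodize; have [_ <-] := reindex_rsum hb (asum_periodize x Fd).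
by apply: eq_rsum => m /=; rewrite rmorphD /= addrA.
Qed.

Lemma periodizeD F G x : gauss_dom F -> gauss_dom G ->
  periodize (fun y => F y + G y) x = periodize F x + periodize G x.
Proof. by move=> Fd Gd; rewrite /periodize rsumD //; exact: asum_periodize. Qed.

Lemma periodizeZ F a x : gauss_dom F ->
  periodize (fun y => a * F y) x = a * periodize F x.
Proof. by move=> Fd; rewrite /periodize rsumZ //; exact: asum_periodize. Qed.

Lemma periodize_floor F x : gauss_dom F ->
  periodize F x = periodize F (x - (Num.floor x)%:~R).
Proof.
move=> Fd.
have hb : bijective (fun m : int => - Num.floor x + m).
  by exists (fun m => Num.floor x + m) => m; lia.
rewrite /periodize; have [_ <-] := reindex_rsum hb (asum_periodize x Fd).
by apply: eq_rsum => m /=; rewrite rmorphD rmorphN /= addrA.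
Qed.

(** The constant depends on the rate [c] alone, which lets a small pointwise factor [C] pass to the
    periodization and then to its mean. *)
Lemma periodize_bound (c : R) : 0 < c -> exists2 K : R, 0 <= K &
  forall F C, gauss_dom F -> 0 <= C ->
    (forall x, `|F x| <= C * expR (- (c * x ^+ 2))) ->
    forall x, `|periodize F x| <= C * K.
Proof.
move=> c0; have gs := asum_gauss_geom 1 c0.
exists (rsum (fun m : int => expR (c * 1 ^+ 2) * expR (- (c / 2)) ^+ `|m|%N)).
  by apply: rsum_ge0 => m; rewrite mulr_ge0 ?exprn_ge0 ?expR_ge0.
move=> F C Fd C0 FC x; rewrite periodize_floor //.
set y := x - _; have y1 : `|y| <= 1.
  have := floor_le_tmp x; have := floorD1_gt x.
  by rewrite intrD /y ler_norml; lra.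
rewrite -rsumZ //; apply: le_trans (rsum_norm (asum_periodize y Fd)) _.
apply: rsum_le; [exact/asum_norm/asum_periodize|exact: asumZ|] => m.
by apply: le_trans (FC _) _; rewrite ler_wpM2l // gauss_int_le.
Qed.

Lemma rsum_continuous (T : choiceType) (f : R -> T -> R) (g : T -> R) (x : R) :
  (forall t, {for x, continuous (f^~ t)}) -> asum g ->
  (\forall y \near x, forall t, `|f y t| <= g t) ->
  {for x, continuous (fun y => rsum (f y))}.
Proof.
move=> fc gs dom; apply/cvgrPdist_le => /= eps eps0.
have e3 : 0 < eps / 3 by rewrite divr_gt0.
have [A HA] := rsum_tail gs e3.
have domx : forall t, `|f x t| <= g t by exact: nbhs_singleton dom.
have ng y t : `|f y t| <= g t -> `|f y t| <= `|g t|.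
  by move=> h; apply: le_trans h _; exact: ler_norm.
have cA : \sum_(t <- A) f y t @[y --> x] --> \sum_(t <- A) f x t.
  elim: (enum_fset A) => [|t s IH].
    by rewrite big_nil; under eq_fun do rewrite big_nil; exact: cvg_cst.
  rewrite big_cons; under eq_fun do rewrite big_cons.
  by apply: cvgD; [exact: fc|exact: IH].
move/cvgrPdist_le/(_ _ e3) : cA => cA.
near=> y.
have h1 : `|rsum (f x) - \sum_(t <- A) f x t| <= eps / 3.
  by apply: HA => t; exact: ng.
have h2 : `|rsum (f y) - \sum_(t <- A) f y t| <= eps / 3.
  by apply: HA => t; apply: ng; move: t; near: y.
have h3 : `|\sum_(t <- A) f x t - \sum_(t <- A) f y t| <= eps / 3 by near: y.
move: h1 h2 h3; move: (rsum _) (rsum _) (\sum_(t <- A) _) (\sum_(t <- A) _) => a b c d.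
by rewrite !ler_norml; lra.
Unshelve. all: by end_near. Qed.

Lemma periodize_continuous F : gauss_dom F -> continuous (periodize F).
Proof.
move=> Fd x; have [Fc [C [c [C0 c0 FC]]]] := Fd.
apply: (@rsum_continuous _ (fun y (m : int) => F (y + m%:~R)) _ x _
  (asumZ C (asum_gauss_geom (`|x| + 1) c0))).
  move=> m; apply: (@continuous_comp _ _ _ (fun y : R => y + m%:~R) F x); last exact: Fc.
  by apply: continuousD => //; exact: cst_continuous.
near=> y => m; apply: le_trans (FC _) _; rewrite ler_wpM2l // gauss_int_le //.
have : `|x - y| < 1 by near: y; apply: cvgr_dist_lt.
by have := ler_normB x (x - y); rewrite opprB addrC subrK; lra.
Unshelve. all: by end_near. Qed.

Lemma gauss_domD F G : gauss_dom F -> gauss_dom G -> gauss_dom (fun x => F x + G x).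
Proof.
move=> [Fc [C [c [C0 c0 FC]]]] [Gc [D [d [D0 d0 GD]]]]; split.
  by move=> x; apply: continuousD; [exact: Fc|exact: Gc].
exists (C + D), (Num.min c d); split; rewrite ?addr_ge0 // ?lt_min ?c0 // => x.
have h (k : R) : Num.min c d <= k -> expR (- (k * x ^+ 2)) <= expR (- (Num.min c d * x ^+ 2)).
  by move=> h; rewrite ler_expR lerN2 ler_wpM2r // sqr_ge0.
rewrite mulrDl; apply: le_trans (ler_normD _ _) _; apply: lerD.
  by apply: le_trans (FC x) _; rewrite ler_wpM2l // h // ge_min lexx.
by apply: le_trans (GD x) _; rewrite ler_wpM2l // h // ge_min lexx orbT.
Qed.

Lemma gauss_domM F (p : R -> R) : gauss_dom F -> continuous p -> (exists K, forall x, `|p x| <= K) ->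
  gauss_dom (fun x => p x * F x).
Proof.
move=> [Fc [C [c [C0 c0 FC]]]] pc [K pK]; split.
  by move=> x; apply: continuousM; [exact: pc|exact: Fc].
have K0 : 0 <= K by apply: le_trans (pK 0).
exists (K * C), c; split; rewrite ?mulr_ge0 // => x.
by rewrite normrM -mulrA ler_pM.
Qed.

Lemma gauss_domZ F a : gauss_dom F -> gauss_dom (fun x => a * F x).
Proof.
move=> Fd; apply: (@gauss_domM F (cst a)) => //; first exact: cst_continuous.
by exists `|a|.
Qed.

Lemma gauss_dom_shift F h : gauss_dom F -> gauss_dom (fun x => F (x + h)).
Proof.
move=> [Fc [C [c [C0 c0 FC]]]]; split.
  move=> x; apply: (@continuous_comp _ _ _ (fun y : R => y + h) F x); last exact: Fc.
  by apply: continuousD => //; exact: cst_continuous.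
exists (C * expR (c * h ^+ 2)), (c / 2); split; rewrite ?mulr_ge0 ?expR_ge0 ?divr_gt0 // => x.
apply: le_trans (FC _) _; rewrite -mulrA ler_wpM2l // -expRD ler_expR.
have : 0 <= c * (x + 2 * h) ^+ 2 by rewrite mulr_ge0 ?sqr_ge0 ?ltW.
by lra.
Qed.

End periodization.

(** * Remainder estimates *)

Section estimates.
Context {R : realType}.

Lemma MVT_R (f df : R -> R) (a b : R) :
  (forall t, `|t - a| <= `|b - a| -> is_derive t 1 f (df t)) ->
  exists2 t, `|t - a| <= `|b - a| & f b - f a = df t * (b - a).
Proof.
move=> fd.
have fc t : `|t - a| <= `|b - a| -> {for t, continuous f}.
  by move=> /fd fdt; apply/differentiable_continuous/derivable1_diffP; case: fdt.
have [ab|ba|<-] := ltgtP a b; last by exists a; rewrite !subrr ?normr0 ?mulr0.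
- have dom t : t \in `[a, b] -> `|t - a| <= `|b - a|.
    by rewrite in_itv /= => /andP[h1 h2]; rewrite ger0_norm ?subr_ge0 // ger0_norm ?subr_ge0 ?(ltW ab) // lerD2r.
  have [||t tI E] := @MVT _ f df a b ab.
  + by move=> t tI; apply/fd/dom; exact: subset_itv_oo_cc tI.
  + by apply: continuous_in_subspaceT => t; rewrite inE => /dom /fc.
  by exists t => //; apply: dom; exact: subset_itv_oo_cc tI.
- have dom t : t \in `[b, a] -> `|t - a| <= `|b - a|.
    rewrite in_itv /= => /andP[h1 h2].
    by rewrite ler0_norm ?subr_le0 // ler0_norm ?subr_le0 ?(ltW ba) // lerN2 lerD2r.
  have [||t tI E] := @MVT _ f df b a ba.
  + by move=> t tI; apply/fd/dom; exact: subset_itv_oo_cc tI.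
  + by apply: continuous_in_subspaceT => t; rewrite inE => /dom /fc.
  exists t; first by apply: dom; exact: subset_itv_oo_cc tI.
  by rewrite -opprB E -mulrN opprB.
Qed.

Lemma abs_sin_le (t : R) : `|sin t| <= `|t|.
Proof.
have [x _] := @MVT_R sin cos 0 t (fun x _ => is_derive_sin x).
by rewrite sin0 !subr0 => ->; rewrite normrM ler_piMl // cos_max.
Qed.

Lemma abs_cosB1_le (t : R) : `|cos t - 1| <= t ^+ 2.
Proof.
have [x xt] := @MVT_R cos (fun x => - sin x) 0 t (fun x _ => is_derive_cos x).
rewrite !subr0 cos0 => ->; rewrite normrM normrN -[leRHS]real_normK ?num_real // expr2.
rewrite ler_wpM2r //; apply: le_trans (abs_sin_le x) _.
by move: xt; rewrite !subr0.
Qed.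

Lemma abs_sinB_le (t : R) : `|sin t - t| <= t ^+ 2.
Proof.
have [x xt] := @MVT_R (fun x => sin x - x) (fun x => cos x - 1) 0 t
  (fun x _ => is_deriveB (is_derive_sin x) (is_derive_id x 1)).
rewrite sin0 !subr0 => ->.
have [y yx] := @MVT_R cos (fun x => - sin x) 0 x (fun x _ => is_derive_cos x).
rewrite subr0 cos0 => ->; rewrite normrM -[leRHS]real_normK ?num_real // expr2.
rewrite ler_wpM2r // normrM normrN; move: xt; rewrite !subr0 => xt.
apply: le_trans _ xt; rewrite ler_piMl //.
by rewrite sin_max.
Qed.

Lemma cos_taylor (s t : R) : `|cos (s + t) - cos s + t * sin s| <= 2 * t ^+ 2.
Proof.
have -> : cos (s + t) - cos s + t * sin s = cos s * (cos t - 1) - sin s * (sin t - t).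
  by rewrite cosD; ring.
apply: le_trans (ler_normB _ _) _; rewrite mulr_natl mulr2n !normrM; apply: lerD.
  by apply: le_trans (abs_cosB1_le t); rewrite ler_piMl // cos_max.
by apply: le_trans (abs_sinB_le t); rewrite ler_piMl // sin_max.
Qed.

Lemma sin_taylor (s t : R) : `|sin (s + t) - sin s - t * cos s| <= 2 * t ^+ 2.
Proof.
have := cos_taylor (s - pi / 2) t.
rewrite (addrAC s) !cosBpihalf sinBpihalf.
by rewrite mulrN.
Qed.

Lemma abs_expRB1_le (u : R) : `|expR u - 1| <= `|u| * expR `|u|.
Proof.
have h1 : 1 + u <= expR u by exact: expR_ge1Dx.
have h2 : 1 + `|u| <= expR `|u| by exact: expR_ge1Dx.
have h3 : expR u - 1 <= u * expR u.
  have := expR_ge1Dx (- u); rewrite expRN -div1r ler_pdivlMr ?expR_gt0 //.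
  by lra.
have u0 : `|u| * 1 <= `|u| * expR `|u|.
  by rewrite ler_wpM2l // (le_trans _ h2) // lerDl.
have [u1|u1] := ler0P u.
  rewrite ler0_norm; last by rewrite subr_le0 expR_le1.
  by move: u0; rewrite ler0_norm //; lra.
by rewrite ger0_norm // subr_ge0 ltW // expR_gt1.
Qed.

Lemma expR_taylor (u : R) : `|expR u - 1 - u| <= u ^+ 2 * expR `|u|.
Proof.
have h1 : 1 + u <= expR u by exact: expR_ge1Dx.
have h3 : expR u - 1 <= u * expR u.
  have := expR_ge1Dx (- u); rewrite expRN -div1r ler_pdivlMr ?expR_gt0 //.
  by lra.
rewrite ger0_norm; last by rewrite subr_ge0; lra.
apply: (@le_trans _ _ (u * (expR u - 1))); first by lra.
apply: le_trans (ler_norm _) _; rewrite normrM.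
rewrite -[u ^+ 2]real_normK ?num_real // expr2 -mulrA ler_wpM2l //.
exact: abs_expRB1_le.
Qed.

Lemma le_expR (u : R) : u <= expR u.
Proof. by apply: le_trans (expR_ge1Dx u); rewrite lerDr. Qed.

(** Completing the square: half of the Gaussian absorbs any exponential growth. *)
Lemma expR_gauss_le (a k x : R) : 0 < a ->
  expR (k * `|x|) * expR (- (a * x ^+ 2)) <= expR (k ^+ 2 / (2 * a)) * expR (- (a / 2 * x ^+ 2)).
Proof.
move=> a0; rewrite -!expRD ler_expR -subr_ge0.
have -> : k ^+ 2 / (2 * a) - a / 2 * x ^+ 2 - (k * `|x| - a * x ^+ 2) =
    (a * `|x| - k) ^+ 2 / (2 * a).
  rewrite -[x ^+ 2]real_normK ?num_real //; field.
  by rewrite gt_eqF.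
by rewrite divr_ge0 ?sqr_ge0 // mulr_ge0 // ltW.
Qed.

(** This is the form in which derivatives are taken under [line_mean], through which only uniform
    bounds pass. *)
Lemma is_derive_quad (f : R -> R) (d x K e : R) : 0 < e ->
  (forall h, `|h| <= e -> `|f (x + h) - f x - h * d| <= K * h ^+ 2) ->
  is_derive x 1 f d.
Proof.
move=> e0 H.
have : h^-1 *: ((f \o shift x) (h *: 1) - f x) @[h --> 0^'] --> d.
  apply/cvgrPdist_le => /= eps eps0.
  pose K1 := `|K| + 1; have K0 : 0 < K1 by rewrite ltr_wpDl.
  near=> h.
  have hn0 : h != 0 by near: h; exact: nbhs_dnbhs_neq.
  have he : `|h| <= e.
    by near: h; apply/dnbhs0_le.
  have hK : `|h| <= eps / K1.
    by near: h; apply/dnbhs0_le; rewrite divr_gt0.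
  rewrite [h *: 1]mulr1 /= [h + x]addrC.
  have -> : d - h^-1 *: (f (x + h) - f x) = - h^-1 * (f (x + h) - f x - h * d).
    by rewrite mulrBr !mulNr mulKf // opprK [RHS]addrC.
  rewrite normrM normrN normfV mulrC ler_pdivrMr ?normr_gt0 //.
  apply: le_trans (H h he) _; rewrite -[h ^+ 2]real_normK ?num_real // expr2 mulrA.
  rewrite ler_wpM2r //; apply: le_trans (ler_norm _) _; rewrite normrM normr_id.
  apply: (@le_trans _ _ (K1 * `|h|)); first by rewrite ler_wpM2r // lerDl.
  by rewrite mulrC -ler_pdivlMr.
move=> c; split; first by apply/cvg_ex; exists d.
exact: cvg_lim c.
Unshelve. all: by end_near. Qed.

End estimates.

(** The torus of dimension one, so that the mean and Fourier uniqueness on ['cV[R]_n] apply to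
    functions of a real variable. *)
Definition circle (R : realType) : 'I_1 -> 'cV[R]_1 := fun=> const_mx 1.

(* Unfolding the circle: the mean of a periodization behaves like an integral
   over the real line. *)
Definition line_mean (R : realType) (F : R -> R) : R :=
  mean (@circle R) (fun v => periodize F (v 0 0)).

Section line_mean.
Context {R : realType}.
Implicit Types F G : R -> R.

Lemma dot_circle (u v : 'cV[R]_1) : dot u v = u 0 0 * v 0 0.
Proof. by rewrite dotE big_ord_recl big_ord0 addr0. Qed.

Lemma circle_orth i j : dot (@circle R i) (@circle R j) = (i == j)%:R.
Proof. by rewrite dot_circle !mxE mulr1 !ord1 eqxx. Qed.

Lemma xi_circle k : xi (@circle R) k 0 0 = (k 0)%:~R.
Proof. by rewrite /xi summxE big_ord_recl big_ord0 addr0 !mxE mulr1. Qed.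

Lemma cper_circle (f : R -> R) : continuous f -> (forall x, f (x + 1) = f x) ->
  cper (@circle R) (fun v => f (v 0 0)).
Proof.
move=> fc fp; split => [v|i v]; last by rewrite !mxE fp.
apply: (@continuous_comp _ _ _ (fun v : 'cV[R]_1 => v 0 0) f v); last exact: fc.
exact: coord_continuous.
Qed.

Lemma cper_periodize F : gauss_dom F -> cper (@circle R) (fun v => periodize F (v 0 0)).
Proof.
move=> Fd; apply: cper_circle => [|x]; first exact: periodize_continuous.
exact: periodizeD1.
Qed.

Lemma line_meanD F G : gauss_dom F -> gauss_dom G ->
  line_mean (fun x => F x + G x) = line_mean F + line_mean G.
Proof.
move=> Fd Gd; rewrite /line_mean -(meanD circle_orth) //; try exact: cper_periodize.
by congr mean; apply/funext => v; exact: periodizeD.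
Qed.

Lemma line_meanZ F a : gauss_dom F -> line_mean (fun x => a * F x) = a * line_mean F.
Proof.
move=> Fd; rewrite /line_mean -(meanZ circle_orth) //; last exact: cper_periodize.
by congr mean; apply/funext => v; exact: periodizeZ.
Qed.

Lemma line_meanN F : gauss_dom F -> line_mean (fun x => - F x) = - line_mean F.
Proof. by move=> Fd; under eq_fun do rewrite -mulN1r; rewrite line_meanZ ?mulN1r. Qed.

Lemma gauss_domN F : gauss_dom F -> gauss_dom (fun x => - F x).
Proof. by move=> Fd; under eq_fun do rewrite -mulN1r; exact: gauss_domZ. Qed.

Lemma gauss_domB F G : gauss_dom F -> gauss_dom G -> gauss_dom (fun x => F x - G x).
Proof. by move=> Fd Gd; apply: gauss_domD => //; exact: gauss_domN. Qed.

Lemma line_meanB F G : gauss_dom F -> gauss_dom G ->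
  line_mean (fun x => F x - G x) = line_mean F - line_mean G.
Proof. by move=> Fd Gd; rewrite line_meanD ?line_meanN //; exact: gauss_domN. Qed.

Lemma line_mean_shift F h : gauss_dom F -> line_mean (fun x => F (x + h)) = line_mean F.
Proof.
move=> Fd; rewrite /line_mean -[RHS](mean_shift circle_orth (const_mx h)); last exact: cper_periodize.
congr mean; apply/funext => v; rewrite !mxE; apply: eq_rsum => m.
by rewrite addrAC.
Qed.

Lemma line_mean_quad (E : R -> R -> R) (C c e : R) : 0 <= C -> 0 < c ->
  (forall h, `|h| <= e -> gauss_dom (E h)) ->
  (forall h x, `|h| <= e -> `|E h x| <= C * h ^+ 2 * expR (- (c * x ^+ 2))) ->
  exists K, forall h, `|h| <= e -> `|line_mean (E h)| <= K * h ^+ 2.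
Proof.
move=> C0 c0 Ed EC; have [K K0 HK] := periodize_bound c0.
exists (C * K) => h he; apply: mean_bound => v.
rewrite mulrAC; apply: HK; [exact: Ed|by rewrite mulr_ge0 // sqr_ge0|].
by move=> x; exact: EC.
Qed.

End line_mean.

(** * Fourier transform of the Gaussian *)

Section gauss_transform.
Context {R : realType}.

Definition gauss (a x : R) : R := expR (- (a * x ^+ 2)).

Lemma continuous_gauss a : continuous (gauss a).
Proof.
move=> x; apply: (@continuous_comp _ _ _ (fun x : R => - (a * x ^+ 2)) expR x).
  apply: continuousN; apply: continuousM; first exact: cst_continuous.
  exact: exprn_continuous.
exact: continuous_expR.
Qed.

Lemma gauss_ge0 a x : 0 <= gauss a x. Proof. exact: expR_ge0. Qed.

Lemma gauss_dom_exp (a K k : R) (p : R -> R) : 0 < a -> 0 <= K -> continuous p ->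
  (forall x, `|p x| <= K * expR (k * `|x|)) -> gauss_dom (fun x => p x * gauss a x).
Proof.
move=> a0 K0 pc pK; split.
  by move=> x; apply: continuousM; [exact: pc|exact: continuous_gauss].
exists (K * expR (k ^+ 2 / (2 * a))), (a / 2); split.
- by rewrite mulr_ge0 ?expR_ge0.
- by rewrite divr_gt0.
move=> x; rewrite normrM (ger0_norm (gauss_ge0 _ _)).
apply: (@le_trans _ _ (K * expR (k * `|x|) * gauss a x)).
  by rewrite ler_wpM2r // gauss_ge0.
by rewrite -2!(mulrA K) ler_wpM2l //; exact: expR_gauss_le.
Qed.

Lemma gauss_dom_gauss a : 0 < a -> gauss_dom (gauss a).
Proof.
move=> a0; rewrite (_ : gauss a = fun x => cst 1 x * gauss a x); last first.
  by apply/funext => x; rewrite mul1r.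
apply: (@gauss_dom_exp a 1 0 (cst 1)) => //; first exact: cst_continuous.
by move=> x /=; rewrite mul0r expR0 normr1 mul1r.
Qed.

Lemma absD1_le_exp (x : R) : 1 + `|x| <= expR `|x|.
Proof. exact: expR_ge1Dx. Qed.

(** The integrand is the derivative of [p * gauss a], with [q] the derivative of [p]. By shift
    invariance the remainder [E h] has mean [- (h * line_mean W)], and a bound quadratic in [h]
    forces [line_mean W] to vanish. *)
Lemma line_mean_gauss_deriv (a K : R) (p q : R -> R) : 0 < a -> 0 <= K ->
  continuous p -> continuous q ->
  (forall x, `|p x| <= K * expR `|x|) -> (forall x, `|q x| <= K) ->
  (forall x h, `|p (x + h) - p x - h * q x| <= K * h ^+ 2) ->
  line_mean (fun x => (q x - 2 * a * x * p x) * gauss a x) = 0.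
Proof.
move=> a0 K0 pc qc pK qK pq.
pose w x := p x * gauss a x.
pose W x := (q x - 2 * a * x * p x) * gauss a x.
have wd : gauss_dom w.
  by apply: (@gauss_dom_exp a K 1) => // x; rewrite mul1r.
have Wd : gauss_dom W.
  apply: (@gauss_dom_exp a (K + 2 * a * K) 2) => //.
  - by rewrite addr_ge0 // mulr_ge0 // mulr_ge0 // ltW.
  - move=> x; apply: (@continuousD _ _ _ q (fun y : R => - (2 * a * y * p y)) x); first exact: qc.
    apply: continuousN; apply: continuousM; last exact: pc.
    by apply: continuousM => //; exact: cst_continuous.
  move=> x; rewrite [leRHS]mulrDl; apply: le_trans (ler_normB _ _) _; apply: lerD.
    apply: le_trans (qK x) _; rewrite ler_peMr //.
    by rewrite -expR0 ler_expR mulr_ge0.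
  have a2 : 0 <= 2 * a by rewrite mulr_ge0 // ltW.
  rewrite -(mulrA (2 * a)) normrM (ger0_norm a2) normrM -(mulrA (2 * a)).
  rewrite ler_wpM2l // mulr_natl mulr2n expRD mulrCA.
  by rewrite ler_pM // le_expR.
pose E (h x : R) := w (x + h) - w x - h * W x.
have Ed h : gauss_dom (E h).
  apply: gauss_domB; last exact: gauss_domZ.
  by apply: gauss_domB => //; exact: gauss_dom_shift.
have Emean h : line_mean (E h) = - (h * line_mean W).
  rewrite line_meanB; [|by apply: gauss_domB => //; exact: gauss_dom_shift|exact: gauss_domZ].
  rewrite line_meanB //; last exact: gauss_dom_shift.
  by rewrite line_mean_shift // subrr sub0r line_meanZ.
(* The last factor adds up the weights [1], [2 * a], [a] and [4 * a ^+ 2] of the bounds [b1] to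
   [b4]. *)
pose D := K * expR a * (1 + 3 * a + 4 * a ^+ 2).
have D0 : 0 <= D.
  have p1 : 0 <= 1 + 3 * a + 4 * a ^+ 2 by have := sqr_ge0 a; lra.
  by rewrite /D !mulr_ge0 ?expR_ge0.
have EB h x : `|h| <= 1 -> `|E h x| <= D * h ^+ 2 * (expR ((3 + 2 * a) * `|x|) * gauss a x).
  move=> h1.
  pose u := - (2 * a * h * x + a * h ^+ 2).
  pose eta := p (x + h) - p x - h * q x.
  pose rho := expR u - 1 - u.
  have gE : gauss a (x + h) = gauss a x * expR u.
    by rewrite /gauss -expRD; congr expR; rewrite /u; ring.
  (* Four terms of second order in [h]: [eta] is the remainder of [p], [rho] that of the
     exponential, and [- a * h ^+ 2] is the nonlinear part of [u]. *)
  have -> : E h x = gauss a x * (eta * expR u + (expR u - 1) * (h * q x)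
      - a * h ^+ 2 * p x + rho * p x).
    by rewrite /E /w /W gE /rho /eta /u; ring.
  rewrite normrM (ger0_norm (gauss_ge0 _ _)) [leRHS]mulrA [leRHS]mulrC.
  rewrite ler_wpM2l ?gauss_ge0 //.
  have L1 := absD1_le_exp x.
  set L := `|x| in L1 *; have L0 : 0 <= L by exact: normr_ge0.
  have eL1 : 1 <= expR L by rewrite -expR0 ler_expR.
  have hh : `|h| ^+ 2 = h ^+ 2 by rewrite real_normK ?num_real.
  have a0' := ltW a0; have H0 : 0 <= `|h| by exact: normr_ge0.
  have un : `|u| <= 2 * a * `|h| * L + a * `|h| ^+ 2.
    rewrite /u normrN; apply: le_trans (ler_normD _ _) _.
    by rewrite !normrM (gtr0_norm a0) (ger0_norm (ler0n R 2)).
  have ub : `|u| <= `|h| * (2 * a * expR L).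
    apply: le_trans un _; rewrite -subr_ge0.
    rewrite (_ : _ - _ = a * `|h| * (2 * expR L - 2 * L - `|h|)); last by ring.
    by apply: mulr_ge0; [exact: mulr_ge0|lra].
  have ub1 : expR `|u| <= expR a * expR (2 * a * L).
    rewrite -expRD ler_expR; apply: le_trans un _; rewrite -subr_ge0.
    rewrite (_ : _ - _ = a * ((1 - `|h|) * (1 + `|h|) + 2 * (1 - `|h|) * L)); last by ring.
    have h1' : 0 <= 1 - `|h| by rewrite subr_ge0.
    by rewrite mulr_ge0 // addr_ge0 // ?mulr_ge0 // addr_ge0.
  have eu : expR u <= expR a * expR (2 * a * L).
    by apply: le_trans ub1; rewrite ler_expR ler_norm.
  set X := expR a * expR (2 * a * L) in ub1 eu *.
  have X0 : 0 <= X by rewrite mulr_ge0 ?expR_ge0.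
  have X1 : 1 <= X.
    by rewrite /X -expRD -[leLHS]expR0 ler_expR addr_ge0 // !mulr_ge0.
  set Y := expR L in L1 eL1 ub *.
  have Y0 : 0 <= Y by apply: expR_ge0.
  have YY (j : nat) : (j <= 3)%N -> Y ^+ j <= Y ^+ 3 by move=> j3; rewrite ler_weXn2l.
  have -> : D * h ^+ 2 * expR ((3 + 2 * a) * L) =
      K * h ^+ 2 * X * (Y ^+ 3) * (1 + 3 * a + 4 * a ^+ 2).
    rewrite (_ : expR ((3 + 2 * a) * L) = Y ^+ 3 * expR (2 * a * L)).
      by rewrite /D /X; ring.
    by rewrite mulrDl expRD /Y -expRM_natl.
  have a2 : 0 <= 2 * a by rewrite mulr_ge0.
  have Kh : 0 <= K * h ^+ 2 by exact: (mulr_ge0 K0 (sqr_ge0 h)).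
  have Q0 : 0 <= K * h ^+ 2 * X by exact: mulr_ge0.
  have YY3 : Y <= Y ^+ 3 by have := YY 1%N isT; rewrite expr1.
  have b1 : `|eta * expR u| <= K * h ^+ 2 * X * Y ^+ 3.
    rewrite normrM (ger0_norm (expR_ge0 _)).
    apply: (@le_trans _ _ (K * h ^+ 2 * X)); first by rewrite ler_pM ?expR_ge0 // pq.
    by apply: ler_peMr => //; exact: exprn_ege1.
  have b2 : `|(expR u - 1) * (h * q x)| <= 2 * a * (K * h ^+ 2 * X * Y ^+ 3).
    rewrite !normrM.
    apply: (@le_trans _ _ ((`|h| * (2 * a * Y) * X) * (`|h| * K))).
      rewrite ler_pM ?mulr_ge0 //; last by rewrite ler_wpM2l.
      by apply: le_trans (abs_expRB1_le u) _; rewrite ler_pM ?expR_ge0.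
    rewrite [leLHS](_ : _ = 2 * a * (K * `|h| ^+ 2 * X * Y)); last by ring.
    by rewrite hh ler_wpM2l // ler_wpM2l.
  have b3 : `|a * h ^+ 2 * p x| <= a * (K * h ^+ 2 * X * Y ^+ 3).
    rewrite -mulrA normrM (gtr0_norm a0) ler_wpM2l // normrM (ger0_norm (sqr_ge0 h)).
    apply: (@le_trans _ _ (h ^+ 2 * (K * Y))); first by rewrite ler_wpM2l ?sqr_ge0.
    rewrite [leLHS](_ : _ = K * h ^+ 2 * Y); last by ring.
    by rewrite -[leRHS]mulrA ler_wpM2l // -[leLHS]mul1r ler_pM.
  have b4 : `|rho * p x| <= 4 * a ^+ 2 * (K * h ^+ 2 * X * Y ^+ 3).
    rewrite normrM.
    apply: (@le_trans _ _ (((`|h| * (2 * a * Y)) ^+ 2 * X) * (K * Y))).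
      rewrite ler_pM //; apply: le_trans (expR_taylor u) _.
      rewrite ler_pM ?sqr_ge0 ?expR_ge0 // -[leLHS]real_normK ?num_real //.
      by rewrite lerXn2r ?nnegrE ?mulr_ge0 ?(ltW a0).
    by rewrite le_eqVlt; apply/orP; left; apply/eqP; rewrite -hh; ring.
  apply: le_trans (ler_normD _ _) _.
  apply: le_trans (lerD (ler_normB _ _) b4) _.
  apply: le_trans (lerD (lerD (le_trans (ler_normD _ _) (lerD b1 b2)) b3) (lexx _)) _.
  by rewrite le_eqVlt; apply/orP; left; apply/eqP; ring.
have [K' HK'] : exists K', forall h, `|h| <= 1 -> `|line_mean (E h)| <= K' * h ^+ 2.
  apply: (@line_mean_quad _ E (D * expR ((3 + 2 * a) ^+ 2 / (2 * a))) (a / 2) 1).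
  - by rewrite mulr_ge0 ?expR_ge0.
  - by rewrite divr_gt0.
  - by move=> h _; exact: Ed.
  move=> h x h1; apply: le_trans (EB h x h1) _.
  rewrite (_ : _ * expR (- (a / 2 * x ^+ 2)) = D * h ^+ 2 *
    (expR ((3 + 2 * a) ^+ 2 / (2 * a)) * expR (- (a / 2 * x ^+ 2)))); last by ring.
  by rewrite ler_wpM2l ?(mulr_ge0 D0 (sqr_ge0 h)) //; exact: expR_gauss_le.
(* The quadratic bound makes [line_mean W] a derivative of the zero function. *)
have id : is_derive (0 : R) 1 (fun=> 0 : R) (line_mean W).
  apply: (@is_derive_quad _ _ _ _ K' 1) => // h h1.
  by rewrite subrr sub0r -Emean HK'.
by have /@derive_val := id; rewrite derive_cst.
Qed.

End gauss_transform.

Section theta_inversion.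
Context {R : realType}.

Lemma continuous_cmul (c : R) (f : R -> R) :
  continuous f -> continuous (fun x => c * f x).
Proof.
by move=> cf x; apply: (@continuousM _ _ (cst c) f x);
  [exact: cst_continuous|exact: cf].
Qed.

(** With [f t] the left side at frequency [t], [f' = - g], and [line_mean_gauss_deriv] gives
    [t * f t = 2 * a * g t]. Hence [f' = - t / (2 * a) * f], solved by the integrating factor in
    [H]. The phase [s] treats cosine and sine together. *)
Lemma line_mean_gauss_cos (a s tau : R) : 0 < a ->
  line_mean (fun x => cos (tau * x + s) * gauss a x) =
  expR (- (tau ^+ 2 / (4 * a))) * (cos s * line_mean (gauss a)).
Proof.
move=> a0.
have cont_lin (t u : R) : continuous (fun x : R => t * x + u).
  move=> x; apply: (@continuousD _ _ _ (fun x : R => t * x) (cst u) x).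
    by apply: continuousM => //; exact: cst_continuous.
  exact: cst_continuous.
have ccos t u : continuous (fun x : R => cos (t * x + u)).
  move=> x; apply: (@continuous_comp _ _ _ (fun x : R => t * x + u) cos x).
    exact: cont_lin.
  exact: continuous_cos.
have csin t u : continuous (fun x : R => sin (t * x + u)).
  move=> x; apply: (@continuous_comp _ _ _ (fun x : R => t * x + u) sin x).
    exact: cont_lin.
  exact: continuous_sin.
have exp1 (x : R) : 1 <= expR `|x| by rewrite -[leLHS]expR0 ler_expR.
have dcos t : gauss_dom (fun x => cos (t * x + s) * gauss a x).
  apply: gauss_domM; [exact: gauss_dom_gauss|exact: ccos|].
  by exists 1 => x; exact: cos_max.
have dsin t : gauss_dom (fun x => x * sin (t * x + s) * gauss a x).
  apply: (@gauss_dom_exp R a 1 1) => // [x|x].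
    by apply: (@continuousM _ _ id (fun x : R => sin (t * x + s)) x) => //; exact: csin.
  rewrite normrM !mul1r (le_trans _ (le_expR _)) //.
  by rewrite ler_piMr // sin_max.
pose f t := line_mean (fun x => cos (t * x + s) * gauss a x).
pose g t := line_mean (fun x => x * sin (t * x + s) * gauss a x).
have fd (t : R) : is_derive t 1 f (- g t).
  pose E h x := cos ((t + h) * x + s) * gauss a x - cos (t * x + s) * gauss a x
     + h * (x * sin (t * x + s) * gauss a x).
  have Ed h : gauss_dom (E h).
    by apply: gauss_domD; [exact: gauss_domB|exact: gauss_domZ].
  have [K HK] : exists K, forall h, `|h| <= 1 -> `|line_mean (E h)| <= K * h ^+ 2.
    apply: (@line_mean_quad _ E (2 * expR (2 ^+ 2 / (2 * a))) (a / 2) 1).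
    - by rewrite mulr_ge0 ?expR_ge0.
    - by rewrite divr_gt0.
    - by move=> h _; exact: Ed.
    move=> h x _.
    have -> : E h x = (cos ((t * x + s) + h * x) - cos (t * x + s) +
       (h * x) * sin (t * x + s)) * gauss a x.
      by rewrite /E (_ : (t + h) * x + s = t * x + s + h * x); ring.
    rewrite normrM (ger0_norm (gauss_ge0 _ _)).
    apply: (@le_trans _ _ (2 * h ^+ 2 * (expR (2 * `|x|) * gauss a x))).
      rewrite mulrA ler_wpM2r ?gauss_ge0 //; apply: le_trans (cos_taylor _ _) _.
      rewrite exprMn mulrA ler_wpM2l ?(mulr_ge0 _ (sqr_ge0 h)) //.
      rewrite -[x ^+ 2]real_normK ?num_real // expRM_natl.
      by rewrite lerXn2r ?nnegrE ?expR_ge0 // le_expR.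
    rewrite [leRHS](_ : _ = 2 * h ^+ 2 * (expR (2 ^+ 2 / (2 * a)) * expR (- (a / 2 * x ^+ 2)))); last by ring.
    by rewrite ler_wpM2l ?(mulr_ge0 _ (sqr_ge0 h)) //; exact: expR_gauss_le.
  apply: (@is_derive_quad _ _ _ _ K 1) => // h h1.
  apply: le_trans (HK h h1); rewrite le_eqVlt; apply/orP; left; apply/eqP; congr `|_|.
  rewrite /E line_meanD; [|exact: gauss_domB|exact: gauss_domZ].
  by rewrite line_meanB // line_meanZ // mulrN opprK.
have fg t : t * f t = 2 * a * g t.
  have t2 := sqr_ge0 t; have t1 := normr_ge0 t.
  have : line_mean (fun x => (t * cos (t * x + s) - 2 * a * x * sin (t * x + s)) * gauss a x) = 0.
  (* The constant dominates the sine, the factor [t] of its derivative and the remainder in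
     [sin_taylor]. *)
  apply: (@line_mean_gauss_deriv R a (1 + `|t| + 2 * t ^+ 2)
    (fun x => sin (t * x + s)) (fun x => t * cos (t * x + s)) a0).
  - by lra.
  - exact: csin.
  - by move=> x; apply: continuousM; [exact: cst_continuous|exact: ccos].
  - move=> x; apply: (le_trans (sin_max _)); rewrite -[leLHS]mul1r ler_pM //.
    by lra.
  - move=> x; rewrite normrM; apply: (@le_trans _ _ (`|t|)); last by lra.
    by rewrite ler_piMr // cos_max.
  - move=> x h; rewrite (_ : t * (x + h) + s = (t * x + s) + t * h); last by ring.
    rewrite (_ : h * _ = t * h * cos (t * x + s)); last by ring.
    apply: le_trans (sin_taylor _ _) _; rewrite exprMn mulrA ler_wpM2r ?sqr_ge0 //.
    by lra.
  have -> : (fun x => (t * cos (t * x + s) - 2 * a * x * sin (t * x + s)) * gauss a x)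
     = (fun x => t * (cos (t * x + s) * gauss a x) - 2 * a * (x * sin (t * x + s) * gauss a x)).
    by apply/funext => x; ring.
  rewrite line_meanB ?line_meanZ //; try exact: gauss_domZ.
  by move/eqP; rewrite subr_eq0 => /eqP.
pose H t := f t * expR (t * t * (4 * a)^-1).
have Hd (t : R) : is_derive t 1 H 0.
  have e1 : is_derive t 1 (fun t : R => t * t * (4 * a)^-1) (t / (2 * a)).
    apply: (is_derive_eq (is_deriveM (is_deriveM (is_derive_id t 1) (is_derive_id t 1))
      (is_derive_cst (4 * a)^-1 t 1))).
    rewrite /GRing.scale /=; field.
    by rewrite gt_eqF.
  have e2 := is_derive1_comp (is_derive_expR _) e1.
  apply: (is_derive_eq (is_deriveM (fd t) e2)).
  rewrite /GRing.scale /=.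
  have a1 : a != 0 by rewrite gt_eqF.
  have -> : g t = t * f t / (2 * a) by rewrite fg; field.
  by ring.
have := is_derive_0_is_cst tau 0 Hd.
rewrite /H !mul0r expR0 mulr1 => HE.
have f0 : f 0 = cos s * line_mean (gauss a).
  rewrite /f -line_meanZ; last exact: gauss_dom_gauss.
  by congr line_mean; apply/funext => x; rewrite mul0r add0r.
have EE : expR (- (tau ^+ 2 / (4 * a))) * expR (tau * tau * (4 * a)^-1) = 1.
  by rewrite -expRD expr2 addNr expR0.
by rewrite -f0 -HE mulrCA EE mulr1.
Qed.

Definition wave (k : int) (x : R) : R :=
  cos (2 * pi * k%:~R * x) + sin (2 * pi * k%:~R * x).

Lemma cas_circle k (v : 'cV[R]_1) : cas (xi (@circle R) k) v = wave (k 0) (v 0 0).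
Proof. by rewrite /cas /wave dot_circle xi_circle !mulrA. Qed.

Lemma waveDz (k m : int) x : wave k (x + m%:~R) = wave k x.
Proof.
rewrite /wave mulrDr -(mulrA (2 * pi) k%:~R m%:~R) -intrM.
by rewrite cos_periodz sin_periodz.
Qed.

Lemma continuous_wave (k : int) : continuous (wave k).
Proof.
have cl : continuous (fun x : R => 2 * pi * k%:~R * x).
  move=> x; apply: (@continuousM _ _ (cst (2 * pi * k%:~R)) id x) => //.
  exact: cst_continuous.
move=> x; apply: (@continuousD _ _ _ (fun x : R => cos (2 * pi * k%:~R * x))
    (fun x : R => sin (2 * pi * k%:~R * x)) x).
  by apply: (@continuous_comp _ _ _ (fun x : R => 2 * pi * k%:~R * x) cos x); [exact: cl|exact: continuous_cos].
by apply: (@continuous_comp _ _ _ (fun x : R => 2 * pi * k%:~R * x) sin x); [exact: cl|exact: continuous_sin].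
Qed.

Lemma wave_bound (k : int) x : `|wave k x| <= 2.
Proof.
apply: le_trans (ler_normD _ _) _; rewrite -[leRHS]/(1 + 1) lerD //.
  exact: cos_max.
exact: sin_max.
Qed.

Lemma mean_rsum (T : choiceType) (f : R -> T -> R) (g : T -> R) :
  (forall t, continuous (f^~ t)) -> (forall x t, f (x + 1) t = f x t) ->
  asum g -> (forall x t, `|f x t| <= g t) ->
  mean (@circle R) (fun v => rsum (f (v 0 0))) =
  rsum (fun t => mean (@circle R) (fun v => f (v 0 0) t)).
Proof.
move=> fc fp gs fg.
have ng x t : `|f x t| <= `|g t| by apply: le_trans (fg x t) (ler_norm _).
have cf t : cper (@circle R) (fun v => f (v 0 0) t).
  exact: (cper_circle (f := f^~ t)).
have cr : cper (@circle R) (fun v => rsum (f (v 0 0))).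
  apply: (cper_circle (f := fun x => rsum (f x))).
    move=> x; apply: (rsum_continuous (g := g)) => //.
      by move=> t; exact: fc.
    by near=> y => t.
  by move=> x; apply: eq_rsum => t.
apply/eqP; rewrite -subr_eq0 -normr_le0; apply/ler_addgt0Pr => eps eps0; rewrite add0r.
have e2 : 0 < eps / 2 by rewrite divr_gt0.
have [A HA] := rsum_tail gs e2.
have h1 : `|rsum (fun t => mean (@circle R) (fun v => f (v 0 0) t)) -
    \sum_(t <- A) mean (@circle R) (fun v => f (v 0 0) t)| <= eps / 2.
  apply: HA => t; apply: le_trans (ler_norm (g t)).
  by apply: mean_bound => v; exact: fg.
have h2 : `|mean (@circle R) (fun v => rsum (f (v 0 0))) -
    \sum_(t <- A) mean (@circle R) (fun v => f (v 0 0) t)| <= eps / 2.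
  rewrite -(mean_sum circle_orth) // -(meanB circle_orth) //; last exact: cper_sum.
  by apply: mean_bound => v; apply: HA => t; exact: ng.
move: h1 h2; move: (rsum _) (mean _ _) (\sum_(t <- A) _) => a b c.
by rewrite !ler_norml; lra.
Unshelve. all: by end_near. Qed.

Lemma asum_gauss_int (c : R) : 0 < c -> asum (fun k : int => expR (- (c * k%:~R ^+ 2))).
Proof.
move=> c0; apply: asum_le (asum_gauss_geom 0 c0) => m.
rewrite ger0_norm ?expR_ge0 //.
by have := @gauss_int_le R c 0 0 m c0; rewrite normr0 add0r; apply.
Qed.

Lemma mean_wave_mul (k : int) (l : {ffun 'I_1 -> int}) :
  mean (@circle R) (fun v => wave k (v 0 0) * cas (xi (@circle R) l) v) = (k == l 0)%:R.
Proof.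
have -> : (fun v : 'cV[R]_1 => wave k (v 0 0) * cas (xi (@circle R) l) v) =
   fun v => cas (xi (@circle R) [ffun=> k]) v * cas (xi (@circle R) l) v.
  by apply/funext => v; rewrite !cas_circle ffunE.
rewrite mean_cas_mul; last exact: circle_orth.
congr (nat_of_bool _)%:R; apply/eqP/eqP => [<-|kl]; first by rewrite ffunE.
by apply/ffunP => i; rewrite ffunE kl (ord1 i).
Qed.

Lemma periodize_gauss (a x : R) : 0 < a ->
  periodize (gauss a) x = line_mean (gauss a) *
    rsum (fun k : int => expR (- (pi ^+ 2 / a * k%:~R ^+ 2)) * wave k x).
Proof.
move=> a0.
have gd := gauss_dom_gauss a0.
have c0 : 0 < pi ^+ 2 / a :> R by rewrite divr_gt0 // exprn_gt0 // pi_gt0.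
have ws := asum_gauss_int c0.
pose w (k : int) : R := expR (- (pi ^+ 2 / a * k%:~R ^+ 2)).
have w0 k : 0 <= w k by exact: expR_ge0.
have ww k y : `|w k * wave k y| <= 2 * w k.
  by rewrite normrM (ger0_norm (w0 k)) mulrC ler_wpM2r // wave_bound.
have cw k : continuous (fun y => w k * wave k y).
  by apply: continuous_cmul; exact: continuous_wave.
have pw k y : w k * wave k (y + 1) = w k * wave k y by rewrite (waveDz k 1).
have Scper : cper (@circle R) (fun v => rsum (fun k => w k * wave k (v 0 0))).
  apply: (cper_circle (f := fun y => rsum (fun k => w k * wave k y))).
    move=> y; apply: (rsum_continuous (f := fun y k => w k * wave k y) (g := fun k => 2 * w k)).
    + by move=> k; exact: cw.
    + exact: asumZ.
    + by near=> z => k.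
  by move=> y; apply: eq_rsum.
suff /(congr1 (fun f => f (const_mx x))) : (fun v : 'cV[R]_1 => periodize (gauss a) (v 0 0)) =
   (fun v => line_mean (gauss a) * rsum (fun k => w k * wave k (v 0 0))).
  by rewrite mxE.
apply: (cper_ext circle_orth).
- exact: cper_periodize.
- exact: cperZ.
move=> l.
pose tau : R := 2 * pi * (l 0)%:~R.
have ta : expR (- (tau ^+ 2 / (4 * a))) = w (l 0).
  by congr (expR (- _)); rewrite /tau; field; rewrite gt_eqF.
transitivity (w (l 0) * line_mean (gauss a)).
  have cosd s : gauss_dom (fun x => cos (tau * x + s) * gauss a x).
    apply: gauss_domM => //.
      move=> y; apply: (@continuous_comp _ _ _ (fun x : R => tau * x + s) cos y).
        apply: (@continuousD _ _ _ (fun x : R => tau * x) (cst s) y).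
          by apply: continuousM => //; exact: cst_continuous.
        exact: cst_continuous.
      exact: continuous_cos.
    by exists 1 => y; exact: cos_max.
  (* Unfolding: the mode is invariant under integer shifts and moves inside the periodization. Its
     sine is the cosine with phase [- pi / 2], whose contribution is [cos (- pi / 2) = 0]. *)
  transitivity (line_mean (fun x => cos (tau * x + 0) * gauss a x +
       cos (tau * x - pi / 2) * gauss a x)).
    congr mean; apply/funext => v; rewrite cas_circle mulrC /periodize.
    rewrite -rsumZ; last exact: asum_periodize.
    apply: eq_rsum => m; rewrite -(waveDz (l 0) m) /wave -/tau addr0 cosBpihalf.
    by rewrite mulrDl.
  rewrite line_meanD // !line_mean_gauss_cos // ta cos0 cosN cos_pihalf.
  by rewrite mul1r mul0r mulr0 addr0.
have Sp : cper (@circle R) (fun v => rsum (fun k => w k * wave k (v 0 0)) * cas (xi (@circle R) l) v).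
  apply: cperM; last exact: (cper_cas circle_orth).
  exact: Scper.
symmetry; transitivity (line_mean (gauss a) *
    mean (@circle R) (fun v => rsum (fun k => w k * wave k (v 0 0)) * cas (xi (@circle R) l) v)).
  by rewrite -[RHS](meanZ circle_orth _ Sp); congr mean; apply/funext => v; rewrite mulrA.
rewrite mulrC; congr (_ * _).
have sw y : asum (fun k => w k * wave k y).
  by apply: asum_le (asumZ 2 ws) => k; exact: ww.
have -> : (fun v : 'cV[R]_1 => rsum (fun k => w k * wave k (v 0 0)) * cas (xi (@circle R) l) v) =
   (fun v : 'cV[R]_1 => rsum ((fun (y : R) k => w k * wave k y * wave (l 0) y) (v 0 0))).
  apply/funext => v; rewrite cas_circle mulrC -rsumZ //.
  by apply: eq_rsum => k; rewrite mulrC.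
rewrite (@mean_rsum _ (fun (y : R) k => w k * wave k y * wave (l 0) y) (fun k => 4 * w k)); first last.
- move=> y k; rewrite normrM (_ : 4 * w k = (2 * w k) * 2); last by ring.
  by rewrite ler_pM // wave_bound.
- exact: asumZ.
- by move=> y k; rewrite pw (waveDz (l 0) 1).
- move=> k y; apply: (@continuousM _ _ (fun y => w k * wave k y) (wave (l 0)) y).
    exact: cw.
  exact: continuous_wave.
have mE k : mean (@circle R) (fun v => w k * wave k (v 0 0) * wave (l 0) (v 0 0)) =
    w k * (k == l 0)%:R.
  under eq_fun do rewrite -mulrA -(cas_circle l).
  rewrite (meanZ circle_orth) ?mean_wave_mul //.
  apply: cperM; last exact: (cper_cas circle_orth).
  apply: (cper_circle (f := wave k)); first exact: continuous_wave.
  by move=> y; rewrite (waveDz k 1).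
under eq_rsum do rewrite mE.
have [|_ ->] := @rsum_finite R int (fun k => w k * (k == l 0)%:R) [fset l 0]%fset.
  by move=> k; rewrite !inE => /negPf ->; rewrite mulr0.
by rewrite big_seq_fset1 eqxx mulr1.
Unshelve. all: by end_near. Qed.

(** The derivative is minus the second moment [g], and [line_mean_gauss_deriv] with [p] the identity
    gives [line_mean (gauss a) = 2 * a * g]. *)
Lemma line_mean_gauss_derive (a : R) : 0 < a ->
  is_derive a 1 (fun t : R => line_mean (gauss t)) (- (line_mean (gauss a) / (2 * a))).
Proof.
move=> a0.
have idc : continuous (fun x : R => x) by move=> x.
have x2g : gauss_dom (fun x => x ^+ 2 * gauss a x).
  apply: (@gauss_dom_exp R a 1 2) => // [x|x]; first exact: exprn_continuous.
  rewrite mul1r ger0_norm ?sqr_ge0 // -[x ^+ 2]real_normK ?num_real // expRM_natl.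
  by rewrite lerXn2r ?nnegrE ?expR_ge0 // le_expR.
pose g := line_mean (fun x => x ^+ 2 * gauss a x).
have gE : line_mean (gauss a) = 2 * a * g.
  have : line_mean (fun x => (1 - 2 * a * x * x) * gauss a x) = 0.
    apply: (@line_mean_gauss_deriv R a 1 (fun x => x) (cst 1) a0) => //.
    - exact: cst_continuous.
    - by move=> x; rewrite mul1r le_expR.
    - by move=> x; rewrite normr1.
    - move=> x h; rewrite /= (_ : _ - _ - _ = 0); last by ring.
      by rewrite normr0 mul1r sqr_ge0.
  have -> : (fun x => (1 - 2 * a * x * x) * gauss a x) =
     (fun x => gauss a x - 2 * a * (x ^+ 2 * gauss a x)) by apply/funext => x; ring.
  rewrite line_meanB ?line_meanZ //; [|exact: gauss_dom_gauss|exact: gauss_domZ].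
  by move/eqP; rewrite subr_eq0 => /eqP.
have -> : - (line_mean (gauss a) / (2 * a)) = - g.
  by rewrite gE; field; rewrite gt_eqF.
(* For [h] up to [a / 4] the remainder loses at most a factor [expR (a / 4 * x ^+ 2)], which leaves
   a Gaussian of rate [3 * a / 4]. *)
have a4 : 0 < a / 4 by rewrite divr_gt0.
have b0 : 0 < 3 * a / 4 by lra.
pose E h x := gauss (a + h) x - gauss a x + h * (x ^+ 2 * gauss a x).
have ah h : `|h| <= a / 4 -> 0 < a + h by rewrite ler_norml => /andP[h1 _]; lra.
have Ed h : `|h| <= a / 4 -> gauss_dom (E h).
  move=> h4; apply: gauss_domD; last exact: gauss_domZ.
  by apply: gauss_domB; apply: gauss_dom_gauss => //; exact: ah.
have [K HK] : exists K, forall h, `|h| <= a / 4 -> `|line_mean (E h)| <= K * h ^+ 2.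
  apply: (@line_mean_quad _ E (expR (4 ^+ 2 / (2 * (3 * a / 4)))) (3 * a / 4 / 2)) => //.
    by rewrite divr_gt0.
  move=> h x h4.
  have -> : E h x = gauss a x * (expR (- (h * x ^+ 2)) - 1 - (- (h * x ^+ 2))).
    rewrite /E (_ : gauss (a + h) x = gauss a x * expR (- (h * x ^+ 2))).
      by ring.
    by rewrite /gauss -expRD; congr expR; ring.
  rewrite normrM (ger0_norm (gauss_ge0 _ _)).
  apply: (@le_trans _ _ (gauss a x * ((h * x ^+ 2) ^+ 2 * expR (a / 4 * x ^+ 2)))).
    rewrite ler_wpM2l ?gauss_ge0 //; apply: le_trans (expR_taylor _) _.
    rewrite sqrrN ler_wpM2l ?sqr_ge0 // ler_expR normrN normrM.
    by rewrite (ger0_norm (sqr_ge0 x)) ler_wpM2r // sqr_ge0.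
  have -> : gauss a x * ((h * x ^+ 2) ^+ 2 * expR (a / 4 * x ^+ 2)) =
      h ^+ 2 * (x ^+ 4 * expR (- (3 * a / 4 * x ^+ 2))).
    have -> : expR (- (3 * a / 4 * x ^+ 2)) = gauss a x * expR (a / 4 * x ^+ 2).
      by rewrite /gauss -expRD; congr expR; field.
    by ring.
  rewrite [leRHS](_ : _ = h ^+ 2 * (expR (4 ^+ 2 / (2 * (3 * a / 4))) *
     expR (- (3 * a / 4 / 2 * x ^+ 2)))); last by ring.
  rewrite ler_wpM2l ?sqr_ge0 //.
  apply: le_trans (@expR_gauss_le R (3 * a / 4) 4 x b0).
  rewrite ler_wpM2r ?expR_ge0 // (_ : x ^+ 4 = `|x| ^+ 4).
    by rewrite expRM_natl lerXn2r ?nnegrE ?expR_ge0 // le_expR.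
  by rewrite (exprM x 2 2) (exprM `|x| 2 2) real_normK ?num_real.
apply: (@is_derive_quad _ _ _ _ K (a / 4)) => // h h1.
apply: le_trans (HK h h1); rewrite le_eqVlt; apply/orP; left; apply/eqP; congr `|_|.
rewrite /E line_meanD; [|by apply: gauss_domB; apply: gauss_dom_gauss => //; exact: ah|exact: gauss_domZ].
rewrite line_meanB; [|by apply: gauss_dom_gauss; exact: ah|exact: gauss_dom_gauss].
by rewrite line_meanZ // mulrN opprK.
Qed.

(* The constant is pinned down at the self-dual point [a = pi]. *)
Lemma line_mean_gauss_pi : line_mean (gauss (pi : R)) = 1.
Proof.
have p0 := pi_gt0 R; have := periodize_gauss 0 p0.
have -> : rsum (fun k : int => expR (- (pi ^+ 2 / pi * k%:~R ^+ 2)) * wave k 0) =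
    periodize (gauss pi) 0.
  apply: eq_rsum => k; rewrite /wave mulr0 cos0 sin0 addr0 mulr1 add0r /gauss.
  by rewrite expr2 mulfK // gt_eqF.
set P := periodize _ _ => PE.
(* The term of index 0 alone contributes 1 to a sum of nonnegative terms. *)
have P0 : P != 0.
  apply/eqP => P0; have gs := asum_periodize 0 (gauss_dom_gauss p0).
  have g0 (m : int) : 0 <= gauss (pi : R) (0 + m%:~R) by exact: gauss_ge0.
  have := sum_le_rsum [fset (0 : int)]%fset g0 gs; rewrite -/(periodize (gauss pi) 0) -/P P0.
  by rewrite big_seq_fset1 addr0 /gauss expr0n mulr0 oppr0 expR0 ler10.
by apply: (mulIf P0); rewrite mul1r -PE.
Qed.

(** The value is the square root of [pi / a]. The variable [u = ln a] spreads the half-line over all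
    reals, where a zero derivative gives constancy; [expR (u / 2)] is the integrating factor. *)
Lemma line_mean_gauss (a : R) : 0 < a ->
  line_mean (gauss a) = expR (2^-1 * (ln pi - ln a)).
Proof.
move=> a0.
pose H (u : R) := line_mean (gauss (expR u)) * expR (u * 2^-1).
have Hd (u : R) : is_derive u 1 H 0.
  have e0 := expR_gt0 u.
  have d1 := is_derive1_comp (line_mean_gauss_derive e0) (is_derive_expR u).
  have d2 : is_derive u 1 (fun u : R => u * 2^-1) (2^-1).
    apply: (is_derive_eq (is_deriveM (is_derive_id u 1) (is_derive_cst (2^-1 : R) u 1))).
    by rewrite /GRing.scale /=; ring.
  have d3 := is_derive1_comp (is_derive_expR _) d2.
  apply: (is_derive_eq (is_deriveM d1 d3)).
  by rewrite /GRing.scale /=; field; rewrite gt_eqF.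
have := is_derive_0_is_cst (ln a) (ln pi) Hd.
rewrite /H !lnK ?posrE ?pi_gt0 // line_mean_gauss_pi mul1r => E.
have -> : 2^-1 * (ln pi - ln a) = ln pi * 2^-1 - ln a * 2^-1 :> R by ring.
by rewrite expRD -E expRN mulfK // gt_eqF // expR_gt0.
Qed.

(** [periodize_gauss] at [a = 1 / (4 * s)], for which [pi ^+ 2 / a] is [4 * pi ^+ 2 * s]. *)
Lemma theta_inversion (s x : R) : 0 < s ->
  rsum (fun k : int => expR (- (4 * pi ^+ 2 * s * k%:~R ^+ 2)) * wave k x) =
  (4 * pi * s) `^ (- 2^-1) * rsum (fun m : int => expR (- ((4 * s)^-1 * (m%:~R + x) ^+ 2))).
Proof.
move=> s0; have p0 := pi_gt0 R.
have s4 : 0 < 4 * s by rewrite mulr_gt0.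
have a0 : 0 < (4 * s)^-1 by rewrite invr_gt0.
have := periodize_gauss x a0; rewrite /periodize /gauss.
under eq_rsum do rewrite addrC.
move=> ->.
have K : (4 * pi * s) `^ (- 2^-1) * line_mean (gauss (4 * s)^-1) = 1.
  rewrite line_mean_gauss // /powR gt_eqF ?mulr_gt0 // -expRD.
  rewrite lnV ?posrE // (_ : 4 * pi * s = pi * (4 * s)); last by ring.
  rewrite lnM ?posrE // (_ : - 2^-1 * _ + _ = 0) ?expR0 //.
  by ring.
rewrite [RHS]mulrA K mul1r (_ : pi ^+ 2 / (4 * s)^-1 = 4 * pi ^+ 2 * s) //.
by rewrite invrK; ring.
Qed.

End theta_inversion.

(** * Eigenforms of a flat torus *)

Section smooth.
Context {R : realType} {n : nat}.
Implicit Types (f g : 'cV[R]_n -> R^o) (v x : 'cV[R]_n).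

Lemma smooth_continuous f : smooth f -> continuous f.
Proof. by move=> /(_ 0%N) []. Qed.

Lemma smooth_derivable f v x : smooth f -> derivable f x v.
Proof. by move=> /(_ 1%N) [_ /(_ v)[]]. Qed.

Lemma smooth_derive f v : smooth f -> smooth (fun x => 'D_v f x).
Proof. by move=> fs k; have [_ /(_ v)[]] := fs k.+1. Qed.

Lemma smoothD f g : smooth f -> smooth g -> smooth (fun x => f x + g x).
Proof.
move=> fs gs k; elim: k f g fs gs => [|k IH] f g fs gs.
  split=> // x; apply: (@continuousD _ _ _ f g x); exact: smooth_continuous.
split=> [x|v].
  by apply: (@continuousD _ _ _ f g x); exact: smooth_continuous.
split=> [x|].
  by apply: (@derivableD _ _ _ f g); exact: smooth_derivable.
have -> : (fun x => 'D_v (fun x => f x + g x : R^o) x) = fun x => 'D_v f x + 'D_v g x.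
  by apply/funext => x; apply: (@deriveD _ _ _ f g); exact: smooth_derivable.
by apply: IH; exact: smooth_derive.
Qed.

Lemma smooth_scale (c : R) f : smooth f -> smooth (fun x => c * f x).
Proof.
move=> fs k; elim: k f fs => [|k IH] f fs.
  split=> // x; apply: (@continuousM _ _ (cst c) f x); first exact: cst_continuous.
  exact: smooth_continuous.
split=> [x|v].
  apply: (@continuousM _ _ (cst c) f x); first exact: cst_continuous.
  exact: smooth_continuous.
split=> [x|].
  by apply: (@derivableZ _ _ _ f c); exact: smooth_derivable.
have -> : (fun x => 'D_v (fun x => c * f x : R^o) x) = fun x => c * 'D_v f x.
  by apply/funext => x; apply: (@deriveZ _ _ _ f c); exact: smooth_derivable.
by apply: IH; exact: smooth_derive.
Qed.

Lemma smooth0 : smooth (fun _ : 'cV[R]_n => 0 : R).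
Proof.
elim=> [|k IH]; first by split=> // x; exact: cst_continuous.
split=> [x|v]; first exact: cst_continuous.
split=> [x|]; first exact: derivable_cst.
have -> : (fun x : 'cV[R]_n => 'D_v (fun _ : 'cV[R]_n => 0 : R^o) x) = fun=> 0.
  by apply/funext => x; rewrite derive_cst.
exact: IH.
Qed.

Lemma smooth_sum (I : Type) (r : seq I) (P : pred I) (F : I -> 'cV[R]_n -> R) :
  (forall i, P i -> smooth (F i)) -> smooth (fun x => \sum_(i <- r | P i) F i x).
Proof.
move=> Fs; elim: r => [|i r IH].
  by under eq_fun do rewrite big_nil; exact: smooth0.
under eq_fun do rewrite big_cons.
by case Pi: (P i) => //; apply: smoothD => //; exact: Fs.
Qed.

Lemma smoothN f : smooth f -> smooth (fun x => - f x).
Proof. by move=> fs; under eq_fun do rewrite -mulN1r; exact: smooth_scale. Qed.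

Lemma continuous_cas (u : 'cV[R]_n) : continuous (cas u : 'cV[R]_n -> R).
Proof.
have cl : continuous (fun x : 'cV[R]_n => 2 * pi * dot u x).
  move=> x; apply: (@continuousM _ _ (cst (2 * pi)) (dot u) x).
    exact: cst_continuous.
  exact: continuous_dot.
move=> x; apply: (@continuousD _ _ _ (fun x => cos (2 * pi * dot u x))
   (fun x => sin (2 * pi * dot u x)) x).
  apply: (@continuous_comp _ _ _ (fun x : 'cV[R]_n => 2 * pi * dot u x) cos x).
    exact: cl.
  exact: continuous_cos.
apply: (@continuous_comp _ _ _ (fun x : 'cV[R]_n => 2 * pi * dot u x) sin x).
  exact: cl.
exact: continuous_sin.
Qed.

Lemma smooth_cas (u : 'cV[R]_n) : smooth (cas u : 'cV[R]_n -> R).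
Proof.
(* The derivative of a multiple of a mode is a multiple of the reversed mode, so the induction
   ranges over coefficient and frequency. *)
suff H k (c : R) w : Ck k (fun x => c * cas w x : R^o).
  move=> k; have := H k 1 u.
  by congr Ck; apply/funext => x; rewrite mul1r.
have cc (a : R) (z : 'cV[R]_n) : continuous (fun x => a * cas z x : R^o).
  move=> x; apply: (@continuousM _ _ (cst a) (cas z) x); first exact: cst_continuous.
  exact: continuous_cas.
elim: k c w => [|k IH] c w; first by split.
split=> // v; split=> [x|].
  by apply: (@derivableZ _ _ _ (cas w : _ -> R^o) c); exact: derivable_cas.
have -> : (fun x => 'D_v (fun x => c * cas w x : R^o) x) =
    fun x => (c * (2 * pi * dot v w)) * cas (- w) x.
  apply/funext => x; rewrite -mulrA -derive_cas.
  by apply: (@deriveZ _ _ _ (cas w : _ -> R^o) c); exact: derivable_cas.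
exact: IH.
Qed.

End smooth.

Section row_mx_cons.
Context {R : Type} {n p : nat}.
Implicit Types (u : 'cV[R]_n) (V : 'M[R]_(n, p)).

Lemma row_mx_head u V i : (row_mx u V : 'M[R]_(n, p.+1)) i ord0 = u i 0.
Proof.
have -> : (ord0 : 'I_p.+1) = lshift p (ord0 : 'I_1) by exact: val_inj.
exact: row_mxEl.
Qed.

Lemma row_mx_tail u V i a : (row_mx u V : 'M[R]_(n, p.+1)) i (lift ord0 a) = V i a.
Proof.
have -> : lift ord0 a = rshift 1 a by exact: val_inj.
exact: row_mxEr.
Qed.

Lemma col_row_mx_head u V : col ord0 (row_mx u V : 'M[R]_(n, p.+1)) = u.
Proof. by apply/colP => i; rewrite mxE row_mx_head. Qed.

Lemma col'_row_mx_head u V : col' ord0 (row_mx u V : 'M[R]_(n, p.+1)) = V.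
Proof. by apply/matrixP => i a; rewrite mxE row_mx_tail. Qed.

Lemma col_row_mx_tail u V a : col (lift ord0 a) (row_mx u V : 'M[R]_(n, p.+1)) = col a V.
Proof. by apply/colP => i; rewrite mxE row_mx_tail mxE. Qed.

End row_mx_cons.

Lemma col'_row_mx_tail (R : Type) (n q : nat) (u : 'cV[R]_n) (V : 'M[R]_(n, q.+1)) i :
  col' (lift ord0 i) (row_mx u V : 'M[R]_(n, q.+2)) = row_mx u (col' i V).
Proof.
apply/matrixP => a b; rewrite mxE.
have [->|[c ->]] : b = (ord0 : 'I_q.+1) \/ exists c, b = lift ord0 c.
  by case: (unliftP ord0 b) => [c|] ->; [right; exists c|left].
- have -> : lift (lift ord0 i) (ord0 : 'I_q.+1) = ord0 by exact: val_inj.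
  by rewrite !row_mx_head.
have -> : lift (lift ord0 i) (lift ord0 c) = lift ord0 (lift i c).
  by apply: val_inj; rewrite /= /bump /= !add1n ltnS addnS.
by rewrite !row_mx_tail mxE.
Qed.

Section fourier_forms.
Context {R : realType} {n : nat} (e : 'I_n -> 'cV[R]_n).
Hypothesis He : forall i j, dot (e i) (e j) = (i == j)%:R.
Implicit Types (k l : {ffun 'I_n -> int}).

Definition smooth_periodic p (w : @pform R n p) : Prop :=
  forall V, smooth (fun x => w x V) /\ forall i x, w (x + e i) V = w x V.

Definition fcoef p (w : @pform R n p) k (V : 'M[R]_(n, p)) : R :=
  mean e (fun x => w x V * cas (xi e k) x).

Lemma derive_translate (f : 'cV[R]_n -> R^o) (h v x : 'cV[R]_n) :
  (forall y, f (y + h) = f y) -> 'D_v f (x + h) = 'D_v f x.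
Proof.
move=> fh; rewrite /derive.
have -> // : (fun t : R => t^-1 *: ((f \o shift (x + h)) (t *: v) - f (x + h))) =
  (fun t : R => t^-1 *: ((f \o shift x) (t *: v) - f x)).
by apply/funext => t /=; rewrite addrA !fh.
Qed.

Lemma smooth_periodic_cper p (w : @pform R n p) V :
  smooth_periodic w -> cper e (fun x => w x V).
Proof.
move=> /(_ V)[ws wp]; split => [x|i x]; last exact: wp.
exact: (smooth_continuous ws).
Qed.

Lemma smooth_periodic_derive_cper p (w : @pform R n p) V v :
  smooth_periodic w -> cper e (fun x => 'D_v (fun y => w y V : R^o) x).
Proof.
move=> /(_ V)[ws wp]; split => [x|i x].
  exact: (smooth_continuous (smooth_derive v ws)).
by apply: derive_translate => y; exact: wp.
Qed.

Lemma smooth_periodic_ext_deriv p (w : @pform R n p) :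
  smooth_periodic w -> smooth_periodic (ext_deriv w).
Proof.
move=> wsp V; split => [|i x].
  apply: smooth_sum => i _; apply: smooth_scale; apply: smooth_derive.
  exact: (wsp _).1.
apply: eq_bigr => j _; congr (_ * _); apply: derive_translate => y.
exact: (wsp _).2.
Qed.

Lemma smooth_periodic_coderiv p (w : @pform R n p.+1) :
  smooth_periodic w -> smooth_periodic (coderiv w).
Proof.
move=> wsp V; split => [|i x].
  apply: smoothN; apply: smooth_sum => i _; apply: smooth_derive.
  exact: (wsp _).1.
congr (- _); apply: eq_bigr => j _; apply: derive_translate => y.
exact: (wsp _).2.
Qed.

Lemma fcoef_derive p (w : @pform R n p) k V v : smooth_periodic w ->
  mean e (fun x => 'D_v (fun y => w y V : R^o) x * cas (xi e k) x) =
  - (2 * pi * dot v (xi e k)) * fcoef w (- k) V.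
Proof.
move=> wsp; apply: (mean_by_parts He).
- exact: smooth_periodic_cper.
- by move=> x; apply: smooth_derivable; exact: (wsp V).1.
- exact: smooth_periodic_derive_cper.
Qed.

Lemma fcoef_ext_deriv p (w : @pform R n p) k V : smooth_periodic w ->
  fcoef (ext_deriv w) k V = \sum_(i < p.+1) (-1) ^+ i *
    (- (2 * pi * dot (col i V) (xi e k)) * fcoef w (- k) (col' i V)).
Proof.
move=> wsp; rewrite /fcoef /ext_deriv.
under eq_fun do rewrite mulr_suml.
have dc i : cper e (fun x => 'D_(col i V) (fun y => w y (col' i V) : R^o) x * cas (xi e k) x).
  by apply: cperM; [exact: smooth_periodic_derive_cper|exact: cper_cas].
rewrite (mean_sum He) => [|i _]; last first.
  by under eq_fun do rewrite -mulrA; exact: cperZ.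
apply: eq_bigr => i _; under eq_fun do rewrite -mulrA.
by rewrite (meanZ He _ (dc i)) fcoef_derive.
Qed.

Lemma fcoef_coderiv p (w : @pform R n p.+1) k V : smooth_periodic w ->
  fcoef (coderiv w) k V = \sum_(j < n) 2 * pi * dot (delta_mx j 0) (xi e k) *
    fcoef w (- k) (row_mx (delta_mx j 0 : 'cV[R]_n) V).
Proof.
move=> wsp; rewrite /fcoef /coderiv.
under eq_fun do rewrite -sumrN mulr_suml.
have dc (j : 'I_n) : cper e (fun x => 'D_(delta_mx j 0) (fun y =>
    w y (row_mx (delta_mx j 0 : 'cV[R]_n) V) : R^o) x * cas (xi e k) x).
  by apply: cperM; [exact: smooth_periodic_derive_cper|exact: cper_cas].
rewrite (mean_sum He) => [|i _]; last first.
  by under eq_fun do rewrite mulNr; exact: cperN.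
apply: eq_bigr => i _; under eq_fun do rewrite mulNr.
by rewrite (meanN He (dc i)) fcoef_derive // mulNr opprK.
Qed.

Lemma smooth_periodic_laplacian p (w : @pform R n p) :
  smooth_periodic w -> smooth_periodic (laplacian w).
Proof.
case: p w => [|q] w wsp.
  by apply: smooth_periodic_coderiv; exact: smooth_periodic_ext_deriv.
move=> V.
have [s1 p1] := smooth_periodic_ext_deriv (smooth_periodic_coderiv wsp) V.
have [s2 p2] := smooth_periodic_coderiv (smooth_periodic_ext_deriv wsp) V.
split; first exact: smoothD.
by move=> i x; rewrite /= /GRing.add /= /GRing.add /= p1 p2.
Qed.

Lemma sum_dot_delta (u : 'cV[R]_n) : \sum_(j < n) dot (delta_mx j 0) u ^+ 2 = dot u u.
Proof. by rewrite dotE; apply: eq_bigr => j _; rewrite dot_deltal expr2. Qed.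

(* Both halves of the Laplacian produce the same mixed terms, with opposite
   signs; no symmetry of second derivatives is needed on Fourier coefficients. *)
Lemma fcoef_coderiv_ext_deriv p (w : @pform R n p) k V : smooth_periodic w ->
  fcoef (coderiv (ext_deriv w)) k V =
  4 * pi ^+ 2 * dot (xi e k) (xi e k) * fcoef w k V -
  \sum_(j < n) \sum_(i < p) (-1) ^+ i * (2 * pi * dot (delta_mx j 0) (xi e k)) *
    (2 * pi * dot (col i V) (xi e k)) *
    fcoef w k (col' (lift ord0 i) (row_mx (delta_mx j 0 : 'cV[R]_n) V)).
Proof.
move=> wsp; rewrite fcoef_coderiv; last exact: smooth_periodic_ext_deriv.
rewrite -sum_dot_delta mulr_sumr mulr_suml -sumrB; apply: eq_bigr => j _.
rewrite fcoef_ext_deriv // big_ord_recl /= expr0 mul1r.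
rewrite mulrDr mulr_sumr -sumrN; congr (_ + _).
  rewrite col_row_mx_head col'_row_mx_head.
  by rewrite opprK xiN dotNr; ring.
apply: eq_bigr => i _.
rewrite col_row_mx_tail.
by rewrite opprK xiN dotNr /bump /= add1n exprS; ring.
Qed.

Lemma fcoef_laplacian p (w : @pform R n p) k V : smooth_periodic w ->
  fcoef (laplacian w) k V = 4 * pi ^+ 2 * dot (xi e k) (xi e k) * fcoef w k V.
Proof.
case: p w V => [|q] w V wsp.
  rewrite /= fcoef_coderiv_ext_deriv // big1 ?subr0 // => j _.
  by rewrite big_ord0.
have s1 := smooth_periodic_ext_deriv (smooth_periodic_coderiv wsp).
have s2 := smooth_periodic_coderiv (smooth_periodic_ext_deriv wsp).
have cD : fcoef (laplacian w) k V = fcoef (ext_deriv (coderiv w)) k V +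
    fcoef (coderiv (ext_deriv w)) k V.
  rewrite /fcoef -(meanD He).
  - by congr mean; apply/funext => x; rewrite -mulrDl.
  - by apply: cperM; [exact: smooth_periodic_cper|exact: cper_cas].
  - by apply: cperM; [exact: smooth_periodic_cper|exact: cper_cas].
rewrite cD fcoef_coderiv_ext_deriv // fcoef_ext_deriv; last exact: smooth_periodic_coderiv.
rewrite addrC -[RHS]addr0 -addrA; congr (_ + _).
(* Deleting column [i + 1] from [(e_j, V)] amounts to deleting column [i] from [V] behind [e_j], so
   the mixed terms cancel pair by pair. *)
rewrite exchange_big /= addrC -sumrB big1 // => i _.
rewrite fcoef_coderiv // !mulr_sumr -sumrB big1 // => j _.
rewrite opprK xiN !dotNr.
rewrite col'_row_mx_tail.
by ring.
Qed.

End fourier_forms.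

(** * Alternating forms in the lattice basis *)

Section alternating_forms.
Context {R : realType} {n p : nat}.
Implicit Types (f : 'M[R]_(n, p) -> R) (V : 'M[R]_(n, p)) (u v : 'cV[R]_n).

Definition setcol V (i : 'I_p) u : 'M[R]_(n, p) :=
  \matrix_(a, b) if b == i then u a 0 else V a b.

Lemma col_setcol V i u : col i (setcol V i u) = u.
Proof. by apply/colP => a; rewrite !mxE eqxx. Qed.

Lemma col_setcol_neq V i j u : j != i -> col j (setcol V i u) = col j V.
Proof. by move=> ji; apply/colP => a; rewrite !mxE (negPf ji). Qed.

Lemma col'_setcol V i u v : col' i (setcol V i u) = col' i (setcol V i v).
Proof.
by apply/matrixP => a b; rewrite !mxE eq_sym (negPf (neq_lift _ _)).
Qed.

Lemma setcol_id V i : setcol V i (col i V) = V.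
Proof. by apply/matrixP => a b; rewrite !mxE; case: eqP => [->|]. Qed.

Lemma setcolC V i j u v : i != j ->
  setcol (setcol V i u) j v = setcol (setcol V j v) i u.
Proof.
move=> ij; apply/matrixP => a b; rewrite !mxE.
by have [->|] := eqVneq b j; rewrite ?(negPf ij) // eq_sym (negPf ij).
Qed.

Lemma multilinear_setcol f V i (c : R) u v : multilinear f ->
  f (setcol V i (c *: u + v)) = c * f (setcol V i u) + f (setcol V i v).
Proof.
move=> ml; apply: (ml i); rewrite ?col_setcol //; exact: col'_setcol.
Qed.

Lemma multilinear_setcol0 f V i : multilinear f -> f (setcol V i 0) = 0.
Proof.
move=> ml; have := multilinear_setcol V i 1 0 0 ml.
by rewrite scaler0 addr0 mul1r => /eqP; rewrite -subr_eq0 opprD addrA subrr sub0r oppr_eq0 => /eqP.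
Qed.

Lemma multilinear_setcol_sum f V i (I : Type) (r : seq I) (c : I -> R) (u : I -> 'cV[R]_n) :
  multilinear f -> f (setcol V i (\sum_(j <- r) c j *: u j)) =
  \sum_(j <- r) c j * f (setcol V i (u j)).
Proof.
move=> ml; elim: r => [|j r IH]; first by rewrite !big_nil multilinear_setcol0.
by rewrite !big_cons multilinear_setcol // IH.
Qed.

Lemma alternating_swap f V i j u v : multilinear f -> Defs.alternating f -> i != j ->
  f (setcol (setcol V i u) j v) = - f (setcol (setcol V i v) j u).
Proof.
move=> ml al ij; pose F x y := f (setcol (setcol V i x) j y).
have FD2 x y z : F x (y + z) = F x y + F x z.
  by have := multilinear_setcol (setcol V i x) j 1 y z ml; rewrite scale1r mul1r.
have FD1 x y z : F (x + y) z = F x z + F y z.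
  rewrite /F !(setcolC _ _ _ ij).
  by have := multilinear_setcol (setcol V j z) i 1 x y ml; rewrite scale1r mul1r.
have F0 x : F x x = 0.
  by apply: (al _ i j) => //; rewrite (col_setcol_neq _ _ ij) !col_setcol.
have := F0 (u + v); rewrite FD1 !FD2 !F0 add0r addr0 => /eqP.
by rewrite addr_eq0 => /eqP.
Qed.

Context (e : 'I_n -> 'cV[R]_n).
Hypothesis He : forall i j, dot (e i) (e j) = (i == j)%:R.

Definition basis_mx (g : 'I_p -> 'I_n) : 'M[R]_(n, p) := \matrix_(a, b) e (g b) a 0.

Lemma col_basis_mx g b : col b (basis_mx g) = e (g b).
Proof. by apply/colP => a; rewrite !mxE. Qed.

Lemma multilinear_eq0 f : multilinear f -> (forall g, f (basis_mx g) = 0) ->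
  forall V, f V = 0.
Proof.
move=> ml f0 V.
(* Induction on the number [m] of leading columns not yet known to be basis vectors. It needs some
   map [g] to start: for [p = 0] there is the empty one, and for [n = 0 < p] the matrix has a zero
   column instead. *)
suff H m V' (g : 'I_p -> 'I_n) : (forall b : 'I_p, (m <= b)%N -> col b V' = e (g b)) ->
    f V' = 0.
  have [p0|p0] := posnP p.
    have g : 'I_p -> 'I_n by move=> b; have := leq_trans (ltn_ord b) (eq_leq p0).
    by apply: (H 0%N V g) => b; have := leq_trans (ltn_ord b) (eq_leq p0).
  have [n0|n0] := posnP n.
    have -> : V = setcol V (Ordinal p0) 0; last exact: multilinear_setcol0.
    by apply/matrixP => a; have := leq_trans (ltn_ord a) (eq_leq n0).
  by apply: (H p V (fun=> Ordinal n0)) => b; rewrite leqNgt ltn_ord.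
elim: m V' g => [|m IH] V' g Vg.
  have -> : V' = basis_mx g; last exact: f0.
  apply/matrixP => a b; have /colP/(_ a) := Vg b isT.
  by rewrite !mxE.
have [pm|mp] := leqP p m.
  apply: (IH V' g) => b mb; have := ltn_ord b.
  by rewrite ltnNge (leq_trans pm mb).
pose i := Ordinal mp.
rewrite -(setcol_id V' i) (basis_expand He (col i V')).
rewrite multilinear_setcol_sum // big1 // => j _.
rewrite (IH _ (fun b => if b == i then j else g b)) ?mulr0 // => b mb.
have [->|bi] := eqVneq b i; first by rewrite col_setcol.
rewrite col_setcol_neq // Vg // ltn_neqAle mb andbT.
by apply: contra bi => /eqP mb'; apply/eqP/val_inj.
Qed.

Definition psubset := {I : {set 'I_n} | #|I| == p}.

Definition psubset_fun (I : psubset) (a : 'I_p) : 'I_n :=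
  enum_val (cast_ord (esym (eqP (valP I))) a).

Lemma psubset_fun_inj I : injective (psubset_fun I).
Proof. by move=> a b /enum_val_inj /cast_ord_inj. Qed.

Lemma psubset_funP (I : psubset) a : psubset_fun I a \in val I.
Proof. exact: enum_valP. Qed.

Lemma psubset_fun_codom (I : psubset) i : i \in val I -> exists a, psubset_fun I a = i.
Proof.
move=> iI; exists (cast_ord (eqP (valP I)) (enum_rank_in iI i)).
by rewrite /psubset_fun cast_ordK enum_rankK_in.
Qed.

(** Only vanishing is transported, so transpositions are handled one at a time and the sign of [s]
    is never computed. *)
Lemma alternating_perm_eq0 f (s : 'S_p) (g : 'I_p -> 'I_n) : multilinear f -> Defs.alternating f ->
  f (basis_mx g) = 0 -> f (basis_mx (g \o s)) = 0.
Proof.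
move=> ml al; have [ts -> _] := prod_tpermP s.
elim: ts g => [|[i j] ts IH] g fg.
  rewrite big_nil (_ : basis_mx _ = basis_mx g) //.
  by apply/matrixP => a b; rewrite !mxE /= perm1.
rewrite big_cons /=.
pose P := (\prod_(t <- ts) tperm t.1 t.2)%g : 'S_p.
rewrite -/P; have := IH g fg; rewrite -/P => fP.
have [->|ij] := eqVneq i j.
  rewrite (_ : basis_mx _ = basis_mx (g \o P)) //.
  by apply/matrixP => a b; rewrite !mxE /= permM tperm1 perm1.
pose W := basis_mx (g \o P).
have -> : basis_mx (g \o (tperm i j * P)%g) = setcol (setcol W i (col j W)) j (col i W).
  apply/matrixP => a b; rewrite !mxE /= permM.
  have [->|bj] := eqVneq b j; first by rewrite tpermR.
  have [->|bi] := eqVneq b i; first by rewrite tpermL.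
  by rewrite tpermD // eq_sym.
rewrite alternating_swap // setcol_id.
have -> : setcol W j (col j W) = W by exact: setcol_id.
by rewrite fP oppr0.
Qed.

Lemma alternating_eq0 f : multilinear f -> Defs.alternating f ->
  (forall I : psubset, f (basis_mx (psubset_fun I)) = 0) -> forall V, f V = 0.
Proof.
move=> ml al fI; apply: multilinear_eq0 => // g.
have [/injectiveP gi|gi] := boolP (injectiveb g); last first.
  have /injectivePn[i [j ij gij]] := gi.
  by apply: (al _ i j ij); rewrite !col_basis_mx gij.
have cI : #|(g @: 'I_p)%SET| == p by rewrite card_imset // card_ord.
pose I : psubset := exist (fun I : {set 'I_n} => #|I| == p) _ cI.
have : perm_eq [tuple g a | a < p] [tuple psubset_fun I a | a < p].
  apply: uniq_perm.
  - by rewrite map_inj_uniq ?enum_uniq.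
  - by rewrite map_inj_uniq ?enum_uniq //; exact: psubset_fun_inj.
  move=> i; apply/mapP/mapP => -[a _ ->].
    have : g a \in val I by exact: imset_f.
    by move=> /psubset_fun_codom[b bE]; exists b; rewrite ?mem_enum.
  have /imsetP[b _ ->] := psubset_funP I a.
  by exists b; rewrite ?mem_enum.
case/tuple_permP => s sE.
rewrite (_ : basis_mx g = basis_mx (psubset_fun I \o s)); first exact: alternating_perm_eq0.
apply/matrixP => a b; rewrite !mxE /=; congr (e _ _ _).
have /(congr1 (fun t : seq 'I_n => nth (g b) t b)) := sE.
by rewrite -!tnth_nth !tnth_mktuple.
Qed.

(** The wedge product of the covectors dual to the [e i] with [i] in [I], in the order of
    [psubset_fun]. *)
Definition eta (I : psubset) V : R :=
  \det (\matrix_(b < p, a < p) dot (e (psubset_fun I a)) (col b V)).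

Lemma eta_multilinear I : multilinear (eta I).
Proof.
move=> i c V V1 V2 Vi V1i V2i; rewrite /eta.
rewrite (determinant_multilinear (i0 := i) (b := c) (c := 1) (B := \matrix_(b < p, a < p) dot (e (psubset_fun I a)) (col b V1))
  (C := \matrix_(b < p, a < p) dot (e (psubset_fun I a)) (col b V2))) ?mul1r //.
- by apply/rowP => a; rewrite !mxE Vi dotDr dotZr mul1r.
- apply/matrixP => b a; rewrite !mxE; congr dot.
  by have /matrixP E := V1i; apply/colP => l; have := E l b; rewrite !mxE.
- apply/matrixP => b a; rewrite !mxE; congr dot.
  by have /matrixP E := V2i; apply/colP => l; have := E l b; rewrite !mxE.
Qed.

Lemma eta_alternating I : Defs.alternating (eta I).
Proof.
move=> V i j ij Vij; apply: (determinant_alternate ij) => a.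
by rewrite !mxE Vij.
Qed.

Lemma eta_basis (I J : psubset) : eta I (basis_mx (psubset_fun J)) = (I == J)%:R.
Proof.
rewrite /eta; have [->|IJ] := eqVneq I J.
  rewrite (_ : \matrix_(_, _) _ = 1%:M) ?det1 //.
  apply/matrixP => b a; rewrite !mxE col_basis_mx He; congr (nat_of_bool _)%:R.
  by rewrite eq_sym (inj_eq (@psubset_fun_inj J)).
have [b bI] : exists b, psubset_fun J b \notin val I.
  apply/existsP; apply: contraNT IJ; rewrite negb_exists => /forallP H.
  have JI : val J \subset val I.
    apply/fintype.subsetP => i /psubset_fun_codom[b <-].
    by have := H b; rewrite negbK.
  rewrite -val_eqE /= eq_sym eqEcard JI /=.
  by rewrite (eqP (valP I)) (eqP (valP J)).
rewrite (expand_det_row _ b) big1 // => a _.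
rewrite mxE col_basis_mx He; case: eqP => [E|]; last by rewrite mul0r.
by move: bI; rewrite -E psubset_funP.
Qed.

Lemma eta_diag (I : psubset) (B : 'M[R]_n) (eps : 'I_n -> R) V :
  (forall i, B^T *m e i = eps i *: e i) ->
  eta I (B *m V) = (\prod_(i in val I) eps i) * eta I V.
Proof.
move=> Be; rewrite /eta.
have -> : \matrix_(b < p, a < p) dot (e (psubset_fun I a)) (col b (B *m V)) =
    (\matrix_(b < p, a < p) dot (e (psubset_fun I a)) (col b V)) *m
    diag_mx (\row_a eps (psubset_fun I a)).
  apply/matrixP => b a; rewrite mul_mx_diag !mxE.
  have -> : col b (B *m V) = B *m col b V by rewrite !colE mulmxA.
  by rewrite dot_mulmxr Be dotZl mulrC.
rewrite det_mulmx det_diag mulrC; congr (_ * _).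
rewrite [RHS]big_enum_val (reindex (cast_ord (esym (eqP (valP I))))) /=; last first.
  by exists (cast_ord (eqP (valP I))) => a _; rewrite ?cast_ordK ?cast_ordKV.
by apply: eq_bigr => a _; rewrite mxE.
Qed.

End alternating_forms.

(** * Dimension as the trace of an idempotent *)

Section dimension_image.
Context {R : realType}.

(** In the rank factorization [P = C *m D] idempotence cancels to [D *m C = 1%:M], whose size is the
    rank and whose trace is that of [P]. *)
Lemma mxtrace_idempotent N (P : 'M[R]_N) : P *m P = P -> \tr P = (\rank P)%:R.
Proof.
move=> PP.
have E : row_base P *m col_base P = 1%:M.
  have : col_base P *m (row_base P *m col_base P) *m row_base P = col_base P *m 1%:M *m row_base P.
    by rewrite mulmx1 mulmxA mulmx_base -mulmxA mulmx_base PP.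
  move/(row_free_inj (row_base_free P)); exact: row_full_inj (col_base_full P) _ _.
by rewrite -[in LHS](mulmx_base P) mxtrace_mulC E mxtrace1.
Qed.

(** [Psi] identifies [S] with the row space of [P]: a family in [S] is a matrix of rows fixed by
    [P], and independence becomes [row_free]. *)
Lemma dimension_image (V : lmodType R) N (P : 'M[R]_N) (Psi : 'rV[R]_N -> V) (S : set V) :
  (forall c a b, Psi (c *: a + b) = c *: Psi a + Psi b) ->
  (forall a, Psi a = 0 -> a = 0) -> P *m P = P ->
  (forall w, S w <-> exists2 a, a *m P = a & w = Psi a) ->
  dimension S = (\tr P)%:E.
Proof.
move=> PL Pinj PP SP; rewrite mxtrace_idempotent //.
have P0 : Psi 0 = 0 by have := PL (-1) 0 0; rewrite scaler0 addr0 scaleN1r addNr.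
have PS (k : nat) (c : 'I_k -> R) (a : 'I_k -> 'rV[R]_N) :
    Psi (\sum_i c i *: a i) = \sum_i c i *: Psi (a i).
  elim/big_rec2: _ => // i y1 y2 _ E.
  by rewrite PL E.
have rows (k : nat) (c : 'I_k -> R) (A : 'M[R]_(k, N)) :
    \sum_i c i *: row i A = (\row_i c i) *m A.
  by rewrite mulmx_sum_row; apply: eq_bigr => i _; rewrite mxE.
have lin k (A : 'M[R]_(k, N)) : lin_indep (fun i => Psi (row i A)) <-> row_free A.
  split => [li|fA c].
    apply/inj_row_free => v vA; apply/rowP => i; rewrite mxE.
    apply: (li (fun i => v 0 i)); rewrite -PS rows.
    by rewrite (_ : \row_i v 0 i = v) ?vA //; apply/rowP => j; rewrite mxE.
  rewrite -PS rows => /Pinj cA i.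
  have /rowP/(_ i) : \row_i c i = 0 by apply: (row_free_inj fA); rewrite mul0mx.
  by rewrite !mxE.
apply/eqP; rewrite eq_le; apply/andP; split.
  apply: ge_ereal_sup => _ [k [w [Sw wi]] <-].
  rewrite lee_fin ler_nat.
  have ex i : exists a, a *m P = a /\ w i = Psi a.
    by have [a h1 h2] := (SP (w i)).1 (Sw i); exists a.
  pose a i := sval (cid (ex i)).
  have aP i : a i *m P = a i by exact: (svalP (cid (ex i))).1.
  have wa i : w i = Psi (a i) by exact: (svalP (cid (ex i))).2.
  pose A : 'M[R]_(k, N) := \matrix_i a i.
  have rA i : row i A = a i by rewrite rowK.
  have fA : row_free A.
    by apply/lin; rewrite (_ : (fun i => _) = w) //; apply/funext => i; rewrite rA wa.
  have AP : A = A *m P by apply/row_matrixP => i; rewrite row_mul rA aP.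
  by move/eqP: fA => <-; rewrite AP mxrankM_maxr.
apply: ereal_sup_ubound; exists (\rank P) => //.
exists (fun i => Psi (row i (row_base P))); split; last exact/lin/row_base_free.
move=> i; apply/SP; exists (row i (row_base P)) => //.
have /submxP[D ->] : (row_base P <= P)%MS by rewrite eq_row_base.
by rewrite row_mul -mulmxA PP.
Qed.

End dimension_image.

Section shell.
Context {R : realType} {n : nat}.

Definition normsq (k : {ffun 'I_n -> int}) : int := \sum_i k i ^+ 2.

Definition shell (mu : R) : set {ffun 'I_n -> int} := [set k | (normsq k)%:~R = mu].

Lemma finite_shell mu : finite_set (shell mu).
Proof.
(* [|k i| ^ 2 <= mu < N] bounds each coordinate by [N]; the offset in [h] encodes the integers from
   [- N] to [N] as ordinals. *)
pose N := Num.bound `|mu|.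
pose h (f : {ffun 'I_n -> 'I_(2 * N).+1}) : {ffun 'I_n -> int} := [ffun i => (f i)%:Z - N%:Z].
apply: (sub_finite_set _ (finite_image h (@finite_finset _ setT))).
move=> k /= kmu.
have kN i : (`|k i| <= N)%N.
  have h1 : (`|k i| ^ 2)%N%:Z <= normsq k.
    rewrite -mulnn PoszM !abszE -normrM -expr2 ger0_norm ?sqr_ge0 //.
    rewrite /normsq (bigD1 i) //= lerDl.
    by apply: sumr_ge0 => j _; exact: sqr_ge0.
  have h2 : (normsq k)%:~R < N%:R :> R.
    by rewrite kmu (le_lt_trans (ler_norm _)) // archi_boundP.
  have h3 : normsq k < N%:Z by rewrite -(ltr_int R).
  have : (`|k i| ^ 2 < N)%N by rewrite -ltz_nat (le_lt_trans h1).
  by apply: contraTT; rewrite -!ltnNge => h4; nia.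
exists [ffun i => inord (absz (k i + N%:Z)%R)] => //.
apply/ffunP => i; rewrite !ffunE; move: (kN i); move: (k i) => z zN.
rewrite inordK; last by lia.
by rewrite -[LHS](addrK N%:Z) gez0_abs; lia.
Qed.

Definition shellF mu : {fset {ffun 'I_n -> int}} := fset_set (shell mu).

Lemma in_shellF mu k : (k \in shellF mu) = ((normsq k)%:~R == mu).
Proof.
rewrite /shellF in_fset_set; last exact: finite_shell.
by apply/idP/eqP => [/set_mem|h]; last apply: mem_set.
Qed.

End shell.

Section eigenforms.
Context {R : realType} {n p : nat} (e : 'I_n -> 'cV[R]_n).
Hypothesis He : forall i j, dot (e i) (e j) = (i == j)%:R.
Variable mu : R.
Implicit Types (k l : {ffun 'I_n -> int}) (V : 'M[R]_(n, p)).

Lemma dot_normsq k : dot (xi e k) (xi e k) = (normsq k)%:~R.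
Proof. by rewrite dot_xi_xi // /normsq rmorph_sum. Qed.

(* Indices of the torus eigenforms [cas (xi e k) * eta e I]. *)
Definition modes : finType := (@psubset n p * shellF (n := n) mu)%type.

Definition mode_form (t : modes) : @pform R n p :=
  fun x V => cas (xi e (val t.2)) x * eta e t.1 V.

Definition torus_form (a : 'rV[R]_#|modes|) : @pform R n p :=
  fun x V => \sum_i a 0 i * mode_form (enum_val i) x V.

Lemma torus_formE a x V : torus_form a x V = \sum_i a 0 i * mode_form (enum_val i) x V.
Proof. by []. Qed.

Lemma torus_form_linear c a b : torus_form (c *: a + b) = c *: torus_form a + torus_form b.
Proof.
apply/funext => x; apply/funext => V.
transitivity (c * torus_form a x V + torus_form b x V); last by [].
rewrite !torus_formE mulr_sumr -big_split; apply: eq_bigr => i _ /=.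
by rewrite !mxE mulrDl mulrA.
Qed.

Lemma mode_norm (t : modes) : (normsq (val t.2))%:~R = mu.
Proof. by apply/eqP; rewrite -in_shellF; exact: (valP t.2). Qed.

Lemma torus_form_smooth_periodic a : smooth_periodic e (torus_form a).
Proof.
move=> V; split => [|i x].
  apply: smooth_sum => i _; apply: smooth_scale.
  under eq_fun do rewrite /mode_form mulrC.
  by apply: smooth_scale; exact: smooth_cas.
apply: eq_bigr => j _; congr (_ * (_ * _)).
exact: (cper_cas He _).2.
Qed.

Lemma fcoef_torus_form a k V : fcoef e (torus_form a) k V =
  \sum_i a 0 i * ((val (enum_val i).2 == k)%:R * eta e (enum_val i).1 V).
Proof.
rewrite /fcoef; under eq_fun do rewrite torus_formE mulr_suml.
have mE i : (fun x => a 0 i * mode_form (enum_val i) x V * cas (xi e k) x) =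
    fun x => (a 0 i * eta e (enum_val i).1 V) * (cas (xi e (val (enum_val i).2)) x * cas (xi e k) x).
  by apply/funext => x; rewrite /mode_form; ring.
have cc (i : 'I_#|modes|) : cper e (fun x => cas (xi e (val (enum_val i).2)) x * cas (xi e k) x).
  by apply: cperM; exact: cper_cas.
rewrite (mean_sum He) => [|i _]; last by rewrite mE; exact: cperZ.
apply: eq_bigr => i _.
rewrite mE (meanZ He _ (cc i)) (mean_cas_mul He) -mulrA; congr (_ * _).
by rewrite mulrC.
Qed.

Lemma fcoef_torus_form_mode a (i : 'I_#|modes|) :
  fcoef e (torus_form a) (val (enum_val i).2) (basis_mx e (psubset_fun (enum_val i).1)) = a 0 i.
Proof.
rewrite fcoef_torus_form (bigD1 i) //= eqxx mul1r eta_basis // eqxx mulr1.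
rewrite big1 ?addr0 // => j ji; rewrite eta_basis //.
have [E|] := eqVneq (val (enum_val j).2) (val (enum_val i).2); last by rewrite mul0r mulr0.
have [E'|] := eqVneq (enum_val j).1 (enum_val i).1; last by rewrite mulr0 mulr0.
case/eqP: ji; apply: enum_val_inj.
by move: E E'; case: (enum_val j) => I1 k1; case: (enum_val i) => I2 k2 /= /val_inj -> ->.
Qed.

Lemma torus_form_inj a : torus_form a = 0 -> a = 0.
Proof.
move=> a0; apply/rowP => i; rewrite mxE -fcoef_torus_form_mode a0 /fcoef.
under eq_fun do rewrite /= mul0r.
exact: mean_cst.
Qed.

Lemma torus_form_multilinear a x : multilinear (torus_form a x).
Proof.
move=> i c V V1 V2 Vi V1i V2i; rewrite !torus_formE mulr_sumr -big_split.
apply: eq_bigr => j _ /=; rewrite /mode_form.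
by rewrite (@eta_multilinear R n p e (enum_val j).1 i c V V1 V2 Vi V1i V2i); ring.
Qed.

Lemma torus_form_alternating a x : Defs.alternating (torus_form a x).
Proof.
move=> V i j ij Vij; rewrite torus_formE big1 // => t _; rewrite /mode_form.
by rewrite (@eta_alternating R n p e _ V i j ij Vij) !mulr0.
Qed.

Lemma torus_form_is_form a : is_form (torus_form a).
Proof.
split; [exact: torus_form_multilinear|exact: torus_form_alternating|].
by move=> V; exact: (torus_form_smooth_periodic a V).1.
Qed.

(** Checked on Fourier coefficients, where the Laplacian is already diagonal, rather than by
    differentiating the modes twice. *)
Lemma torus_form_laplacian a : laplacian (torus_form a) = (4 * pi ^+ 2 * mu) *: torus_form a.
Proof.
have sp := torus_form_smooth_periodic a.
have lsp := smooth_periodic_laplacian sp.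
apply/funext => x; apply/funext => V.
have cp := smooth_periodic_cper V sp.
suff /(congr1 (@^~ x)) : (fun x => laplacian (torus_form a) x V) =
   (fun x => (4 * pi ^+ 2 * mu) * torus_form a x V) by [].
apply: (cper_ext He); [exact: smooth_periodic_cper|exact: cperZ|] => k.
rewrite -/(fcoef e (laplacian (torus_form a)) k V) fcoef_laplacian //.
under [in RHS]eq_fun do rewrite -mulrA.
rewrite (meanZ He); last by apply: cperM => //; exact: cper_cas.
rewrite -/(fcoef e (torus_form a) k V) fcoef_torus_form !mulr_sumr.
apply: eq_bigr => i _; have [<-|] := eqVneq (val (enum_val i).2) k.
  by rewrite dot_normsq mode_norm.
by rewrite !mul0r !mulr0.
Qed.

(** A coefficient off the shell is killed by the nonzero factor [normsq k - mu]; those on the shell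
    define [a]. By [alternating_eq0] it is enough to compare values on [basis_mx] of subsets. *)
Lemma eigenform_torus_form (w : @pform R n p) : is_form w -> smooth_periodic e w ->
  laplacian w = (4 * pi ^+ 2 * mu) *: w -> exists a, w = torus_form a.
Proof.
move=> [wml wal wsm] wsp wl.
pose a : 'rV[R]_#|modes| := \row_i fcoef e w (val (enum_val i).2) (basis_mx e (psubset_fun (enum_val i).1)).
exists a; apply/funext => x; apply/funext => V; apply/eqP; rewrite -subr_eq0; apply/eqP.
move: V; apply: (alternating_eq0 He).
- move=> i c V V1 V2 Vi V1i V2i.
  rewrite (wml x i c V V1 V2 Vi V1i V2i) (@torus_form_multilinear a x i c V V1 V2 Vi V1i V2i).
  by ring.
- move=> V i j ij Vij.
  by rewrite (wal x V i j ij Vij) (@torus_form_alternating a x V i j ij Vij) subrr.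
move=> J; set V := basis_mx _ _; apply/eqP; rewrite subr_eq0; apply/eqP.
have sp := torus_form_smooth_periodic a.
suff /(congr1 (@^~ x)) : (fun x => w x V) = (fun x => torus_form a x V) by [].
apply: (cper_ext He); [exact: smooth_periodic_cper|exact: smooth_periodic_cper|] => k.
rewrite -/(fcoef e w k V) -/(fcoef e (torus_form a) k V).
have [kmu|kmu] := boolP (k \in shellF mu).
  pose t : modes := (J, FSetSub kmu).
  by have := fcoef_torus_form_mode a (enum_rank t); rewrite enum_rankK mxE enum_rankK /= => ->.
rewrite fcoef_torus_form big1 => [|i _]; last first.
  case: eqP => [E|]; last by rewrite mul0r mulr0.
  by case/negP: kmu; rewrite -E; exact: (valP (enum_val i).2).
have := fcoef_laplacian He k V wsp; rewrite wl dot_normsq.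
have -> : fcoef e ((4 * pi ^+ 2 * mu) *: w) k V = 4 * pi ^+ 2 * mu * fcoef e w k V.
  rewrite /fcoef -(meanZ He).
    by congr mean; apply/funext => y; exact: (esym (mulrA _ _ _)).
  by apply: cperM; [exact: smooth_periodic_cper|exact: cper_cas].
move/eqP; rewrite -subr_eq0 -mulrBl mulf_eq0 => /orP[|/eqP//].
rewrite -mulrBr mulf_eq0 mulf_eq0 pnatr_eq0 /= expf_eq0 /= gt_eqF ?pi_gt0 //=.
by rewrite subr_eq0 eq_sym -in_shellF (negPf kmu).
Qed.

End eigenforms.

(** * Traces of the holonomy action *)

Section pullback.
Context {R : realType} {n p : nat} (G : set (affine R n)) (e : 'I_n -> 'cV[R]_n).
Hypothesis HG : isometry_subgroup G.
Hypothesis HGe : diagonal_basis G e.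
Implicit Types (k l : {ffun 'I_n -> int}) (g h : affine R n).

Let He : forall i j, dot (e i) (e j) = (i == j)%:R.
Proof. by case: HGe. Qed.

Definition flip g (i : 'I_n) : bool := g.1 *m e i != e i.

Lemma diag_act g i : G g -> g.1 *m e i = (-1) ^+ flip g i *: e i.
Proof.
move=> Gg; have [_ _ /(_ g Gg i)] := HGe.
rewrite /flip; case: eqP => [-> _|ne [//|->]]; first by rewrite expr0 scale1r.
by rewrite expr1 scaleN1r.
Qed.

Lemma diag_act_tr g i : G g -> g.1^T *m e i = (-1) ^+ flip g i *: e i.
Proof.
move=> Gg; have [Giso _ _ _] := HG.
have gg : g.1^T *m g.1 = 1%:M by exact: Giso.
have := congr1 (mulmx g.1^T) (diag_act i Gg); rewrite mulmxA gg mul1mx -scalemxAr.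
by move=> {2}->; rewrite scalerA -signr_addb addbb expr0 scale1r.
Qed.

Definition reflect_freq g k : {ffun 'I_n -> int} := [ffun i => (-1) ^+ flip g i * k i].

Lemma xi_reflect g k : G g -> g.1^T *m xi e k = xi e (reflect_freq g k).
Proof.
move=> Gg; rewrite /xi mulmx_sumr; apply: eq_bigr => i _.
rewrite -scalemxAr diag_act_tr // scalerA ffunE rmorphM mulrC rmorph_sign.
by [].
Qed.

Lemma normsq_reflect g k : normsq (reflect_freq g k) = normsq k.
Proof. by apply: eq_bigr => i _; rewrite ffunE exprMn sqrr_sign mul1r. Qed.

Lemma normsqN k : normsq (- k) = normsq k.
Proof. by apply: eq_bigr => i _; rewrite ffunE sqrrN. Qed.

Lemma cas_act g k x : G g -> cas (xi e k) (act g x) =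
  cos (2 * pi * dot (xi e (reflect_freq g k)) g.2) * cas (xi e (reflect_freq g k)) x
  + sin (2 * pi * dot (xi e (reflect_freq g k)) g.2) * cas (xi e (- reflect_freq g k)) x.
Proof.
move=> Gg.
have -> : cas (xi e k) (act g x) = cas (xi e (reflect_freq g k)) (x - - g.2).
  by rewrite /cas /act dot_mulmxr xi_reflect // opprK.
by rewrite cas_shift dotNr mulrN cosN sinN mulNr opprK.
Qed.

Definition pullback g (w : @pform R n p) : @pform R n p :=
  fun x V => w (act g x) (g.1 *m V).

Variable mu : R.

(** Two target frequencies, since a translation turns a mode into a combination of itself and the
    reversed one ([cas_shift]). When they coincide, at frequency 0, the sine is zero. *)
Definition mode_coef g (s t : @modes R n p mu) : R :=
  (s.1 == t.1)%:R * (\prod_(i in val s.1) (-1) ^+ flip g i) *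
  ((val t.2 == reflect_freq g (val s.2))%:R *
     cos (2 * pi * dot (xi e (reflect_freq g (val s.2))) g.2)
   + (val t.2 == - reflect_freq g (val s.2))%:R *
     sin (2 * pi * dot (xi e (reflect_freq g (val s.2))) g.2)).

Definition pull_mx g : 'M[R]_#|@modes R n p mu| :=
  \matrix_(i, j) mode_coef g (enum_val i) (enum_val j).

Lemma sum_shell_delta (F : {ffun 'I_n -> int} -> R) k : k \in shellF mu ->
  \sum_(l : shellF mu) (val l == k)%:R * F (val l) = F k.
Proof.
move=> kS; rewrite (bigD1 (FSetSub kS)) //= eqxx mul1r big1 ?addr0 // => l lk.
have [E|] := eqVneq (val l) k; last by rewrite mul0r.
by case/eqP: lk; apply: val_inj.
Qed.

Lemma shellF_reflect g k : k \in shellF mu -> reflect_freq g k \in shellF mu.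
Proof. by rewrite !in_shellF normsq_reflect. Qed.

Lemma shellFN k : k \in shellF mu -> - k \in shellF mu.
Proof. by rewrite !in_shellF normsqN. Qed.

Lemma pullback_mode g (s : @modes R n p mu) x V : G g ->
  \sum_(t : @modes R n p mu) mode_coef g s t * mode_form e t x V =
  pullback g (mode_form e s) x V.
Proof.
move=> Gg; rewrite /pullback /mode_form cas_act //.
rewrite (@eta_diag R n p e s.1 g.1 (fun i => (-1) ^+ flip g i)); last first.
  by move=> i; exact: diag_act_tr.
rewrite -(pair_bigA _ (fun (I : @psubset n p) (l : shellF (n := n) mu) => mode_coef g s (I, l) * (cas (xi e (val l)) x * eta e I V))) /=.
rewrite (bigD1 s.1) //= [X in _ + X]big1 ?addr0; last first.
  move=> I Is; rewrite big1 // => l _; rewrite /mode_coef /= eq_sym (negPf Is).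
  by rewrite !mul0r.
have kS : reflect_freq g (val s.2) \in shellF mu.
  by apply: shellF_reflect; exact: (valP s.2).
have := sum_shell_delta (fun l => cas (xi e l) x) kS.
have := sum_shell_delta (fun l => cas (xi e l) x) (shellFN kS).
set kk := reflect_freq g (val s.2); set c := cos _; set d := sin _; move=> <- <-.
rewrite /mode_coef /= eqxx mul1r -/kk -/c -/d 2!mulr_sumr -big_split mulr_suml /=.
by apply: eq_bigr => l _; ring.
Qed.

Lemma pullback_torus_form g a : G g ->
  pullback g (torus_form e (mu := mu) a) = torus_form e (a *m pull_mx g).
Proof.
move=> Gg; apply/funext => x; apply/funext => V.
rewrite /pullback !torus_formE.
under [RHS]eq_bigr do rewrite mxE mulr_suml.
rewrite exchange_big; apply: eq_bigr => i _ /=.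
rewrite -[mode_form e _ _ _]/(pullback g (mode_form e (enum_val i)) x V).
rewrite -(pullback_mode _ _ _ Gg) mulr_sumr.
rewrite [RHS](eq_bigr (fun j => a 0 i * (mode_coef g (enum_val i) (enum_val j) *
   mode_form e (enum_val j) x V))); last by move=> j _; rewrite mxE mulrA.
rewrite (reindex (@enum_val (@modes R n p mu) predT)) //=.
by apply: onW_bij; exact: enum_val_bij.
Qed.

(** The elementary symmetric function of degree [p] in the signs: the trace of the rotation part on
    constant [p]-forms. *)
Definition esym_sign g : R := \sum_(I : @psubset n p) \prod_(i in val I) (-1) ^+ flip g i.

Lemma mxtrace_pull_mx g : \tr (pull_mx g) = esym_sign g *
  \sum_(k <- shellF mu) (k == reflect_freq g k)%:R * cos (2 * pi * dot (xi e k) g.2).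
Proof.
rewrite /mxtrace.
transitivity (\sum_(t : @modes R n p mu) mode_coef g t t).
  rewrite [RHS](reindex (@enum_val (@modes R n p mu) predT)) /=; last first.
    by apply: onW_bij; exact: enum_val_bij.
  by apply: eq_bigr => i _; rewrite mxE.
rewrite -(pair_bigA _ (fun (I : @psubset n p) (l : shellF (n := n) mu) => mode_coef g (I, l) (I, l))) /=.
(* The diagonal entries coming from the reversed frequency are odd in [k], and the shell is
   symmetric under negation. *)
pose sn k := (k == - reflect_freq g k)%:R * sin (2 * pi * dot (xi e (reflect_freq g k)) g.2) : R.
have sn0 : \sum_(k <- shellF mu) sn k = 0.
  have : \sum_(k <- shellF mu) sn k = - \sum_(k <- shellF mu) sn k.
    have pN : perm_eq (shellF mu) [seq - k | k <- shellF mu].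
      apply: uniq_perm; first exact: fset_uniq.
        by rewrite map_inj_uniq ?fset_uniq //; exact: oppr_inj.
      move=> k; apply/idP/mapP => [kS|[l lS ->]]; last exact: shellFN.
      by exists (- k); rewrite ?opprK //; exact: shellFN.
    rewrite {1}(perm_big _ pN) /= big_map -sumrN; apply: eq_bigr => k _; rewrite /sn.
    have -> : reflect_freq g (- k) = - reflect_freq g k.
      by apply/ffunP => i; rewrite !ffunE mulrN.
    by rewrite eqr_opp xiN dotNl mulrN sinN mulrN.
  by move/esym/eqP; rewrite eqNr => /eqP.
rewrite /esym_sign mulr_suml; apply: eq_bigr => I _.
rewrite big_seq_fsetE /= in sn0.
rewrite big_seq_fsetE /= -[X in _ * X]addr0 -[X in _ * (_ + X)]sn0 -big_split mulr_sumr /=.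
apply: eq_bigr => l _; rewrite /mode_coef /sn /= eqxx mul1r; congr (_ * (_ + _)).
by have [<-|] := eqVneq (val l) (reflect_freq g (val l)); rewrite ?mul0r.
Qed.

(* [None] for a coordinate reflected by the rotation part, [Some true] for a
   fixed coordinate along which the translation part is a half integer. *)
Definition coord_type g (i : 'I_n) : option bool :=
  if flip g i then None else Some (dot g.2 (e i) - 2^-1 \is a Num.int).

(** Contribution of one coordinate to the trace at frequency [m]: a reflection fixes only [m = 0],
    and a half-integral shift gives [cos (pi * m)]. *)
Definition coord_weight (c : option bool) (m : int) : R :=
  match c with
  | None => (m == 0)%:R
  | Some true => (-1) ^+ `|m|%N
  | Some false => 1
  end.

(** The square of [g] is the translation by [v], which therefore lies in the lattice, and along a
    fixed [e i] its coordinate is twice that of [g.2]. *)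
Lemma half_integral g i : G g -> ~~ flip g i -> exists m : int, 2 * dot g.2 (e i) = m%:~R.
Proof.
move=> Gg fi.
have [Giso _ GM _] := HG; have [_ tG _] := HGe.
pose v := g.1^T *m g.2 + g.2.
have B2 : g.1 *m g.1 = 1%:M.
  apply/matrixP => a b.
  have Bx (x : 'cV[R]_n) : g.1 *m (g.1 *m x) = x.
    rewrite (basis_expand He x) !mulmx_sumr; apply: eq_bigr => j _.
    by rewrite -!scalemxAr !diag_act // -!scalemxAr diag_act // (scalerA ((-1) ^+ _)) -signr_addb addbb scale1r.
  have /(congr1 (fun M : 'cV[R]_n => M a 0)) := Bx (delta_mx b 0).
  rewrite mulmxA -colE !mxE => ->.
  by rewrite eqxx andbT.
have : translations G v.
  by have := GM g g Gg Gg; rewrite /translations /= /translation /isoM B2.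
rewrite tG => -[z vz]; exists (z i).
have : dot (e i) v = (z i)%:~R.
  rewrite vz (_ : \sum_i _ = xi e [ffun i => z i]) ?(dot_xi He) ?ffunE //.
  by apply: eq_bigr => j _; rewrite ffunE.
rewrite /v dotDr dot_mulmxr trmxK diag_act // (negPf fi) expr0 scale1r => <-.
by rewrite dotC; ring.
Qed.

Lemma cos_sin_half (b : R) (m : int) (j : int) : 2 * b = m%:~R ->
  cos (2 * pi * (j%:~R * b)) =
    coord_weight (Some (b - 2^-1 \is a Num.int)) j /\ sin (2 * pi * (j%:~R * b)) = 0.
Proof.
move=> bm.
have cospi (a : nat) : cos (pi * a%:R) = (-1) ^+ a :> R /\ sin (pi * a%:R) = 0 :> R.
  elim: a => [|a [IH1 IH2]]; first by rewrite mulr0 cos0 sin0.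
  by rewrite -natr1 mulrDr mulr1 cosDpi sinDpi IH1 IH2 oppr0 exprS mulN1r.
have cosz (a : int) : cos (pi * a%:~R) = (-1) ^+ `|a|%N :> R /\ sin (pi * a%:~R) = 0 :> R.
  case: a => a; first exact: cospi.
  rewrite NegzE mulrNz mulrN cosN sinN abszN /=.
  by have [-> ->] := cospi a.+1; rewrite oppr0.
have t2 : (2 : R) != 0 by rewrite pnatr_eq0.
have [z [mz|mz]] : exists z : int, m = 2 * z \/ m = 2 * z + 1.
  by exists (m %/ 2)%Z; lia.
- have bz : b = z%:~R by apply: (mulfI t2); rewrite bm mz intrM.
  have -> : 2 * pi * (j%:~R * b) = 0 + 2 * pi * (j * z)%:~R by rewrite bz intrM add0r.
  rewrite cos_periodz sin_periodz cos0 sin0; split=> //.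
  rewrite /coord_weight; case: ifPn => // /intrP[y yE]; exfalso.
  have : (2 * z)%:~R = (2 * y + 1)%:~R :> R.
    by rewrite intrD !intrM -yE -bz; field.
  by move/eqP; rewrite eqr_int => /eqP; lia.
- have bz : b = z%:~R + 2^-1.
    apply: (mulfI t2).
    by rewrite bm mz intrD intrM mulrDr mulfV.
  have -> : 2 * pi * (j%:~R * b) = pi * j%:~R + 2 * pi * (j * z)%:~R.
    by rewrite bz intrM; field.
  rewrite cos_periodz sin_periodz; have [-> ->] := cosz j; split=> //.
  rewrite /coord_weight ifT //; apply/intrP; exists z.
  by rewrite bz addrK.
Qed.

Lemma coord_weight_prod g k : G g ->
  (k == reflect_freq g k)%:R * cos (2 * pi * dot (xi e k) g.2) =
  \prod_i coord_weight (coord_type g i) (k i).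
Proof.
move=> Gg.
have [/eqP E|ne] := boolP (k == reflect_freq g k); last first.
  rewrite mul0r; have [i fi ki] : exists2 i, flip g i & k i != 0.
    apply: contrapT => H; case/eqP: ne; apply/ffunP => i; rewrite ffunE.
    have [fi|fi] := boolP (flip g i); last by rewrite expr0 mul1r.
    have [->|ki] := eqVneq (k i) 0; first by rewrite mulr0.
    by case: H; exists i.
  by rewrite (bigD1 i) //= /coord_type fi /= (negPf ki) mul0r.
rewrite mul1r.
have k0 i : flip g i -> k i = 0.
  move=> fi; have /ffunP/(_ i) := E; rewrite ffunE fi /= expr1 mulN1r.
  by move/esym/eqP; rewrite eqNr => /eqP.
rewrite /xi dot_suml mulr_sumr.
have cs i : cos (2 * pi * dot ((k i)%:~R *: e i) g.2) = coord_weight (coord_type g i) (k i) /\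
    sin (2 * pi * dot ((k i)%:~R *: e i) g.2) = 0.
  rewrite dotZl dotC /coord_type; have [fi|fi] := boolP (flip g i).
    by rewrite k0 // mul0r mulr0 cos0 sin0.
  have [m mE] := half_integral Gg fi.
  exact: (cos_sin_half (k i) mE).
(* All sines vanish, so the addition formula makes the cosine multiplicative; the vanishing of the
   sine is carried through the induction. *)
have : cos (\sum_i 2 * pi * dot ((k i)%:~R *: e i) g.2) = \prod_i coord_weight (coord_type g i) (k i) /\
    sin (\sum_i 2 * pi * dot ((k i)%:~R *: e i) g.2) = 0.
  elim/big_rec2: _ => [|i y1 y2 _ [c s]]; first by rewrite cos0 sin0.
  by rewrite cosD sinD c s; have [-> ->] := cs i; rewrite !mulr0 mul0r subr0 addr0.
by case.
Qed.

Definition weighted_count (tau : 'I_n -> option bool) : R :=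
  \sum_(k <- shellF mu) \prod_i coord_weight (tau i) (k i).

Lemma mxtrace_pull_mx_count g : G g ->
  \tr (pull_mx g) = esym_sign g * weighted_count (coord_type g).
Proof.
move=> Gg; rewrite mxtrace_pull_mx; congr (_ * _); apply: eq_bigr => k _.
exact: coord_weight_prod.
Qed.

End pullback.

(** * Averaging over the holonomy group *)

Section holonomy_representatives.
Context {R : realType} {n : nat} (G : set (affine R n)) (e : 'I_n -> 'cV[R]_n) (r : nat).
Hypothesis HG : isometry_subgroup G.
Hypothesis HGe : diagonal_basis G e.
Variable phi : set (affine R n) -> 'rV['F_2]_r.
Hypothesis phi_bij : set_bij (holonomy G) [set: 'rV['F_2]_r] phi.
Hypothesis phiM : forall g h, G g -> G h ->
  phi (Defs.coset G (isoM g h)) = phi (Defs.coset G g) + phi (Defs.coset G h).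

Let He : forall i j, dot (e i) (e j) = (i == j)%:R.
Proof. by case: HGe. Qed.

Lemma ex_rep u : exists g, G g /\ phi (Defs.coset G g) = u.
Proof.
have [_ _ /(_ u I)[C [g Gg <-] <-]] := phi_bij.
by exists g.
Qed.

Definition rep u : affine R n := sval (cid (ex_rep u)).

Lemma rep_in u : G (rep u). Proof. exact: (svalP (cid (ex_rep u))).1. Qed.

Lemma phi_rep u : phi (Defs.coset G (rep u)) = u.
Proof. exact: (svalP (cid (ex_rep u))).2. Qed.

Lemma coset_self g : Defs.coset G g g.
Proof.
have [_ G1 _ _] := HG; exists 0; first exact: G1.
by case: g => B b; rewrite /isoM /= mul1mx mulmx0 add0r.
Qed.

Lemma coset_inj g h : G g -> G h -> phi (Defs.coset G g) = phi (Defs.coset G h) ->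
  Defs.coset G g = Defs.coset G h.
Proof.
by move=> Gg Gh; have [_ inj _] := phi_bij; apply: inj; rewrite inE; [exists g|exists h].
Qed.

Lemma rep_coset g : G g -> exists2 v, translations G v &
  g = isoM (translation v) (rep (phi (Defs.coset G g))).
Proof.
move=> Gg; have := coset_self g.
rewrite (@coset_inj g (rep (phi (Defs.coset G g)))) ?phi_rep //; last exact: rep_in.
by case=> v Gv E; exists v.
Qed.

Lemma translation_basis i : G (translation (e i)).
Proof.
have [_ tG _] := HGe; suff : translations G (e i) by [].
rewrite tG; exists (fun j => (j == i)%:Z).
rewrite (bigD1 i) //= eqxx scale1r big1 ?addr0 // => j /negPf ->.
by rewrite scale0r.
Qed.

Section multiplicity.
Variables (p : nat) (mu : R).
Let T g := pull_mx (p := p) e mu g.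
Let Psi := torus_form (p := p) e (mu := mu).

Lemma pullback_isoM g h (w : @pform R n p) : G h ->
  pullback (isoM g h) w = pullback h (pullback g w).
Proof.
move=> Gh; have [Giso _ _ _] := HG.
apply/funext => x; apply/funext => V; rewrite /pullback actM; last exact: Giso.
by rewrite /= mulmxA.
Qed.

Lemma pullback_translation v (w : @pform R n p) : smooth_periodic e w ->
  translations G v -> pullback (translation v) w = w.
Proof.
move=> wsp; have [_ tG _] := HGe; rewrite tG => -[z ->].
apply/funext => x; apply/funext => V; rewrite /pullback /act /= !mul1mx.
rewrite -[RHS](cper_lat [ffun i => z i] x (smooth_periodic_cper V wsp)).
by congr (w (_ + _) V); apply: eq_bigr => i _; rewrite ffunE.
Qed.

Let pull_Psi g a : G g -> pullback g (Psi a) = Psi (a *m T g).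
Proof. exact: (pullback_torus_form HG HGe). Qed.

Let PsiB a c : Psi (a - c) = Psi a - Psi c.
Proof.
have := torus_form_linear e (mu := mu) (-1) c a.
by rewrite !scaleN1r addrC [RHS]addrC.
Qed.

(** Lattice translations act trivially on torus forms, so pullbacks depend only on cosets;
    injectivity of [Psi] turns the identity between pullbacks into one between matrices. *)
Lemma pull_mx_rep u h : G h -> T (rep u) *m T h = T (rep (u + phi (Defs.coset G h))).
Proof.
move=> Gh; have [_ _ GM _] := HG.
have Guh : G (isoM (rep u) h) by apply: GM => //; exact: rep_in.
have [v Gv E] := rep_coset Guh; rewrite phiM ?phi_rep in E => //; last exact: rep_in.
apply/row_matrixP => i; rewrite !rowE; set b := delta_mx 0 i.
apply/eqP; rewrite -subr_eq0; apply/eqP; apply: (torus_form_inj He (mu := mu)).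
rewrite -/Psi PsiB; apply/eqP; rewrite subr_eq0; apply/eqP.
rewrite mulmxA -!pull_Psi //; [|exact: rep_in|exact: rep_in].
rewrite -pullback_isoM // E pullback_isoM; last exact: rep_in.
by rewrite pullback_translation //; exact: torus_form_smooth_periodic.
Qed.

Definition avg_mx : 'M[R]_#|@modes R n p mu| := 2^-1 ^+ r *: \sum_u T (rep u).

Lemma avg_mx_pull h : G h -> avg_mx *m T h = avg_mx.
Proof.
move=> Gh; rewrite /avg_mx -scalemxAl mulmx_suml; congr (_ *: _).
rewrite [RHS](reindex_inj (addIr (phi (Defs.coset G h)))) /=.
by apply: eq_bigr => u _; rewrite pull_mx_rep.
Qed.

Lemma card_F2_row : #|'rV['F_2]_r| = (2 ^ r)%N.
Proof. by rewrite card_mx card_Fp // mul1n. Qed.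

Lemma half_pow_sum (V : lmodType R) (a : V) : 2^-1 ^+ r *: \sum_(u : 'rV['F_2]_r) a = a.
Proof.
rewrite sumr_const card_F2_row -[a *+ _]scaler_nat scalerA natrX exprVn mulVf ?scale1r //.
Qed.

Lemma avg_mx_idem : avg_mx *m avg_mx = avg_mx.
Proof.
rewrite {2}/avg_mx -scalemxAr mulmx_sumr.
rewrite (eq_bigr (fun=> avg_mx)); first exact: half_pow_sum.
by move=> u _; apply: avg_mx_pull; exact: rep_in.
Qed.

Lemma eigenformsP (w : @pform R n p) : eigenforms G (4 * pi ^+ 2 * mu) w <->
  exists2 a, a *m avg_mx = a & w = Psi a.
Proof.
split=> [[wf winv wl]|[a aP ->]]; last first.
  split; [exact: torus_form_is_form| |exact: torus_form_laplacian].
  move=> g Gg x V.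
  have := pull_Psi a Gg => /(congr1 (fun f => f x V)); rewrite /pullback => ->.
  by rewrite -{1}aP -mulmxA avg_mx_pull // aP.
have wsp : smooth_periodic e w.
  move=> V; have [_ _ ws] := wf; split; first exact: ws.
  move=> i x; have := winv _ (translation_basis i) x V.
  by rewrite /act /= !mul1mx.
have [a wa] := eigenform_torus_form He wf wsp wl.
exists a => //; apply/eqP; rewrite -subr_eq0; apply/eqP.
have aT u : a *m T (rep u) = a.
  apply/eqP; rewrite -subr_eq0; apply/eqP; apply: (torus_form_inj He (mu := mu)).
  rewrite -/Psi PsiB; apply/eqP; rewrite subr_eq0; apply/eqP.
  have waP : w = Psi a by exact: wa.
  rewrite -pull_Psi -?waP; last exact: rep_in.
  by apply/funext => x; apply/funext => V; apply: winv; exact: rep_in.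
rewrite /avg_mx -scalemxAr mulmx_sumr (eq_bigr (fun=> a)) => [|u _]; last exact: aT.
by rewrite half_pow_sum subrr.
Qed.

Lemma multiplicity_formula : multiplicity G p mu =
  (2^-1 ^+ r * \sum_u @esym_sign R n p e (rep u) * weighted_count mu (coord_type e (rep u)))%:E.
Proof.
rewrite /multiplicity (dimension_image (P := avg_mx) (Psi := Psi)) //.
- congr EFin; rewrite /avg_mx mxtraceZ raddf_sum; congr (_ * _).
  by apply: eq_bigr => u _; apply: (mxtrace_pull_mx_count HG HGe); exact: rep_in.
- exact: torus_form_linear.
- by move=> a; exact: torus_form_inj.
- exact: avg_mx_idem.
- exact: eigenformsP.
Qed.

End multiplicity.

End holonomy_representatives.

(** * Krawtchouk polynomials and Sunada numbers *)

Section krawtchouk.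
Context {R : realType}.

Lemma binom_poly_nat (t m : nat) : (binom_poly R t).[m%:R] = 'C(m, t)%:R.
Proof.
rewrite /binom_poly hornerZ horner_prod.
have -> : \prod_(i < t) ('X - i%:R%:P).[m%:R] = (m ^_ t)%:R :> R.
  elim: t => [|t IH]; first by rewrite big_ord0 ffactn0.
  rewrite big_ord_recr /= IH ffactnSr natrM !hornerE.
  have [tm|mt] := leqP t m; first by rewrite natrB.
  by rewrite ffact_small // !mul0r.
by rewrite -bin_ffact natrM mulrCA mulVf ?mulr1 // pnatr_eq0 -lt0n fact_gt0.
Qed.

Lemma krawtchouk_nat (n p m : nat) : (m <= n)%N -> (krawtchouk R n p).[m%:R] =
  \sum_(t < p.+1) (-1) ^+ t * 'C(m, t)%:R * 'C(n - m, p - t)%:R.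
Proof.
move=> mn; rewrite /krawtchouk horner_sum; apply: eq_bigr => t _.
rewrite !hornerM binom_poly_nat horner_exp hornerN hornerC horner_comp.
have -> : (n%:R%:P - 'X : {poly R}).[m%:R] = (n - m)%:R by rewrite !hornerE natrB.
by rewrite binom_poly_nat.
Qed.

Lemma coef_1DcXn (c : R) (m t : nat) : ((1 + c *: 'X) ^+ m)`_t = c ^+ t * 'C(m, t)%:R.
Proof.
have -> : (1 + c *: 'X) ^+ m = \poly_(i < m.+1) (c ^+ i * 'C(m, i)%:R).
  rewrite exprDn poly_def; apply: eq_bigr => i _.
  by rewrite expr1n mul1r exprZn -scaler_nat scalerA mulrC.
rewrite coef_poly; case: ltnP => // mt.
by rewrite bin_small ?mulr0.
Qed.

Lemma sum_psubset (n p : nat) (F : {set 'I_n} -> R) :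
  \sum_(I : @psubset n p) F (val I) = \sum_(I : {set 'I_n} | #|I| == p) F I.
Proof.
rewrite [RHS](reindex_omap (val : @psubset n p -> _) insub) /=; last first.
  by move=> I pI; rewrite insubT.
by apply: eq_bigl => I; rewrite (valP I) valK eqxx.
Qed.

(* Both sides are the coefficient of [X ^ p] in [\prod_i (1 +- X)]. *)
Lemma sum_psubset_sign (n p : nat) (b : 'I_n -> bool) :
  \sum_(I : @psubset n p) \prod_(i in val I) ((-1) ^+ b i : R) =
  (krawtchouk R n p).[(n - #|[pred i | ~~ b i]|)%:R].
Proof.
have cb : (#|[pred i | ~~ b i]| + #|[pred i | b i]| = n)%N.
  by rewrite addnC -[RHS](card_ord n) -(cardC [pred i | b i]).
rewrite (sum_psubset p (fun I : {set 'I_n} => \prod_(i in I) (-1) ^+ b i)).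
have nE : (n - #|[pred i | ~~ b i]|)%N = #|[pred i | b i]| by move: cb => /(congr1 (subn^~ #|[pred i | ~~ b i]|)) <-; rewrite addKn.
rewrite nE krawtchouk_nat; last by rewrite -[X in (_ <= X)%N](card_ord n) max_card.
have nE' : (n - #|[pred i | b i]|)%N = #|[pred i | ~~ b i]| by move: cb => /(congr1 (subn^~ #|[pred i | b i]|)) <-; rewrite addnK.
rewrite nE'.
pose Q : {poly R} := \prod_i (((-1) ^+ b i)%:P * 'X + 1).
transitivity Q`_p.
  rewrite /Q bigA_distr coef_sum [RHS](bigID (fun I : {set 'I_n} => #|I| == p)) /=.
  rewrite [X in _ + X]big1 ?addr0 => [|J Jp]; last first.
    rewrite -big_mkcond /= big_split /= prodr_const -rmorph_prod coefCM coefXn.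
    by rewrite eq_sym (negPf Jp) mulr0.
  apply: eq_bigr => J /eqP Jp.
  rewrite -big_mkcond /= big_split /= prodr_const -rmorph_prod coefCM coefXn.
  by rewrite Jp eqxx mulr1.
have -> : Q = (1 + -1 *: 'X) ^+ #|[pred i | b i]| * (1 + 1 *: 'X) ^+ #|[pred i | ~~ b i]|.
  rewrite /Q (bigID b) /= -!prodr_const; congr (_ * _).
    by apply: eq_bigr => i ->; rewrite expr1 mul_polyC addrC.
  by apply: eq_bigr => i /negPf ->; rewrite expr0 mul_polyC addrC.
rewrite coefM; apply: eq_bigr => t _.
by rewrite !coef_1DcXn expr1n mul1r.
Qed.

Lemma krawtchouk0 (n : nat) (x : R) : (krawtchouk R n 0).[x] = 1.
Proof.
have b0 : binom_poly R 0 = 1 by rewrite /binom_poly big_ord0 fact0 invr1 scale1r.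
by rewrite /krawtchouk big_ord1 subnn b0 comp_polyC !mul1r hornerC.
Qed.

End krawtchouk.

(** * Reduction to a standard arrangement of the coordinates *)

Section standard_type.
Context {R : realType} {n : nat}.

Definition std_type (d t : nat) (i : 'I_n) : option bool :=
  if (i < t)%N then Some true else if (i < d)%N then Some false else None.

Lemma card_ord_ltn (t : nat) : (t <= n)%N -> #|[pred i : 'I_n | (i < t)%N]| = t.
Proof.
move=> tn; rewrite -sum1_card -(big_ord_widen n (fun=> 1%N) tn).
by rewrite sum_nat_const card_ord muln1.
Qed.

(** Tuples with equal counts of each value are permutations of each other; the counts of
    [Some false] and [None] follow from [d], [t] and [n]. *)
Lemma exists_std_perm (tau : 'I_n -> option bool) :
  exists s : {perm 'I_n}, forall i, tau i =
    std_type #|[pred i | tau i != None]| #|[pred i | tau i == Some true]| (s i).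
Proof.
set d := #|_|; set t := #|_|.
have dn : (d <= n)%N by rewrite -[X in (_ <= X)%N](card_ord n) max_card.
have td : (t <= d)%N.
  by apply: subset_leq_card; apply/fintype.subsetP => i; rewrite !inE => /eqP ->.
have cE (f : 'I_n -> option bool) x :
    count_mem x [tuple f i | i < n] = #|[pred i | f i == x]|.
  by rewrite count_map cardE [in RHS]/enum_mem size_filter /= -enumT; apply: eq_count => i.
have cd (f : 'I_n -> option bool) : (#|[pred i | f i != None]| =
    #|[pred i | f i == Some true]| + #|[pred i | f i == Some false]|)%N.
  rewrite -cardUI [X in (_ + X)%N]eq_card0 ?addn0; last first.
    by move=> i; rewrite !inE; case: (f i) => [[]|].
  by apply: eq_card => i; rewrite !inE; case: (f i) => [[]|].
have cn (f : 'I_n -> option bool) :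
    (#|[pred i | f i == None]| + #|[pred i | f i != None]|)%N = n.
  by rewrite -[RHS](card_ord n) -(cardC [pred i | f i == None]).
have st : #|[pred i : 'I_n | std_type d t i == Some true]| = t.
  rewrite -[RHS](card_ord_ltn (leq_trans td dn)); apply: eq_card => i.
  by rewrite !inE /std_type; case: ifP => // _; case: ifP.
have sd : #|[pred i : 'I_n | std_type d t i != None]| = d.
  rewrite -[RHS](card_ord_ltn dn); apply: eq_card => i.
  by rewrite !inE /std_type; case: ifP => [it|_]; [rewrite (leq_trans it td)|case: ifP].
have /tuple_permP[s sE] : perm_eq [tuple tau i | i < n] [tuple std_type d t i | i < n].
  apply/allP => x _; apply/eqP; rewrite [LHS]cE [RHS]cE.
  case: x => [[]|]; first by rewrite st.
    have b : (t + #|[pred i : 'I_n | std_type d t i == Some false]|)%N = d.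
      by rewrite -[RHS]sd cd st.
    by apply: (@addnI t); rewrite [RHS]b; apply/esym; exact: cd.
  have b : (#|[pred i : 'I_n | std_type d t i == None]| + d)%N = n.
    by rewrite -[RHS](cn (std_type d t)) sd.
  by apply: (@addIn d); rewrite [RHS]b; exact: cn.
exists s => i; have := congr1 (fun u => nth None u i) sE.
by rewrite -!tnth_nth !tnth_mktuple.
Qed.

(** A permutation of the coordinates maps the shell to itself, so only the number of coordinates of
    each type matters. *)
Lemma weighted_count_std (mu : R) (tau : 'I_n -> option bool) :
  weighted_count mu tau = weighted_count mu
    (std_type #|[pred i | tau i != None]| #|[pred i | tau i == Some true]|).
Proof.
have [s sE] := exists_std_perm tau; set sd := std_type _ _.
pose h (k : {ffun 'I_n -> int}) := [ffun i => k (s i)].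
have hinj : injective h.
  move=> k l /ffunP kl; apply/ffunP => i.
  by have := kl ((s^-1)%g i); rewrite !ffunE permKV.
have hnorm k : normsq (h k) = normsq k.
  rewrite /normsq [RHS](reindex_inj (@perm_inj _ s)).
  by apply: eq_bigr => i _; rewrite ffunE.
have pS : perm_eq (shellF mu) [seq h k | k <- shellF (n := n) mu].
  apply: uniq_perm; first exact: fset_uniq.
    by rewrite map_inj_uniq ?fset_uniq.
  move=> k; apply/idP/mapP => [kS|[l lS ->]]; last first.
    by rewrite in_shellF hnorm -in_shellF.
  have kE : h [ffun i => k ((s^-1)%g i)] = k by apply/ffunP => i; rewrite !ffunE permK.
  by exists [ffun i => k ((s^-1)%g i)]; rewrite // in_shellF -hnorm kE -in_shellF.
rewrite /weighted_count (perm_big _ pS) /= big_map; apply: eq_bigr => k _.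
rewrite [RHS](reindex_inj (@perm_inj _ s)).
by apply: eq_bigr => i _; rewrite ffunE sE.
Qed.

End standard_type.

Section sunada_numbers.
Context {R : realType} {n : nat} (G : set (affine R n)) (e : 'I_n -> 'cV[R]_n).
Hypothesis HG : isometry_subgroup G.
Hypothesis HGe : diagonal_basis G e.

Let He : forall i j, dot (e i) (e j) = (i == j)%:R.
Proof. by case: HGe. Qed.

Lemma mxtrace_basis (P : 'M[R]_n) : \tr P = \sum_i dot (e i) (P *m e i).
Proof.
transitivity (\sum_i \sum_j e j i 0 * (P *m e j) i 0).
  apply: eq_bigr => i _; have := basis_expand He (delta_mx i 0).
  move/(congr1 (fun v => (P *m v) i 0)); rewrite -colE mxE => ->.
  rewrite mulmx_sumr summxE; apply: eq_bigr => j _.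
  by rewrite -scalemxAr mxE dotC dot_deltal.
by rewrite exchange_big; apply: eq_bigr => j _; rewrite dotE.
Qed.

(* [(1 - B) / 2] is the projection onto the reflected coordinates. *)
Lemma fix_dim_flip g : G g -> fix_dim g = #|[pred i | ~~ flip e g i]|.
Proof.
move=> Gg; pose P := 2^-1 *: (1%:M - g.1).
have Pe i : P *m e i = (flip e g i)%:R *: e i.
  rewrite /P -scalemxAl mulmxBl mul1mx (diag_act HGe) // -{1}[e i]scale1r -scalerBl scalerA.
  congr (_ *: _); case: (flip e g i); first by rewrite /= expr1 opprK mulVf.
  by rewrite expr0 subrr mulr0.
have PP : P *m P = P.
  apply/trmx_inj/row_matrixP => a.
  have PPx (x : 'cV[R]_n) : P *m (P *m x) = P *m x.
    rewrite (basis_expand He x) !mulmx_sumr; apply: eq_bigr => j _.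
    rewrite -!scalemxAr !Pe -!scalemxAr Pe; congr (_ *: _); rewrite scalerA -natrM.
    by case: (flip e g j).
  by rewrite -!tr_col !colE -mulmxA PPx.
have rP : \rank (g.1 - 1%:M) = \rank P.
  by rewrite /P mxrank_scale_nz ?invr_eq0 ?pnatr_eq0 // -opprB mxrank_opp.
have := mxtrace_idempotent PP; rewrite mxtrace_basis.
have -> : \sum_i dot (e i) (P *m e i) = #|[pred i | flip e g i]|%:R.
  under eq_bigr do rewrite Pe dotZr He eqxx mulr1.
  by rewrite -sum1_card natr_sum [RHS]big_mkcond; apply: eq_bigr => i _; rewrite inE; case: ifP.
move/eqP; rewrite eqr_nat => /eqP E.
rewrite /fix_dim mxrank_ker mxrank_tr rP -E.
have := cardC [pred i | flip e g i]; rewrite card_ord => {1}<-.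
by rewrite addKn; apply: eq_card.
Qed.

Lemma half_count_type g : half_count e g = #|[pred i | coord_type e g i == Some true]|.
Proof.
apply: eq_card => i; rewrite !inE /coord_type /flip.
by case: eqP => //= _; case: (_ \is a _).
Qed.

Lemma fix_count_type g : #|[pred i | ~~ flip e g i]| = #|[pred i | coord_type e g i != None]|.
Proof. by apply: eq_card => i; rewrite !inE /coord_type; case: ifP. Qed.

Lemma half_count_le g : G g -> (half_count e g <= fix_dim g)%N.
Proof.
move=> Gg; rewrite fix_dim_flip // half_count_type fix_count_type.
by apply: subset_leq_card; apply/fintype.subsetP => i; rewrite !inE => /eqP ->.
Qed.

Lemma fix_dim_le (g : affine R n) : (fix_dim g <= n)%N.
Proof. exact: rank_leq_row. Qed.

(** Within a coset the rotation part is constant and the translation part changes by integers along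
    the fixed axes. *)
Lemma coset_invariants g h : G h -> Defs.coset G h g ->
  fix_dim g = fix_dim h /\ half_count e g = half_count e h.
Proof.
move=> Gh [v Gv <-]; have [_ tG _] := HGe.
split; first by rewrite /fix_dim /isoM /= mul1mx.
apply: eq_card => i; rewrite !inE /isoM /= mul1mx; case: eqP => //= hi.
rewrite dotDl dotC dot_mulmxr trmxK hi.
have : dot (e i) v \is a Num.int.
  move: Gv; rewrite tG => -[z ->].
  rewrite dot_sumr rpred_sum // => j _.
  by rewrite dotZr He rpredM ?intr_int // -[_%:R]/((_)%:R) rpred_nat.
by move=> ez; rewrite -addrA; apply: rpredDl.
Qed.

Variables (r : nat) (phi : set (affine R n) -> 'rV['F_2]_r).
Hypothesis phi_bij : set_bij (holonomy G) [set: 'rV['F_2]_r] phi.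
Local Notation rep := (rep phi_bij).

Lemma sunada_rep d t : sunada G e d t =
  #|[pred u | (fix_dim (rep u) == d) && (half_count e (rep u) == t)]|.
Proof.
rewrite /sunada.
have -> : [set C | holonomy G C /\ exists2 g, C g & fix_dim g = d /\ half_count e g = t] =
    [set` [fset (Defs.coset G (rep u) : set (affine R n)) | u in
       [pred u | (fix_dim (rep u) == d) && (half_count e (rep u) == t)]]%fset].
  apply/seteqP; split => [C [[h Gh <-] [g hg [gd gt]]]|C] /=.
    have E : Defs.coset G (rep (phi (Defs.coset G h))) = Defs.coset G h.
      by apply: (coset_inj phi_bij) => //; [exact: rep_in|exact: phi_rep].
    apply/imfsetP; exists (phi (Defs.coset G h)); last by rewrite E.
    have := hg; rewrite -E => /coset_invariants[|fd ft]; first exact: rep_in.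
    rewrite phi_rep; apply/andP; split; apply/eqP; first by rewrite -gd fd.
    by rewrite -gt ft.
  move=> /imfsetP[u /= /andP[/eqP ud /eqP ut] ->].
  split; first by exists (rep u) => //; exact: rep_in.
  by exists (rep u) => //; exact: coset_self.
rewrite set_fsetK card_in_imfset /=; first by rewrite cardE.
move=> u v _ _ E.
by rewrite -(phi_rep phi_bij u) E phi_rep.
Qed.

Lemma sunada_gt d t : (d < t)%N -> sunada G e d t = 0%N.
Proof.
move=> dt; rewrite sunada_rep; apply: eq_card0 => u; rewrite !inE.
apply/negP => /andP[/eqP ud /eqP ut].
by have := half_count_le (rep_in phi_bij u); rewrite ud ut leqNgt dt.
Qed.

Lemma sum_rep_sunada (F : nat -> nat -> R) :
  \sum_u F (fix_dim (rep u)) (half_count e (rep u)) =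
  \sum_(d < n.+1) \sum_(t < n.+1) (sunada G e d t)%:R * F d t.
Proof.
rewrite pair_bigA /=.
pose dt u : 'I_n.+1 * 'I_n.+1 := (inord (fix_dim (rep u)), inord (half_count e (rep u))).
have dn u : (fix_dim (rep u) < n.+1)%N by rewrite ltnS fix_dim_le.
have tn u : (half_count e (rep u) < n.+1)%N.
  by rewrite ltnS (leq_trans (half_count_le (rep_in phi_bij u))) ?fix_dim_le.
rewrite (partition_big dt predT) //=; apply: eq_bigr => -[d t] _ /=.
rewrite (eq_bigr (fun=> F d t)) => [|u /eqP[<- <-]]; last first.
  by rewrite !inordK.
rewrite sumr_const mulr_natl sunada_rep; congr (_ *+ _); apply: eq_card => u.
by rewrite inE unfold_in /= -!val_eqE /= !inordK.
Qed.

Hypothesis phiM : forall g h, G g -> G h ->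
  phi (Defs.coset G (isoM g h)) = phi (Defs.coset G g) + phi (Defs.coset G h).

Lemma multiplicity_sunada (p : nat) (mu : R) : multiplicity G p mu =
  (2^-1 ^+ r * \sum_(d < n.+1) \sum_(t < n.+1) (sunada G e d t)%:R *
    ((krawtchouk R n p).[(n - d)%:R] * weighted_count mu (@std_type n d t)))%:E.
Proof.
rewrite (multiplicity_formula HG HGe phi_bij phiM) -(sum_rep_sunada (fun d t => (krawtchouk R n p).[(n - d)%:R] * weighted_count mu (@std_type n d t))).
congr (_ * _)%:E; apply: eq_bigr => u _.
rewrite weighted_count_std /esym_sign sum_psubset_sign fix_dim_flip ?half_count_type; last exact: rep_in.
by rewrite -fix_count_type.
Qed.

End sunada_numbers.

(** * Heat trace *)

(** The [f k] are signed, whereas extended sums are regrouped for nonnegative terms. Adding the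
    shell sums of [|f| - f] leads to nonnegative families, which are regrouped along the norm; the
    finite surplus is removed at the end. *)
Lemma esum_shell (R : realType) (n : nat) (f : {ffun 'I_n -> int} -> R) :
  asum f -> (forall mu : R, 0 <= \sum_(k <- shellF mu) f k) ->
  (\esum_(mu in [set mu : R | (0 <= mu)%R]) (\sum_(k <- shellF mu) f k)%:E = (rsum f)%:E)%E.
Proof.
move=> fs f0.
have ns := asum_norm fs.
pose N := [set mu : R | 0 <= mu].
have normsq_ge0 (k : {ffun 'I_n -> int}) : 0 <= (normsq k)%:~R :> R.
  by rewrite ler0z sumr_ge0 // => i _; exact: sqr_ge0.
have nn (a : {ffun 'I_n -> int} -> R) : (forall k, 0 <= a k) -> asum a ->
    (\esum_(mu in N) (\sum_(k <- shellF mu) a k)%:E = (rsum a)%:E)%E.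
  move=> a0 as_; rewrite rsum_esum //.
  transitivity (\esum_(mu in N) \esum_(k in @shell R n mu) (a k)%:E)%E.
    apply: eq_esum => mu _; rewrite esum_fset; last by move=> k _; rewrite lee_fin.
      rewrite fsbig_finite; last exact: finite_shell.
      by rewrite -sumEFin.
    exact: finite_shell.
  rewrite esum_esum; last by move=> mu k _ _; rewrite lee_fin.
  apply: (reindex_esum setT _ (fun k => ((normsq k)%:~R : R, k))).
  split => [k _|k l _ _ [] //|[mu k] [/= _ kmu]]; first by split; [exact: normsq_ge0|].
  by exists k => //; rewrite kmu.
have b0 k : 0 <= `|f k| - f k by rewrite subr_ge0 ler_norm.
have bs := asumB ns fs.
have : (\esum_(mu in N) (\sum_(k <- shellF mu) f k)%:E + (rsum (fun k => `|f k| - f k))%:E =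
    (rsum (fun k => `|f k|))%:E)%E.
  rewrite -!nn // -esumD; first last.
  - by move=> mu _; rewrite lee_fin sumr_ge0.
  - by move=> mu _; rewrite lee_fin.
  apply: eq_esum => mu _; rewrite -EFinD -big_split; congr EFin.
  by apply: eq_bigr => k _ /=; rewrite addrC subrK.
rewrite rsumB //; move: (\esum_(_ in _) _)%E => x.
case: x => [x| |] // E; congr EFin.
have := EFin_inj (E : (x + _)%:E = _); move: (rsum _) (rsum f) => u v; lra.
Qed.

Lemma rsum_prod (R : realType) (n : nat) (F : 'I_n -> int -> R) :
  (forall i, asum (F i)) ->
  asum (fun k : {ffun 'I_n -> int} => \prod_i F i (k i)) /\
  rsum (fun k : {ffun 'I_n -> int} => \prod_i F i (k i)) = \prod_i rsum (F i).
Proof.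
elim: n F => [|n IH] F Fs.
  have [s ->] : asum (fun k : {ffun 'I_0 -> int} => \prod_i F i (k i)) /\
      rsum (fun k : {ffun 'I_0 -> int} => \prod_i F i (k i)) =
      \sum_(k <- [fset (0 : {ffun 'I_0 -> int})]%fset) \prod_i F i (k i).
    apply: rsum_finite => k; rewrite inE => /eqP[].
    by apply/ffunP => -[].
  by split => //; rewrite big_seq_fset1 !big_ord0.
pose h (mk : int * {ffun 'I_n -> int}) : {ffun 'I_n.+1 -> int} :=
  [ffun i => oapp mk.2 mk.1 (unlift ord0 i)].
pose h' (k : {ffun 'I_n.+1 -> int}) : int * {ffun 'I_n -> int} :=
  (k ord0, [ffun i => k (lift ord0 i)]).
have hK : cancel h h'.
  move=> [m k]; rewrite /h /h' ffunE unlift_none /=; congr pair.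
  by apply/ffunP => i; rewrite !ffunE liftK.
have hK' : cancel h' h.
  by move=> k; apply/ffunP => i; rewrite !ffunE; case: unliftP => [j ->|->] /=; rewrite ?ffunE.
have hbij : bijective h' by exists h.
have [IHs IHe] := IH (fun i => F (lift ord0 i)) (fun i => Fs _).
have [s E] := rsum_mul_pair (Fs ord0) IHs.
have [s' E'] := reindex_rsum hbij s.
have fE : (fun k : {ffun 'I_n.+1 -> int} => \prod_i F i (k i)) =
    (fun q : int * {ffun 'I_n -> int} => F ord0 q.1 * \prod_i F (lift ord0 i) (q.2 i)) \o h'.
  apply/funext => k /=; rewrite big_ord_recl; congr (_ * _).
  by apply: eq_bigr => i _; rewrite ffunE.
by rewrite fE; split => //; rewrite E' E IHe big_ord_recl.
Qed.

(** * Theta series as products *)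

Section theta_products.
Context {R : realType}.

Definition theta1 (c x : R) : R :=
  rsum (fun m : int => expR (- (c * (m%:~R + x) ^+ 2))).

Lemma asum_theta1 (c x : R) : 0 < c ->
  asum (fun m : int => expR (- (c * (m%:~R + x) ^+ 2))).
Proof.
move=> c0; under eq_fun do rewrite addrC.
exact: (asum_periodize x (gauss_dom_gauss c0)).
Qed.

Lemma prod_std_type (n d t : nat) (F : option bool -> R) : (t <= d)%N -> (d <= n)%N ->
  F None = 1 ->
  \prod_(i < n) F (std_type d t i) = F (Some true) ^+ t * F (Some false) ^+ (d - t).
Proof.
move=> td dn F1.
pose f i := F (if (i < t)%N then Some true else if (i < d)%N then Some false else None).
rewrite -(big_mkord xpredT f) (big_cat_nat (n := d)) //= (big_cat_nat (n := t)) //=.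
rewrite [X in _ * X]big1_seq ?mulr1 => [|i]; last first.
  rewrite mem_index_iota => /andP[_ /andP[di _]].
  by rewrite /f ltnNge (leq_trans td di) /= ltnNge di.
congr (_ * _).
  rewrite (eq_big_nat _ _ (F2 := fun=> F (Some true))) ?prodr_const_nat ?subn0 //.
  by move=> i /andP[_ it]; rewrite /f it.
rewrite (eq_big_nat _ _ (F2 := fun=> F (Some false))) ?prodr_const_nat //.
by move=> i /andP[ti id]; rewrite /f ltnNge ti id.
Qed.

Lemma theta_real (d t : nat) (c : R) : 0 < c -> (t <= d)%N ->
  theta d t c%:C%C = (theta1 c 2^-1 ^+ t * theta1 c 0 ^+ (d - t))%:C%C.
Proof.
move=> c0 td.
have cexp_real (x : R) : cexp x%:C%C = (expR x)%:C%C.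
  rewrite /cexp /= cos0 sin0; apply/eqP.
  by rewrite eq_complex /= !mulr0 !mul0r subr0 mulr1 addr0 !eqxx.
pose F (tau : option bool) (m : int) :=
  expR (- (c * (m%:~R + if tau == Some true then 2^-1 else 0) ^+ 2)).
have cE (m : {ffun 'I_d -> int}) : cexp (- c%:C%C * (theta_form t m)%:C%C) =
    (\prod_i F (std_type d t i) (m i))%:C%C.
  rewrite -rmorphN -rmorphM cexp_real; congr (_%:C)%C.
  rewrite /theta_form mulr_sumr expR_sum; apply: eq_bigr => i _.
  rewrite /F /std_type mulNr; case: ifP => it; first by rewrite [2^-1 + _]addrC.
  by case: (i < d)%N; rewrite /= addr0.
rewrite /theta (funext cE) /csum; apply/eqP; rewrite eq_complex; apply/andP; split; apply/eqP.
  rewrite [LHS](_ : _ = rsum (fun m : {ffun 'I_d -> int} => \prod_i F (std_type d t i) (m i))) //.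
  rewrite (rsum_prod (F := fun i : 'I_d => F (std_type d t i)) (fun i => asum_theta1 _ c0)).2.
  pose V (tau : option bool) := if tau is None then 1 else rsum (F tau).
  transitivity (\prod_(i < d) V (std_type d t i)).
    by apply: eq_bigr => i _; rewrite /V /std_type ltn_ord; case: (i < t)%N.
  by rewrite prod_std_type.
have [_ E] := @rsum_finite R {ffun 'I_d -> int} (fun=> 0) fset0 (fun _ _ => erefl).
by rewrite [LHS]E big_seq_fset0.
Qed.

(** The signs attached to a half-integral coordinate are values of the modes at 1/2, so
    [theta_inversion] turns them into the shift by 1/2 of the theta series. *)
Lemma wave_half (m : int) : wave m (2^-1) = (-1) ^+ `|m|%N :> R.
Proof.
have h : 2 * 2^-1 = 1%:~R :> R by rewrite mulfV.
by have [] := cos_sin_half m h; rewrite subrr /= rpred0 /wave -!mulrA => -> ->; rewrite addr0.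
Qed.

Lemma wave0 (m : int) : wave m 0 = 1 :> R.
Proof. by rewrite /wave !mulr0 cos0 sin0 addr0. Qed.

Lemma rsum_coord_weight (s : R) (tau : option bool) : 0 < s ->
  asum (fun m : int => coord_weight tau m * expR (- (4 * pi ^+ 2 * s * m%:~R ^+ 2))) /\
  rsum (fun m : int => coord_weight tau m * expR (- (4 * pi ^+ 2 * s * m%:~R ^+ 2))) =
  match tau with
  | None => 1
  | Some b => (4 * pi * s) `^ (- 2^-1) * theta1 (4 * s)^-1 (if b then 2^-1 else 0)
  end.
Proof.
move=> s0.
have q0 : 0 < 4 * pi ^+ 2 * s by rewrite !mulr_gt0 ?exprn_gt0 ?pi_gt0.
case: tau => [b|].
  split.
    apply: asum_le (asum_gauss_int q0) => m.
    rewrite normrM (ger0_norm (expR_ge0 _)).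
    by case: b => /=; rewrite ?normrX ?normrN normr1 ?expr1n mul1r lexx.
  rewrite /theta1 -theta_inversion //; apply: eq_rsum => m; rewrite mulrC.
  by case: b; rewrite ?wave_half ?wave0.
have z0 (m : int) : m \notin [fset 0]%fset ->
    coord_weight None m * expR (- (4 * pi ^+ 2 * s * m%:~R ^+ 2)) = 0 :> R.
  by rewrite inE => /negPf m0; rewrite /= m0 mul0r.
have [s1 ->] := rsum_finite z0.
by split => //; rewrite big_seq_fset1 /= mul1r expr0n /= mulr0 oppr0 expR0.
Qed.

Lemma rsum_std_type (n d t : nat) (s : R) : 0 < s -> (t <= d)%N -> (d <= n)%N ->
  asum (fun k : {ffun 'I_n -> int} => (\prod_i coord_weight (std_type d t i) (k i)) *
     expR (- (4 * pi ^+ 2 * (normsq k)%:~R * s))) /\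
  rsum (fun k : {ffun 'I_n -> int} => (\prod_i coord_weight (std_type d t i) (k i)) *
     expR (- (4 * pi ^+ 2 * (normsq k)%:~R * s))) =
  ((4 * pi * s) `^ (- 2^-1)) ^+ d *
    (theta1 (4 * s)^-1 2^-1 ^+ t * theta1 (4 * s)^-1 0 ^+ (d - t)).
Proof.
move=> s0 td dn.
pose F (i : 'I_n) (m : int) := coord_weight (std_type d t i) m * expR (- (4 * pi ^+ 2 * s * m%:~R ^+ 2)) : R.
have Fs i : asum (F i) by exact: (rsum_coord_weight _ s0).1.
have [P1 P2] := rsum_prod Fs.
have -> : (fun k : {ffun 'I_n -> int} => (\prod_i coord_weight (std_type d t i) (k i)) *
     expR (- (4 * pi ^+ 2 * (normsq k)%:~R * s))) = (fun k => \prod_i F i (k i)).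
  apply/funext => k; rewrite /F big_split /= -expR_sum; congr (_ * expR _).
  rewrite sumrN -mulr_sumr mulrAC; congr (- (_ * _)).
  by rewrite /normsq rmorph_sum; apply: eq_bigr => i _; rewrite rmorphXn.
split=> //; rewrite P2.
pose V (tau : option bool) : R := match tau with
  | None => 1
  | Some b => (4 * pi * s) `^ (- 2^-1) * theta1 (4 * s)^-1 (if b then 2^-1 else 0)
  end.
rewrite (eq_bigr (fun i => V (std_type d t i))) => [|i _]; last exact: (rsum_coord_weight _ s0).2.
rewrite (prod_std_type (F := V)) // /V !exprMn -{3}(subnKC td) exprD; ring.
Qed.

End theta_products.

Section heat_trace_formula.
Context {R : realType} {n : nat} (G : set (affine R n)) (e : 'I_n -> 'cV[R]_n).
Hypothesis HG : isometry_subgroup G.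
Hypothesis HGe : diagonal_basis G e.
Variables (r : nat) (phi : set (affine R n) -> 'rV['F_2]_r).
Hypothesis phi_bij : set_bij (holonomy G) [set: 'rV['F_2]_r] phi.
Hypothesis phiM : forall g h, G g -> G h ->
  phi (Defs.coset G (isoM g h)) = phi (Defs.coset G g) + phi (Defs.coset G h).

Lemma dimension_ge0 (V : lmodType R) (S : set V) : (0 <= dimension S)%E.
Proof.
apply: ereal_sup_ubound; exists 0%N => //; exists (fun=> 0).
by split => [[]|c _ []].
Qed.

Lemma heat_trace_real (p : nat) (s : R) : 0 < s -> heat_trace G p s =
  (2^-1 ^+ r * \sum_(d < n.+1) \sum_(t < n.+1) (sunada G e d t)%:R *
    ((krawtchouk R n p).[(n - d)%:R] * (((4 * pi * s) `^ (- 2^-1)) ^+ d *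
      (theta1 (4 * s)^-1 2^-1 ^+ t * theta1 (4 * s)^-1 0 ^+ (d - t)))))%:E.
Proof.
move=> s0.
pose chi d t (k : {ffun 'I_n -> int}) : R := (\prod_i coord_weight (std_type d t i) (k i)) *
     expR (- (4 * pi ^+ 2 * (normsq k)%:~R * s)).
pose T d t k := (sunada G e d t)%:R * ((krawtchouk R n p).[(n - d)%:R] * chi d t k).
have TE (d t : 'I_n.+1) : asum (T d t) /\ rsum (T d t) = (sunada G e d t)%:R *
    ((krawtchouk R n p).[(n - d)%:R] * (((4 * pi * s) `^ (- 2^-1)) ^+ d *
      (theta1 (4 * s)^-1 2^-1 ^+ t * theta1 (4 * s)^-1 0 ^+ (d - t)))).
  have [td|dt] := leqP t d; last first.
    have z : sunada G e d t = 0%N by apply: (sunada_gt HG HGe phi_bij).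
    have T0 k : k \notin fset0 -> T d t k = 0 by rewrite /T z mul0r.
    have [s1 ->] := rsum_finite T0.
    by rewrite big_seq_fset0 z mul0r.
  have [s1 E] := rsum_std_type s0 td (leq_ord d : (d <= n)%N).
  have s2 := asumZ (krawtchouk R n p).[(n - d)%:R] s1.
  by split; [exact: asumZ|rewrite rsumZ // rsumZ // E].
pose f k := 2^-1 ^+ r * \sum_(d < n.+1) \sum_(t < n.+1) T d t k.
have s1 (d : 'I_n.+1) : asum (fun k => \sum_(t < n.+1) T d t k).
  by apply: asum_sum => t _; exact: (TE d t).1.
have s2 : asum (fun k => \sum_(d < n.+1) \sum_(t < n.+1) T d t k).
  by apply: asum_sum.
have fE mu : (multiplicity G p mu * (expR (- (4 * pi ^+ 2 * mu * s)))%:E)%E =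
    (\sum_(k <- shellF mu) f k)%:E.
  rewrite (multiplicity_sunada HG HGe phi_bij phiM) -EFinM; congr EFin.
  rewrite -[LHS]mulrA /f -[RHS]mulr_sumr; congr (_ * _).
  rewrite [RHS]exchange_big mulr_suml; apply: eq_bigr => d _ /=.
  rewrite [RHS]exchange_big mulr_suml; apply: eq_bigr => t _ /=.
  rewrite /T -[RHS]mulr_sumr -!mulrA; congr (_ * _); rewrite -[RHS]mulr_sumr; congr (_ * _).
  rewrite /weighted_count mulr_suml; apply: eq_big_seq => k.
  by rewrite in_shellF => /eqP kmu; rewrite /chi kmu !mulrA.
have -> : heat_trace G p s = (rsum f)%:E.
  rewrite -esum_shell; last 2 first.
  - exact: asumZ.
  (* The shell sums are multiplicities times positive factors, hence nonnegative, although single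
     values of [f] may be negative. *)
  - move=> mu; rewrite -lee_fin -fE mule_ge0 ?lee_fin ?expR_ge0 //.
    exact: dimension_ge0.
  by apply: eq_esum => mu _; exact: fE.
rewrite /f rsumZ // rsum_sum //; congr (_ * _)%:E; apply: eq_bigr => d _.
rewrite rsum_sum => [|t _]; last exact: (TE d t).1.
by apply: eq_bigr => t _; exact: (TE d t).2.
Qed.

End heat_trace_formula.

(** * Independence of the theta products *)

Section independence.
Context {R : realType}.

Lemma sum_pow_bound (m : nat) (b : nat -> R) (X : R) : 1 <= X ->
  `|\sum_(j < m) b j * X ^+ j| <= (\sum_(j < m) `|b j|) * X ^+ m.-1.
Proof.
move=> X1; apply: (le_trans (ler_norm_sum _ _ _)); rewrite mulr_suml.
have X0 : 0 <= X by apply: le_trans X1.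
apply: ler_sum => j _; rewrite normrM normrX (ger0_norm X0) ler_wpM2l //.
by rewrite ler_weXn2l //; case: m j => [[]|m j] //=; rewrite -ltnS.
Qed.

(** For large [X] a nonzero leading term would dominate the others, so it vanishes and the degree
    drops. *)
Lemma small_poly_eq0 (m : nat) (b : nat -> R) :
  (forall eps X0 : R, 0 < eps -> exists2 X, X0 <= X & `|\sum_(j < m) b j * X ^+ j| <= eps) ->
  forall j, (j < m)%N -> b j = 0.
Proof.
elim: m => // m IH H.
have bm : b m = 0.
  apply/eqP; rewrite -normr_le0; case: m IH H => [|m] _ H.
    apply/ler_addgt0Pr => eps eps0; have [X _] := H eps 0 eps0.
    by rewrite big_ord1 expr0 mulr1 add0r.
  rewrite leNgt; apply/negP => b0.
  set C := \sum_(j < m.+1) `|b j|.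
  have C0 : 0 <= C by apply: sumr_ge0 => j _.
  (* At this size the leading term is at least [(C + 2) * X ^+ m], against the upper bound
     [1 + C * X ^+ m]. *)
  have [X X0 HX] := H 1 (1 + (C + 2) / `|b m.+1|) ltr01.
  have X1 : 1 <= X by apply: le_trans X0; rewrite lerDl divr_ge0 // addr_ge0.
  have Xp : 0 < X by apply: lt_le_trans X1.
  have := sum_pow_bound m.+1 b X1; rewrite -/C /= => HC.
  move: HX; rewrite big_ord_recr /=; set S := \sum_(i < _) _ => HX.
  have : `|b m.+1 * X ^+ m.+1| <= 1 + C * X ^+ m.
    rewrite (_ : b m.+1 * X ^+ m.+1 = (S + b m.+1 * X ^+ m.+1) - S); last by ring.
    by apply: (le_trans (ler_normB _ _)); exact: lerD.
  rewrite normrM normrX (gtr0_norm Xp) exprSr mulrA mulrAC.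
  have Xm : 1 <= X ^+ m by exact: exprn_ege1.
  have : (C + 2) * X ^+ m <= `|b m.+1| * X * X ^+ m.
    rewrite ler_wpM2r ?(le_trans ler01 Xm) //.
    have : (C + 2) / `|b m.+1| <= X by apply: le_trans X0; rewrite lerDr.
    by rewrite ler_pdivrMr // mulrC.
  by move=> h1 h2; have := le_trans h1 h2; rewrite mulrDl; lra.
have Hm : forall eps X0 : R, 0 < eps -> exists2 X, X0 <= X & `|\sum_(j < m) b j * X ^+ j| <= eps.
  move=> eps X0 e0; have [X X0X HX] := H eps X0 e0; exists X => //.
  by move: HX; rewrite big_ord_recr /= bm mul0r addr0.
by move=> j; rewrite ltnS leq_eqVlt => /predU1P[->//|]; exact: IH.
Qed.

(** The terms with [t > 0] are bounded by a multiple of [Z * X ^+ m.-1], so the polynomial at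
    [t = 0] takes small values at large [X] and vanishes; then a factor [Z] is cancelled. The
    freedom in [N] lets [Z] beat the degree in [X]. *)
Lemma small_two_variable_eq0 (T m : nat) (b : nat -> nat -> R) :
  (forall (N : nat) (eps X0 : R), 0 < eps -> exists X Z, [/\ X0 <= X, 0 < Z,
     Z * X ^+ N <= eps & \sum_(t < T) Z ^+ t * \sum_(j < m) b t j * X ^+ j = 0]) ->
  forall t j, (t < T)%N -> (j < m)%N -> b t j = 0.
Proof.
elim: T b => // T IH b H.
pose C := \sum_(t < T) \sum_(j < m) `|b t.+1 j|.
have C0 : 0 <= C by apply: sumr_ge0 => t _; exact: sumr_ge0.
have b0 j : (j < m)%N -> b 0%N j = 0.
  apply: small_poly_eq0 => eps X0 e0.
  (* The minimum with 1 yields [Z <= 1], so every positive power of [Z] is at most [Z]. *)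
  have e1 : 0 < Num.min 1 (eps / (C + 1)).
    by rewrite lt_min ltr01 divr_gt0 // ltr_wpDl.
  have [X [Z [XX0 Z0 ZX E]]] := H m.-1 (Num.min 1 (eps / (C + 1))) (Num.max 1 X0) e1.
  move: XX0; rewrite ge_max => /andP[X1 XX0]; exists X => //.
  move: ZX; rewrite le_min => /andP[ZX1 ZXe].
  have Xm : 1 <= X ^+ m.-1 by exact: exprn_ege1.
  have Z1 : Z <= 1 by apply: le_trans ZX1; rewrite ler_peMr // ltW.
  move: E; rewrite big_ord_recl expr0 mul1r => /eqP; rewrite addr_eq0 => /eqP ->.
  rewrite normrN; apply: (le_trans (ler_norm_sum _ _ _)).
  apply: (@le_trans _ _ (C * (Z * X ^+ m.-1))).
    rewrite /C mulr_suml; apply: ler_sum => t _ /=.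
    rewrite normrM [leRHS]mulrCA ler_pM //; last exact: sum_pow_bound.
    rewrite /bump /= add1n normrX (gtr0_norm Z0) exprS ler_piMr ?(ltW Z0) //.
    by rewrite exprn_ile1 // ltW.
  apply: (@le_trans _ _ (C * (eps / (C + 1)))); first by rewrite ler_wpM2l.
  rewrite mulrCA ler_piMr ?(ltW e0) // ler_pdivrMr ?mul1r ?lerDl //.
  by rewrite ltr_wpDl.
case=> [|t] j; first by move=> _; exact: b0.
rewrite ltnS; apply: (IH (fun t => b t.+1)) => N eps X0 e0.
have [X [Z [XX0 Z0 ZX E]]] := H N eps X0 e0; exists X, Z; split => //.
apply: (mulfI (lt0r_neq0 Z0)); rewrite mulr0 -[RHS]E big_ord_recl.
rewrite [X in _ = _ * X + _]big1 ?mulr0 ?add0r; last by move=> i _; rewrite b0 ?mul0r.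
by rewrite [LHS]mulr_sumr; apply: eq_bigr => i _; rewrite exprS mulrA.
Qed.

(** Since [(m + 1/2) ^ 2 >= 1/4] for every integer [m], raising the parameter from 1 to [c] gains
    the exponential factor in each term. *)
Lemma theta1_half_le (c : R) : 1 <= c ->
  theta1 c 2^-1 <= expR (- ((c - 1) / 4)) * theta1 1 2^-1.
Proof.
move=> c1; have c0 : 0 < c by apply: lt_le_trans c1.
rewrite -rsumZ; last exact: asum_theta1.
apply: rsum_le; [exact: asum_theta1|by apply: asumZ; exact: asum_theta1|].
move=> m; rewrite -expRD ler_expR.
have : 4^-1 <= (m%:~R + 2^-1 : R) ^+ 2.
  have : 0 <= (m * (m + 1))%:~R :> R by rewrite ler0z; nia.
  by rewrite intrM intrD; nra.
by move: (_ ^+ 2) => u; nra.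
Qed.

Lemma theta1_decr (c : R) : 1 <= c -> theta1 c 0 <= theta1 1 0.
Proof.
move=> c1; have c0 : 0 < c by apply: lt_le_trans c1.
apply: rsum_le; [exact: asum_theta1|exact: asum_theta1|].
move=> m; rewrite ler_expR lerN2 ler_wpM2r ?sqr_ge0 //.
Qed.

Lemma theta1_ge_term (c x : R) : 0 < c -> expR (- (c * x ^+ 2)) <= theta1 c x.
Proof.
move=> c0; have := sum_le_rsum [fset (0 : int)]%fset
  (fun m => expR_ge0 (- (c * (m%:~R + x) ^+ 2))) (asum_theta1 x c0).
by rewrite big_seq_fset1 add0r.
Qed.

Lemma theta_asymptotics (N : nat) (eps X0 : R) : 0 < eps -> exists2 s : R, 0 < s &
  [/\ X0 <= (4 * pi * s) `^ (- 2^-1) * theta1 (4 * s)^-1 0,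
      0 < theta1 (4 * s)^-1 2^-1 / theta1 (4 * s)^-1 0 &
      theta1 (4 * s)^-1 2^-1 / theta1 (4 * s)^-1 0 *
        ((4 * pi * s) `^ (- 2^-1) * theta1 (4 * s)^-1 0) ^+ N <= eps].
Proof.
move=> e0.
pose A1 := theta1 1 0 : R; pose B1 := theta1 1 2^-1 : R.
(* From [u <= expR u] at [u = c / (4 * (N + 1))], raised to the power [N + 1]:
   [c ^+ N.+1 <= K * expR (c / 4)]. *)
pose K := (4 * N.+1%:R) ^+ N.+1 : R.
have K0 : 0 <= K by rewrite exprn_ge0 // mulr_ge0.
have A1_ge1 : 1 <= A1.
  by apply: le_trans (theta1_ge_term 0 ltr01); rewrite expr0n mulr0 oppr0 expR0.
have B1_ge0 : 0 <= B1 by apply: le_trans (theta1_ge_term _ ltr01); exact: expR_ge0.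
pose D := expR 4^-1 * B1 * A1 ^+ N * K.
have AN : 0 <= A1 ^+ N by rewrite exprn_ge0 // (le_trans ler01).
have D0 : 0 <= D.
  exact: (mulr_ge0 (mulr_ge0 (mulr_ge0 (expR_ge0 _) B1_ge0) AN) K0).
(* The parameter of the theta series, with [s = 1 / (4 * c)]. Its summands serve in turn the
   comparison with parameter 1, the bound [X0 <= P] where [P ^+ 2 = c / pi], and the final estimate
   [D / c <= eps]. *)
pose c := 1 + pi * X0 ^+ 2 + D / eps.
have h1 : 0 <= pi * X0 ^+ 2 by rewrite mulr_ge0 ?pi_ge0 ?sqr_ge0.
have h2 : 0 <= D / eps by rewrite divr_ge0 // ltW.
have c1 : 1 <= c by rewrite /c; lra.
have c0 : 0 < c by apply: lt_le_trans c1.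
have cX : pi * X0 ^+ 2 <= c by rewrite /c; lra.
have cD : D / eps <= c by rewrite /c; lra.
exists (4 * c)^-1; first by rewrite invr_gt0 mulr_gt0.
have -> : (4 * (4 * c)^-1)^-1 = c.
  by rewrite invfM invrK mulrA mulVf ?mul1r ?pnatr_eq0.
set P := _ `^ _.
have PE : P ^+ 2 = c / pi.
  have q0 : 0 <= 4 * pi * (4 * c)^-1.
    by rewrite mulr_ge0 ?mulr_ge0 ?pi_ge0 ?invr_ge0 ?mulr_ge0 ?ltW.
  rewrite /P -powR_mulrn ?powR_ge0 // -powRrM mulNr mulVf ?pnatr_eq0 // powR_inv1 //.
  rewrite invfM invrK invfM.
  move: (pi : R) (pi_gt0 R) => q p0; field.
  by rewrite gt_eqF.
have P0 : 0 <= P by exact: powR_ge0.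
have pi1 : 1 <= pi :> R by have := pi_ge2 R; lra.
have PX : X0 <= P.
  have [X00|X00] := leP X0 0; first exact: le_trans P0.
  suff : X0 ^+ 2 <= P ^+ 2 by rewrite ler_pXn2r ?nnegrE // ltW.
  by rewrite PE ler_pdivlMr ?pi_gt0 // mulrC.
have Pc : P <= c.
  suff : P ^+ 2 <= c ^+ 2 by rewrite ler_pXn2r ?nnegrE // ltW.
  rewrite PE ler_pdivrMr ?pi_gt0 //.
  by rewrite expr2 -mulrA ler_peMr ?(ltW c0) //; nra.
have A_ge1 : 1 <= theta1 c 0.
  by apply: le_trans (theta1_ge_term 0 c0); rewrite expr0n mulr0 oppr0 expR0.
have A_gt0 : 0 < theta1 c 0 by apply: lt_le_trans A_ge1.
have B_gt0 : 0 < theta1 c 2^-1 by apply: lt_le_trans (theta1_ge_term _ c0); exact: expR_gt0.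
split; [|by rewrite divr_gt0|].
  by apply: (le_trans PX); rewrite ler_peMr.
have exp_bound : c ^+ N.+1 <= K * expR (c / 4).
  have k0 : N.+1%:R != 0 :> R by rewrite pnatr_eq0.
  have cE1 (k : R) : k != 0 -> c / 4 = k * (c / (4 * k)) by move=> nk; field.
  have cE2 (k : R) : k != 0 -> c = 4 * k * (c / (4 * k)) by move=> nk; field.
  rewrite (cE1 _ k0).
  rewrite expRM_natl.
  rewrite {1}(cE2 _ k0).
  rewrite exprMn; apply: ler_pM; rewrite ?exprn_ge0 ?mulr_ge0 ?divr_ge0 ?(ltW c0) //.
  by rewrite lerXn2r ?nnegrE ?divr_ge0 ?(ltW c0) ?expR_ge0 //; exact: le_expR.
have Bc := theta1_half_le c1; have Ac := theta1_decr c1; rewrite -/A1 -/B1 in Bc Ac.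
have step : theta1 c 2^-1 / theta1 c 0 * (P * theta1 c 0) ^+ N <=
    expR (- ((c - 1) / 4)) * B1 * (c * A1) ^+ N.
  apply: ler_pM; rewrite ?exprn_ge0 ?mulr_ge0 ?invr_ge0 ?(ltW B_gt0) ?(ltW A_gt0) //.
    by apply: le_trans Bc; rewrite ler_pdivrMr //; exact: (ler_peMr (ltW B_gt0) A_ge1).
  rewrite lerXn2r ?nnegrE ?mulr_ge0 ?(ltW c0) ?(ltW A_gt0) ?(le_trans ler01 A1_ge1) //.
  by apply: ler_pM; rewrite ?(ltW A_gt0).
apply: (le_trans step).
have -> : expR (- ((c - 1) / 4)) = expR 4^-1 * (expR (c / 4))^-1.
  by rewrite -expRN -expRD; congr expR; field.
have E0 := expR_gt0 (c / 4).
have -> : expR 4^-1 * (expR (c / 4))^-1 * B1 * (c * A1) ^+ N =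
   (expR 4^-1 * B1 * A1 ^+ N) * (c ^+ N.+1 / expR (c / 4)) / c.
  by rewrite exprMn exprS; field; rewrite !gt_eqF.
rewrite ler_pdivrMr //.
apply: (@le_trans _ _ D).
  rewrite /D; apply: ler_pM => //.
  - exact: (mulr_ge0 (mulr_ge0 (expR_ge0 _) B1_ge0) AN).
  - by rewrite divr_ge0 ?exprn_ge0 ?(ltW c0) ?(ltW E0).
  - by rewrite ler_pdivrMr.
by move: cD; rewrite ler_pdivrMr // mulrC.
Qed.

(* Apply the previous lemmas to [X = P * A] and [Z = B / A], where [P], [A], [B] are
   [(4 pi s)^(-1/2)] and the theta series without and with a half-integral shift:
   as [s] tends to 0, [Z] decays faster than any negative power of [X]. *)
Lemma theta_independent (n : nat) (a : nat -> nat -> R) :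
  (forall d t, (d < t)%N -> a d t = 0) ->
  (forall s : R, 0 < s -> \sum_(d < n.+1) \sum_(t < n.+1) a d t *
     (((4 * pi * s) `^ (- 2^-1)) ^+ d *
       (theta1 (4 * s)^-1 2^-1 ^+ t * theta1 (4 * s)^-1 0 ^+ (d - t))) = 0) ->
  forall d t, (d <= n)%N -> (t <= n)%N -> a d t = 0.
Proof.
move=> a0 H d t dn tn.
apply: (@small_two_variable_eq0 n.+1 n.+1 (fun t d => a d t) _ t d) => // N eps X0 e0.
have [s s0 [h1 h2 h3]] := theta_asymptotics N X0 e0.
set P := (4 * pi * s) `^ (- 2^-1) in h1 h3 *.
set A := theta1 (4 * s)^-1 0 in h1 h2 h3 *; set B := theta1 (4 * s)^-1 2^-1 in h2 h3 *.
exists (P * A), (B / A); split => //.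
rewrite -[RHS](H s s0) -/P -/A -/B [RHS]exchange_big; apply: eq_bigr => u _ /=.
rewrite mulr_sumr; apply: eq_bigr => v _.
have [uv|vu] := leqP u v; last by rewrite a0 // !mul0r mulr0.
have A0 : A != 0 by apply: contraTneq h2 => ->; rewrite invr0 mulr0 ltxx.
have -> : (P * A) ^+ v = P ^+ v * (A ^+ (v - u) * A ^+ u) by rewrite exprMn -exprD subnK.
rewrite exprMn exprVn; field.
by rewrite expf_neq0.
Qed.

End independence.

(** * Torsion-freeness and the main theorem *)

Section fixed_points.
Context {R : realType} {n : nat} (G : set (affine R n)) (e : 'I_n -> 'cV[R]_n).
Hypothesis HG : isometry_subgroup G.
Hypothesis HGe : diagonal_basis G e.
Hypothesis torsion_free : forall g k, G g -> (0 < k)%N -> isoX g k = iso1 -> g = iso1.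

Let He : forall i j, dot (e i) (e j) = (i == j)%:R.
Proof. by case: HGe. Qed.

(* With no half-integral fixed coordinate, [g] is a translate by [Lambda] of an
   element of order at most 2. *)
Lemma half_count_eq0 g : G g -> half_count e g = 0%N -> fix_dim g = n.
Proof.
move=> Gg; rewrite half_count_type => /card0_eq h0.
have [Giso _ GM _] := HG; have [_ tG _] := HGe.
have zE i : ~~ flip e g i -> dot g.2 (e i) \is a Num.int.
  move=> fi; have [m mE] := half_integral HG HGe Gg fi.
  have := h0 i; rewrite !inE /coord_type (negPf fi) => /negbT nh.
  have [z [mz|mz]] : exists z : int, m = 2 * z \/ m = 2 * z + 1.
    by exists (m %/ 2)%Z; lia.
  - apply/intrP; exists z; apply: (mulfI (_ : (2 : R) != 0)); first by rewrite pnatr_eq0.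
    by rewrite mE mz intrM.
  - exfalso; move/negP: nh; apply; rewrite eqE /= eqb_id; apply/intrP; exists z.
    apply: (mulfI (_ : (2 : R) != 0)); first by rewrite pnatr_eq0.
    by rewrite mulrBr mE mz intrD intrM mulfV ?pnatr_eq0 // addrK.
have /cid[z zdot] : exists z : 'I_n -> int, forall i, ~~ flip e g i -> dot g.2 (e i) = (z i)%:~R.
  exists (fun i => Num.floor (dot g.2 (e i))) => i /zE.
  by move=> zi; rewrite (floorK zi).
(* The lattice translation that cancels the integral displacement along the fixed axes, so that [h]
   below squares to the identity. *)
pose w := \sum_i (if flip e g i then 0 else - (z i)%:~R) *: e i.
have Gw : G (translation w).
  suff : translations G w by [].
  rewrite tG; exists (fun i => if flip e g i then 0 else - z i).
  by apply: eq_bigr => i _; case: ifP => _; rewrite ?rmorphN.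
have gw : g.1 *m w = w.
  rewrite /w mulmx_sumr; apply: eq_bigr => i _; rewrite -scalemxAr (diag_act HGe) //.
  by case: (flip e g i) => /=; rewrite ?scale0r // expr0 scale1r.
have gwt : g.1^T *m w = w.
  rewrite /w mulmx_sumr; apply: eq_bigr => i _; rewrite -scalemxAr (diag_act_tr HG HGe) //.
  by case: (flip e g i) => /=; rewrite ?scale0r // expr0 scale1r.
pose h := isoM (translation w) g.
have Gh : G h by exact: GM.
have hE : h = (g.1, w + g.2) by rewrite /h /isoM /= mul1mx gwt.
have B2 : g.1 *m g.1 = 1%:M.
  apply/trmx_inj/row_matrixP => a.
  have Bx (x : 'cV[R]_n) : g.1 *m (g.1 *m x) = x.
    rewrite (basis_expand He x) !mulmx_sumr; apply: eq_bigr => j _.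
    by rewrite -!scalemxAr !(diag_act HGe) // -!scalemxAr (diag_act HGe) // (scalerA ((-1) ^+ _)) -signr_addb addbb scale1r.
  by rewrite -!tr_col !colE -mulmxA Bx mul1mx.
(* In the square, displacements along reflected axes cancel, and those along fixed axes are already
   zero. *)
have hw : g.1^T *m (w + g.2) + (w + g.2) = 0.
  rewrite (basis_expand He (g.1^T *m (w + g.2) + (w + g.2))) big1 // => i _.
  have -> : dot (e i) (g.1^T *m (w + g.2) + (w + g.2)) = 0; last by rewrite scale0r.
  rewrite dotDr dot_mulmxr trmxK (diag_act HGe) // dotZl.
  have [fi|fi] := boolP (flip e g i); first by rewrite expr1 mulN1r addNr.
  rewrite expr0 mul1r dotDr (dotC (e i) g.2) zdot //.
  have -> : dot (e i) w = - (z i)%:~R.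
    rewrite /w dot_sumr (bigD1 i) //= (negPf fi) dotZr He eqxx mulr1 big1 ?addr0 // => j ji.
    by rewrite dotZr He eq_sym (negPf ji) mulr0.
  by rewrite addNr addr0.
have h1 : h = iso1.
  apply: (torsion_free Gh (ltn0Sn 1)).
  by rewrite hE /isoX /= /isoM /= !mulmx1 trmx1 mul1mx addr0 B2 hw.
have gI : g.1 = 1%:M by have := congr1 fst h1; rewrite hE.
by rewrite /fix_dim gI subrr trmx0 mxrank_ker mxrank0 subn0.
Qed.

Lemma fix_dim_translation g : G g -> fix_dim g = n -> half_count e g = 0%N /\ translations G g.2 /\ g.1 = 1%:M.
Proof.
move=> Gg; have [_ tG _] := HGe.
move=> gn; have gI : g.1 = 1%:M.
  have : \rank (g.1 - 1%:M)^T = 0%N.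
    by move: gn; rewrite /fix_dim mxrank_ker; have := rank_leq_row (g.1 - 1%:M)^T; lia.
  move/eqP; rewrite mxrank_eq0 => /eqP/(congr1 trmx); rewrite trmxK trmx0 => /eqP.
  by rewrite subr_eq0 => /eqP.
have Gt : translations G g.2 by rewrite /translations /= /translation -gI; case: (g) Gg.
split => //; apply: eq_card0 => i; rewrite !inE; apply/negP => /andP[_].
move: Gt; rewrite tG => -[z ->].
have -> : dot (\sum_j (z j)%:~R *: e j) (e i) = (z i)%:~R.
  rewrite dot_suml (bigD1 i) //= dotZl He eqxx mulr1 big1 ?addr0 // => j ji.
  by rewrite dotZl He (negPf ji) mulr0.
move=> /intrP[y yE].
have : (2 * z i - 1)%:~R = (2 * y)%:~R :> R.
  by rewrite intrB !intrM -yE; field.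
by move/eqP; rewrite eqr_int => /eqP; lia.
Qed.

Variables (r : nat) (phi : set (affine R n) -> 'rV['F_2]_r).
Hypothesis phi_bij : set_bij (holonomy G) [set: 'rV['F_2]_r] phi.

(** An element without half-integral fixed coordinates fixes all axes, hence is a translation; the
    translations form the single coset of [iso1]. *)
Lemma sunada_d0 d : sunada G e d 0 = (d == n).
Proof.
have [_ G1 _ _] := HG.
rewrite (sunada_rep HG HGe phi_bij).
have [->|dn] := eqVneq d n; last first.
  apply: eq_card0 => u; rewrite !inE; apply/negP => /andP[/eqP ud /eqP u0].
  by move/eqP: dn; apply; rewrite -ud; apply: half_count_eq0 => //; exact: rep_in.
apply/eqP/fintype.card1P; exists (phi (Defs.coset G iso1)) => u; rewrite !inE.
have cosetT (g : affine R n) : G g -> translations G g.2 -> g.1 = 1%:M ->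
    Defs.coset G g = [set g | g.1 = 1%:M /\ translations G g.2].
  move=> Gg Gt g1; apply/seteqP; split => [h [v Gv <-]|h [h1 h2]].
    rewrite /isoM /= g1 !mul1mx trmx1 mul1mx; split=> //.
    have [_ _ GM _] := HG.
    by have := GM _ _ Gv Gt; rewrite /translations /= /isoM /= mul1mx trmx1 mul1mx.
  exists (h.2 - g.2).
    have [_ _ GM GV] := HG.
    have := GM _ _ h2 (GV _ Gt); rewrite /isoM /isoV /= !trmx1 !mul1mx.
    by [].
  by rewrite /isoM /= mul1mx g1 trmx1 mul1mx subrK -g1; case: (h) h1 => a b /= ->; rewrite g1.
apply/andP/eqP => [[/eqP ud /eqP u0]|->].
  have [_ [Gt g1]] := fix_dim_translation (rep_in phi_bij u) ud.
  rewrite -(phi_rep phi_bij u); congr phi.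
  by rewrite !cosetT //; exact: rep_in.
set u' := phi _.
have E : Defs.coset G (rep phi_bij u') = Defs.coset G iso1.
  by apply: (coset_inj phi_bij) => //; [exact: rep_in|exact: phi_rep].
have [fd _] : fix_dim (rep phi_bij u') = fix_dim (iso1 : affine R n) /\ half_count e (rep phi_bij u') = half_count e iso1.
  apply: (coset_invariants HGe G1); rewrite -E; exact: coset_self.
have fn : fix_dim (rep phi_bij u') = n.
  by rewrite fd /fix_dim /= subrr trmx0 mxrank_ker mxrank0 subn0.
by rewrite fn eqxx (fix_dim_translation (rep_in phi_bij u') fn).1 eqxx.
Qed.

End fixed_points.

Section isospectrality.
Context {R : realType} {n r : nat}.
Implicit Types (G : set (affine R n)) (e : 'I_n -> 'cV[R]_n).

Lemma sunada_d0_eq G e G' e' d :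
  Bieberbach G -> diagonal_basis G e -> holonomy_iso_Z2 G r ->
  Bieberbach G' -> diagonal_basis G' e' -> holonomy_iso_Z2 G' r ->
  sunada G e d 0 = sunada G' e' d 0.
Proof.
move=> [HG _ _ tf] HGe [phi [pb _]] [HG' _ _ tf'] HGe' [phi' [pb' _]].
by rewrite (sunada_d0 HG HGe tf pb) (sunada_d0 HG' HGe' tf' pb').
Qed.

(** The criterion with [t = 0] included, as the separation of the theta products yields it;
    [sunada_d0_eq] later accounts for that case. *)
Lemma p_isospectral_sunada G e G' e' p :
  Bieberbach G -> diagonal_basis G e -> holonomy_iso_Z2 G r ->
  Bieberbach G' -> diagonal_basis G' e' -> holonomy_iso_Z2 G' r ->
  p_isospectral G G' p <-> (forall d t, (t <= d)%N -> (d <= n)%N ->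
    (krawtchouk R n p).[(n - d)%:R] * (sunada G e d t)%:R =
    (krawtchouk R n p).[(n - d)%:R] * (sunada G' e' d t)%:R).
Proof.
move=> [HG _ _ _] HGe [phi [pb pM]] [HG' _ _ _] HGe' [phi' [pb' pM']].
have gt0 d t : (d < t)%N -> sunada G e d t = 0%N /\ sunada G' e' d t = 0%N.
  by move=> dt; rewrite (sunada_gt HG HGe pb dt) (sunada_gt HG' HGe' pb' dt).
split => [iso|H mu]; last first.
  rewrite (multiplicity_sunada HG HGe pb pM) (multiplicity_sunada HG' HGe' pb' pM').
  congr (_ * _)%:E; apply: eq_bigr => d _; apply: eq_bigr => t _.
  have [td|/gt0[-> ->] //] := leqP t d.
  by rewrite !mulrA ![_%:R * _]mulrC H // -ltnS.
pose a d t : R := (krawtchouk R n p).[(n - d)%:R] * ((sunada G e d t)%:R - (sunada G' e' d t)%:R).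
have a0 d t : (d < t)%N -> a d t = 0.
  by move=> /gt0[z z']; rewrite /a z z' subrr mulr0.
have E (s : R) : 0 < s -> \sum_(d < n.+1) \sum_(t < n.+1) a d t *
     (((4 * pi * s) `^ (- 2^-1)) ^+ d *
       (theta1 (4 * s)^-1 2^-1 ^+ t * theta1 (4 * s)^-1 0 ^+ (d - t))) = 0.
  move=> s0; have : heat_trace G p s = heat_trace G' p s.
    by apply: eq_esum => mu _; rewrite iso.
  rewrite (heat_trace_real HG HGe pb pM _ s0) (heat_trace_real HG' HGe' pb' pM' _ s0).
  have r0 : (2^-1 : R) ^+ r != 0 by rewrite expf_neq0 // invr_eq0 pnatr_eq0.
  move=> h; have := mulfI r0 (EFin_inj h) => /eqP.
  rewrite -subr_eq0 -sumrB => /eqP z; rewrite -[RHS]z; apply: eq_bigr => d _.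
  by rewrite -sumrB; apply: eq_bigr => t _; rewrite /a -mulrBl; ring.
move=> d t td dn; apply/eqP; rewrite -subr_eq0 -mulrBr; apply/eqP.
exact: (theta_independent a0 E dn (leq_trans td dn)).
Qed.

Lemma heat_trace_theta G e p (s : R) : (0 < n)%N ->
  Bieberbach G -> diagonal_basis G e -> holonomy_iso_Z2 G r -> 0 < s ->
  exists2 h : R, heat_trace G p s = h%:E &
    (h%:C)%C = (2^-1) ^+ r * \sum_(1 <= d < n.+1)
      (((krawtchouk R n p).[(n - d)%:R] * (4 * pi * s) `^ (- (d%:R / 2)))%:C)%C *
      \sum_(0 <= t < d.+1) (sunada G e d t)%:R * theta d t (((4 * s)^-1)%:C)%C.
Proof.
move=> n0 [HG _ _ tf] HGe [phi [pb pM]] s0.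
eexists; first exact: (heat_trace_real HG HGe pb pM _ s0).
have c0 : 0 < (4 * s)^-1 by rewrite invr_gt0 mulr_gt0.
set A := theta1 (4 * s)^-1 2^-1; set B := theta1 (4 * s)^-1 0.
transitivity ((2^-1 ^+ r * \sum_(1 <= d < n.+1)
      ((krawtchouk R n p).[(n - d)%:R] * (4 * pi * s) `^ (- (d%:R / 2))) *
      \sum_(0 <= t < d.+1) (sunada G e d t)%:R * (A ^+ t * B ^+ (d - t)))%:C)%C; last first.
  rewrite rmorphM rmorphXn fmorphV rmorph_nat rmorph_sum; congr (_ * _).
  apply: eq_bigr => d _; rewrite [LHS]rmorphM; congr (_ * _).
  rewrite rmorph_sum; apply: eq_big_nat => t /andP[_ td].
  by rewrite theta_real // [LHS]rmorphM rmorph_nat.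
congr (_%:C)%C; congr (_ * _).
pose F d t := (sunada G e d t)%:R * ((krawtchouk R n p).[(n - d)%:R] *
  (((4 * pi * s) `^ (- 2^-1)) ^+ d * (A ^+ t * B ^+ (d - t)))).
have F0 d t : (d < t)%N -> F d t = 0 by move=> dt; rewrite /F (sunada_gt HG HGe pb dt) mul0r.
transitivity (\sum_(0 <= d < n.+1) \sum_(0 <= t < n.+1) F d t).
  by rewrite big_mkord; apply: eq_bigr => d _; rewrite big_mkord.
(* The term [d = 0] drops out: [sunada G e 0 0] is zero because [n > 0], and any [t > 0] exceeds
   [d]. *)
rewrite big_ltn // big1_seq ?add0r => [|[|t] _]; last 2 first.
- by rewrite /F (sunada_d0 HG HGe tf pb) eq_sym (gtn_eqF n0) mul0r.
- exact: F0.
apply: eq_big_nat => d /andP[_ dn].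
rewrite (big_cat_nat (n := d.+1)) //= [X in _ + X]big1_seq ?addr0; last first.
  by move=> t; rewrite mem_index_iota => /andP[_ /andP[dt _]]; exact: F0.
rewrite mulr_sumr; apply: eq_bigr => t _; rewrite /F.
have -> : (4 * pi * s) `^ (- (d%:R / 2)) = ((4 * pi * s) `^ (- 2^-1)) ^+ d.
  by rewrite -powR_mulrn ?powR_ge0 // -powRrM mulNr [2^-1 * _]mulrC.
by rewrite [LHS]mulrCA -[RHS]mulrA; congr (_ * _); rewrite [LHS]mulrCA.
Qed.

End isospectrality.

Theorem theorem4p5 (R : realType) (n r p : nat) (G : set (affine R n))
    (e : 'I_n -> 'cV[R]_n)
    (n_gt0 : (0 < n)%N)
    (HG : Bieberbach G) (HGe : diagonal_basis G e) (HGr : holonomy_iso_Z2 G r)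
    (le_pn : (p <= n)%N) :
  (forall s : R, 0 < s ->
     exists2 h : R, heat_trace G p s = h%:E &
       (h%:C)%C =
         (2^-1) ^+ r *
         \sum_(1 <= d < n.+1)
           (((krawtchouk R n p).[(n - d)%:R]
              * (4 * pi * s) `^ (- (d%:R / 2)))%:C)%C *
           \sum_(0 <= t < d.+1)
             (sunada G e d t)%:R * theta d t (((4 * s)^-1)%:C)%C)
  /\
  (forall (G' : set (affine R n)) (e' : 'I_n -> 'cV[R]_n),
     Bieberbach G' -> diagonal_basis G' e' -> holonomy_iso_Z2 G' r ->
     [/\ p_isospectral G G' p <->
           (forall d t : nat, (1 <= t)%N -> (t <= d)%N -> (d <= n)%N ->
              (krawtchouk R n p).[(n - d)%:R] * (sunada G e d t)%:R =
              (krawtchouk R n p).[(n - d)%:R] * (sunada G' e' d t)%:R),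
         (forall d t : nat, (t <= d)%N -> (d <= n)%N ->
            sunada G e d t = sunada G' e' d t) ->
         forall q : nat, (q <= n)%N -> p_isospectral G G' q,
         (forall x : int, ~~ root (krawtchouk R n p) x%:~R) ->
         p_isospectral G G' p -> sunada_isospectral G e G' e'
       & p_isospectral G G' 0 -> sunada_isospectral G e G' e']).
Proof.
split => [s s0|G' e' HG' HGe' HGr']; first exact: heat_trace_theta.
have iso q := p_isospectral_sunada q HG HGe HGr HG' HGe' HGr'.
split.
- apply: iff_trans (iso p) _; split => H d t; first by move=> _; exact: H.
  (* For [t = 0] both numbers are 1 when [d = n] and 0 otherwise. *)
  case: t => [_ _|t]; last exact: H.
  by rewrite (sunada_d0_eq d HG HGe HGr HG' HGe' HGr').
- by move=> H q _; apply/iso => d t td dn; rewrite H.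
- move=> nroot /iso H d t td dn; apply/eqP; rewrite -(eqr_nat R); apply/eqP.
  (* The Krawtchouk factor is the value at the integer [n - d], hence nonzero and cancellable. *)
  by apply: mulfI (H d t td dn); exact: (nroot (n - d)%N).
- move=> /iso H d t td dn; apply/eqP; rewrite -(eqr_nat R); apply/eqP.
  by have := H d t td dn; rewrite krawtchouk0 !mul1r.
Qed.
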